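(* Assume the long range dependence (LRD) assumption: $c_k\sim k^{-\gamma}L_0(k)$ as $k\to\infty$ with $\gamma\in(1/2,1)$ and $L_0$ slowly varying at infinity. Suppose: (i) $B_1|t|^{\beta_0}\exp(-a|t|^\beta)\le|\phi_\epsilon(t)|\le B_2|t|^{\beta_0}\exp(-a|t|^\beta)$ as $t\to\infty$, for some $a>0$, $B_1,B_2,\beta>0$, $\beta_0\in\mathbb{R}$; (ii) $\phi_K$ has finite support $(-d,d)$; (iii) $|\phi_K(t)|\le B_3(d-t)^m$ and $\phi_K(t)\ge B_4(d-t)^m$ for $t\in(d-\delta_1,d)$, for positive constants $\delta_1,m,B_3,B_4$; (iv) as $t\to\infty$, either the real part of $\phi_\epsilon(t)$ is negligible with respect to its imaginary part, or the imaginary part is negligible with respect to the real part. Suppose moreover that $f_Y'$ is continuous and integrable and that for all $x,y$ (and all $k\ge1$) $$f_k(x,y)=f_Y(x)f_Y(y)+\rho_kf_Y'(x)f_Y'(y)+h_k(x,y),$$ where $f_k$ is the joint density of $(Y_0,Y_k)$, $\rho_k=\mathrm{E}X_0X_k$, and $|h_k(x,y)|\le|\rho_k|^{1+\delta}h(x)h(y)$ with $\delta>0$ and $h$ an integrable and continuous function. Then, choosing $h_n=d\left(\frac{2a}{(1-\theta)\ln n}\right)^{1/\beta}$ with $\theta\in(2-2\gamma,1)$, $$\mathrm{MSE}(f,h_n)=O\big((\ln n)^{-2/\beta}\big).$$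
   Context: Let $\{Z,Z_i,i\in\mathbb{Z}\}$ be i.i.d. centered real random variables with finite variance, and let $X_j=\sum_{k=0}^\infty c_kZ_{j-k}$ with $c_0=1$ be a stationary linear process with marginal density $f=f_X$. Let $\{\epsilon,\epsilon_j\}$ be i.i.d. with known density $f_\epsilon$ and characteristic function $\phi_\epsilon$, independent of the process $X$. One observes $Y_j=X_j+\epsilon_j$, $1\le j\le n$ (with $Y_0$ defined in the same way); $f_Y$ is the marginal density of $Y_j$. Fix $x_0\in\mathbb{R}$. Let $K$ be a kernel with $\int K(u)du=1$, $\phi_K(t)=\int_{\mathbb{R}}e^{itx}K(x)dx$, and let $h_n>0$ be bandwidths. The deconvolution estimator of $f(x_0)$ is $$\hat f_n(x_0)=\frac{1}{nh_n}\sum_{j=1}^ng_n\Big(\frac{x_0-Y_j}{h_n}\Big),\qquad g_n(x)=\frac1{2\pi}\int_{\mathbb{R}}e^{-itx}\frac{\phi_K(t)}{\phi_\epsilon(t/h_n)}dt,$$ and $\mathrm{MSE}(f,h_n)=\mathrm{E}(\hat f_n(x_0)-f(x_0))^2$. Standing assumptions: $f$ is twice differentiable with continuous and bounded second order derivative; $\int uK(u)du=0$ and $0\ne\int u^2K(u)du<\infty$; $|\phi_\epsilon(t)|>0$ for all $t$; $\phi_\epsilon$ and $\phi_K$ are twice differentiable with continuous and bounded derivatives. *)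

(* Defs.v *)
From HB Require Import structures.
From mathcomp Require Import all_boot all_order all_algebra.
From mathcomp Require Import all_classical all_reals all_analysis.
From mathcomp Require Import complex.

Set Implicit Arguments.
Unset Strict Implicit.
Unset Printing Implicit Defensive.

Import Order.TTheory GRing.Theory Num.Theory.
Import numFieldNormedType.Exports.

Local Open Scope classical_set_scope.
Local Open Scope ring_scope.

(* Lets the Landau notations be used at [+oo]. *)
Canonical pinfty_nbhs_filter_on (R : numFieldType) : filter_on R :=
  FilterType (pinfty_nbhs R) _.

Section RandomVariables.
Context {d : measure_display} {T : measurableType d} {R : realType}.
Variable P : probability T R.

Definition mutually_independent (I : choiceType) (X : I -> T -> R) : Prop :=
  forall (s : seq I) (B : I -> set (measurableTypeR R)), uniq s ->
    (forall i, measurable (B i)) ->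
    P (\bigcap_(i in [set` s]) (X i @^-1` B i)) =
    (\prod_(i <- s) P (X i @^-1` B i))%E.

(* Equality of laws is required on Borel sets only: [P] is unconstrained on
   nonmeasurable sets. *)
Definition identically_distributed (I : Type) (X : I -> T -> R) : Prop :=
  forall (i j : I) (B : set (measurableTypeR R)), measurable B ->
    P (X i @^-1` B) = P (X j @^-1` B).

Definition iid (I : choiceType) (X : I -> T -> R) : Prop :=
  mutually_independent X /\ identically_distributed X.

Definition sigma_process (I : Type) (X : I -> T -> R) : set (set T) :=
  <<s \bigcup_i preimage_set_system setT (X i)
        (@measurable _ (measurableTypeR R)) >>.

Definition independent_processes (I J : Type)
    (X : I -> T -> R) (Y : J -> T -> R) : Prop :=
  forall A B : set T, sigma_process X A -> sigma_process Y B ->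
    P (A `&` B) = (P A * P B)%E.

Definition strictly_stationary (X : int -> T -> R) : Prop :=
  forall (s : seq int) (m : int) (B : int -> set (measurableTypeR R)),
    (forall i, measurable (B i)) ->
    P (\bigcap_(i in [set` s]) (X (i + m) @^-1` B i)) =
    P (\bigcap_(i in [set` s]) (X i @^-1` B i)).

(* The infinite sum defining the process is an almost sure limit. *)
Definition linear_process (c : nat -> R) (Z X : int -> T -> R) : Prop :=
  forall j : int, {ae P, forall w,
    series (fun k : nat => c k * Z (j - k%:Z) w) @ \oo --> X j w}.

(* [p] is one fixed everywhere-defined version of the density. *)
Definition has_density {d' : measure_display} {S : measurableType d'}
    (mu : {measure set S -> \bar R}) (X : T -> S) (p : S -> R) : Prop :=
  [/\ measurable_fun setT (p : S -> measurableTypeR R),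
      (forall x, 0 <= p x) &
      forall A, measurable A -> P (X @^-1` A) = (\int[mu]_(x in A) (p x)%:E)%E].

Definition autocovariance (X : int -> T -> R) (k : nat) : R :=
  fine ('E_P[fun w => (X 0 w * X k%:Z w)%R])%E.

End RandomVariables.

Section Analysis.
Context {R : realType}.
Implicit Type t : R.

Notation leb := (@lebesgue_measure R).

Definition slowly_varying (L : R -> R) : Prop :=
  (exists A : R,
     measurable_fun `[A, +oo[ (L : measurableTypeR R -> measurableTypeR R) /\
     forall x, A <= x -> 0 < L x) /\
  forall lam : R, 0 < lam -> (L (lam * x) / L x) @[x --> +oo] --> (1 : R).

Definition lrd_coefficients (c : nat -> R) (gamma : R) (L0 : R -> R) : Prop :=
  [/\ 1 / 2 < gamma < 1, slowly_varying L0 &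
      c ~_\oo (fun k : nat => k%:R `^ (- gamma) * L0 k%:R)].

Definition bounded_fct (u : R -> R) : Prop := exists M : R, forall x, `|u x| <= M.

Definition twice_differentiable (u : R -> R) : Prop :=
  forall x, derivable u x 1 /\ derivable (derive1 u) x 1.

Definition twice_differentiable_bounded (u : R -> R) : Prop :=
  [/\ twice_differentiable u,
      continuous (derive1 u) /\ bounded_fct (derive1 u) &
      continuous (derive1n 2 u) /\ bounded_fct (derive1n 2 u)].

Definition expi t : R[i] := (cos t +i* sin t)%C.

Definition Cintegral {d : measure_display} {S : measurableType d}
    (mu : {measure set S -> \bar R}) (F : S -> R[i]) : R[i] :=
  ((\int[mu]_x complex.Re (F x)) +i* (\int[mu]_x complex.Im (F x)))%C.

Definition fourier (K : R -> R) t : R[i] :=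
  Cintegral leb (fun x => expi (t * x) * (K x)%:C%C).

Definition characteristic_fun {d : measure_display} {T : measurableType d}
    (P : probability T R) (X : T -> R) t : R[i] :=
  Cintegral P (fun w => expi (t * X w)).

Definition deconv_kernel (phiK phie : R -> R[i]) (h x : R) : R[i] :=
  ((2 * pi)^-1)%:C%C *
  Cintegral leb (fun t => expi (- (t * x)) * (phiK t / phie (t / h))).

Definition deconv_estimator {T : Type} (phiK phie : R -> R[i])
    (Y : nat -> T -> R) (x0 h : R) (n : nat) (w : T) : R[i] :=
  ((n%:R * h)^-1)%:C%C *
  \sum_(1 <= j < n.+1) deconv_kernel phiK phie h ((x0 - Y j w) / h).

(* The integrand of [deconv_kernel] is Hermitian in [t], so the estimator is
   real; taking the squared modulus of the complex error drops nothing. *)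
Definition MSE {d : measure_display} {T : measurableType d}
    (P : probability T R) (fhat : T -> R[i]) (v : R) : \bar R :=
  'E_P[fun w => (Normc.normc (fhat w - v%:C%C) ^+ 2)%R]%E.

End Analysis.

(* Main.v *)
Require Import Defs.
From HB Require Import structures.
From mathcomp Require Import all_boot all_order all_algebra.
From mathcomp Require Import all_classical all_reals all_analysis.
From mathcomp Require Import complex measurable_realfun.
From mathcomp Require Import ring lra zify.

(** The mean squared error splits into a squared bias and the variances of
    the real and imaginary parts of the estimator ([mse_le]).

    Bias.  Signal and noise being independent, the expectation of the
    deconvolution kernel no longer involves the noise: it is the inverse
    Fourier integral of phi_K(t) phi_X(t/h).  The inversion goes through the
    damping factor 2 exp(-s|t|) - exp(-2s|t|), whose transform is a nonnegative
    kernel of finite mass with a finite second moment; Fubini turns the damped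
    integral into an average of E[kernel (X - x0 + h u)] against K(u) du.  Near
    x0 the density f varies at most quadratically, so for s = h this average is
    within O(h) of f(x0), and so is the undamped one ([bias_le]).  A squared
    bias O(h^2) is exactly the announced rate.

    Variance.  The law of (Y_i, Y_(i+k)) depends on k only, so the assumed
    expansion of the joint density bounds the covariance of g(Y_i) and
    g(Y_(i+k)) by a constant times sup|g|^2 (|rho_k| + |rho_k|^(1+delta))
    ([observations_cov_le]).  For a linear process with coefficients
    c_k ~ k^(-gamma) L0(k), rho_k is O(k^(-p)) for every p < 2 gamma - 1
    ([linear_process_autocovariance_le]); this rests on the uniform convergence
    theorem for measurable slowly varying functions, used in the form
    [slowly_varying_doubling].  The variance of an empirical mean of g is
    therefore O(sup|g|^2 n^(-p')) for every p' < 2 gamma - 1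
    ([empirical_mean_variance_le]).

    Rate.  The lower bound on |phi_eps| and the choice of the bandwidth make
    the squared supremum of the deconvolution kernel at most n^(1-theta) times
    a power of ln n.  As theta > 2 - 2 gamma, the variance decays like a
    negative power of n, which is negligible against the squared bias. *)

Set Implicit Arguments.
Unset Strict Implicit.
Unset Printing Implicit Defensive.

Import Order.TTheory GRing.Theory Num.Theory.
Import numFieldNormedType.Exports.

Local Open Scope classical_set_scope.
Local Open Scope ring_scope.

(** * Slowly varying functions and power bounds for the coefficients *)

Section SlowVariation.
Context {R : realType}.
Notation mu := (@lebesgue_measure R).

Lemma lebesgue_measure_shift (s : R) (A : set (measurableTypeR R)) :
  measurable A ->
  mu (((fun t : R => t + s) : measurableTypeR R -> measurableTypeR R) @^-1` A) = mu A.
Proof.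
move=> mA.
have ms : measurable_fun setT ((fun t : R => t + s) : measurableTypeR R -> measurableTypeR R).
  by apply: measurable_funD.
pose f : {mfun measurableTypeR R >-> measurableTypeR R} :=
  HB.pack ((fun t : R => t + s) : measurableTypeR R -> measurableTypeR R)
    (isMeasurableFun.Build _ _ _ _ _ ms).
rewrite -[LHS]/(pushforward mu f A).
apply/esym/lebesgue_measure_unique => // _ [[a b]] _ <- /=.
rewrite /pushforward.
rewrite (_ : _ @^-1` _ = `](a - s)%R, (b - s)%R]%classic); last first.
  by apply/seteqP; split=> x /=; rewrite !in_itv/= ltrBlDr lerBrDr.
rewrite !lebesgue_measure_itv /= !lte_fin ltrD2r; case: ifP => // _.
by rewrite -!EFinB; congr (_%:E); ring.
Qed.

(** The uniform convergence theorem for slowly varying functions, at integers: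
    L(k) is almost at most L(m) for m <= k <= 2m, uniformly in large m.  The
    sets of those t in [0, 2] for which L(m exp t) / L(m) is close to 1 for all
    m >= N exhaust [0, 2]; once such a set has measure above 3/2 it meets its
    translate by ln (k/m), and a common point compares L(k) with L(m). *)
Lemma slowly_varying_doubling (L : R -> R) (e : R) : slowly_varying L -> 0 < e ->
  exists N : nat, forall m : nat, (N <= m)%N -> 0 < L m%:R /\
    forall k : nat, (m <= k <= m.*2)%N -> (1 - e) * L k%:R <= (1 + e) * L m%:R.
Proof.
move=> [[A [mL Lpos]] HL] e0.
pose N0 := (Num.truncn A).+1.
have N0A m : (N0 <= m)%N -> A <= m%:R.
  move=> Nm; apply/ltW/(lt_le_trans (truncnS_gt A)).
  by rewrite ler_nat.
pose B n := \bigcap_(m in [set m | (N0 + n <= m)%N])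
   (`[0, 2]%classic `&`
    [set t : R | `|L (m%:R * expR t) / L m%:R - 1| < e]) : set (measurableTypeR R).
have mB n : measurable (B n).
  apply: bigcap_measurable; first by exists (N0 + n)%N => /=.
  move=> m /= Nm.
  have N0m : (N0 <= m)%N by apply: leq_trans Nm; rewrite leq_addr.
  have H : measurable_fun (`[0, 2]%classic : set (measurableTypeR R))
      ((fun t : R => `|L (m%:R * expR t) / L m%:R - 1|) : measurableTypeR R -> measurableTypeR R).
    apply: measurableT_comp => //; apply: measurable_funB => //.
    apply: measurable_funM => //.
    apply: (@measurable_comp _ _ _ _ _ _ (`[A, +oo[%classic : set (measurableTypeR R)) _ _
      ((fun t : R => m%:R * expR t) : measurableTypeR R -> measurableTypeR R)).
    - exact: measurable_itv.
    - move=> y [t tI <-]; move: tI => /=; rewrite in_itv/= => /andP[t0 _].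
      rewrite in_itv/= andbT (le_trans (N0A _ N0m))// ler_peMr//.
      by rewrite -expR0 ler_expR.
    - exact: mL.
    - by apply: measurable_funM => //; apply: measurable_funTS; exact: measurable_expR.
  have := H (measurable_itv _) _ (measurable_itv `]-oo, e[).
  congr measurable; apply/seteqP; split=> t /=; rewrite in_itv//=.
have ndB : nondecreasing_seq B.
  move=> n1 n2 n12; apply/subsetPset => t Bt m /= Nm; apply: Bt => /=.
  by apply: leq_trans Nm; rewrite leq_add2l.
have UB : \bigcup_n B n = `[0, 2]%classic.
  apply/seteqP; split=> t.
    by move=> [n _ /(_ (N0 + n)%N) /= ]; case => //.
  move=> t02.
  have : \forall x \near +oo, `|L (expR t * x) / L x - 1| < e.
    have /cvgrPdist_lt /(_ _ e0) := HL _ (expR_gt0 t).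
    by apply: filterS => x; rewrite distrC.
  move=> [M [_ HM]].
  exists (Num.truncn M).+1 => // m /= Nm; split => //=.
  rewrite (mulrC m%:R); apply: (HM m%:R).
  apply: (lt_le_trans (truncnS_gt M)); rewrite ler_nat.
  by apply: leq_trans Nm; rewrite leq_addl.
have cvB : (mu \o B) n @[n --> \oo] --> mu (\bigcup_n B n).
  by apply: nondecreasing_cvg_mu => //; apply: bigcup_measurable.
have [n Bn] : exists n, ((3 / 2)%:E < mu (B n))%E.
  rewrite UB lebesgue_measure_itv /= lte_fin ltr0n /= sube0 in cvB.
  have : \forall n \near \oo, ((3/2)%:E < mu (B n))%E.
    apply: (cvB [set x | ((3/2)%:E < x)%E]).
    apply: open_nbhs_nbhs; split; first exact: open_ereal_gt_ereal.
    by rewrite /= lte_fin; lra.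
  by move=> [n _ /(_ n) Hn]; exists n; apply: Hn => /=.
exists (N0 + n)%N => m Nm.
have Lm k : (N0 + n <= k)%N -> 0 < L k%:R.
  by move=> Nk; apply/Lpos/N0A/(leq_trans _ Nk); rewrite leq_addr.
split; [exact: Lm|move=> k /andP[mk k2m]].
have Nk := leq_trans Nm mk.
have m0 : 0 < m%:R :> R by rewrite ltr0n; apply: leq_trans Nm; rewrite ltn_addr.
have k0 : 0 < k%:R :> R by rewrite (lt_le_trans m0)// ler_nat.
pose s := ln (k%:R / m%:R : R).
have es : expR s = k%:R / m%:R by rewrite lnK// posrE divr_gt0.
have s0 : 0 <= s by rewrite ln_ge0// ler_pdivlMr// mul1r ler_nat.
have s1 : s <= 1.
  have : k%:R / m%:R <= expR 1 :> R.
    apply: le_trans (expR_ge1Dx 1).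
    rewrite ler_pdivrMr//; rewrite -(natrD _ 1 1) -natrM ler_nat.
    by rewrite mulnC muln2.
  by rewrite -es ler_expR.
pose C := ((fun t : R => t + (- s)) : measurableTypeR R -> measurableTypeR R) @^-1` B n.
have mC : measurable C.
  have mf : measurable_fun setT
      ((fun t : R => t + - s) : measurableTypeR R -> measurableTypeR R).
    by apply: measurable_funD.
  by rewrite -[C]setTI; apply: mf => //; exact: mB.
have muC : mu C = mu (B n) by rewrite lebesgue_measure_shift.
have [dis|/eqP/set0P [t [Bt Ct]]] := pselect (B n `&` C = set0); last first.
  pose u := t - s.
  have [_ /= Ht] := Bt _ Nm.
  have [_ /= Hu] := Ct _ Nk.
  rewrite expRD expRN es in Hu.
  have E : k%:R * (expR t * (k%:R / m%:R)^-1) = m%:R * expR t.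
    by field; rewrite !gt_eqF.
  rewrite E in Hu.
  move: Ht Hu; set q := L _.
  have Lm0 := Lm _ Nm; have Lk0 := Lm _ Nk.
  rewrite !ltr_norml => /andP[_ q1] /andP[q2 _].
  have q1' : q <= (1 + e) * L m%:R by rewrite -ler_pdivrMr//; lra.
  apply: (le_trans _ q1').
  by rewrite -ler_pdivlMr//; lra.
exfalso.
have : (mu (B n `|` C) <= mu `[0%R, 3%R])%E.
  apply: le_measure; rewrite ?inE//; first exact: measurableU.
  move=> t [/(_ _ (leqnn _))[]|/(_ _ (leqnn _))[]] /=; rewrite !in_itv/=.
    by move=> /andP[-> +] _ => /le_trans; apply; rewrite ler_nat.
  move=> /andP[a b] _; apply/andP; split; lra.
have -> : mu (B n `|` C) = (mu (B n) + mu (B n))%E.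
  by rewrite -[in X in (_ + X)%E]muC; exact: measureU.
rewrite lebesgue_measure_itv /= lte_fin ltr0n /= sube0.
apply/negP; rewrite -ltNge.
have -> : 3%:E = ((3/2)%:E + (3/2)%:E :> \bar R)%E.
  by rewrite -EFinD; congr (_%:E); field.
exact: lteD.
Qed.

End SlowVariation.

Section PowerBounds.
Context {R : realType}.

(** Potter's upper bound at integers. *)
Lemma slowly_varying_nat_le_powR (L : R -> R) (eta : R) :
  slowly_varying L -> 0 < eta ->
  exists2 C : R, 0 < C & exists N : nat, forall k, (N <= k)%N ->
    0 < L k%:R <= C * k%:R `^ eta.
Proof.
move=> HL eta0; pose q : R := (3 / 4) `^ eta.
have q0 : 0 < q by apply: powR_gt0; lra.
have q1 : q < 1.
  have -> : 1 = 1 `^ eta :> R by rewrite powR1.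
  by apply: gt0_ltr_powR => //; rewrite ?nnegrE; lra.
(* This choice makes (1 - e) / (1 + e) equal to q. *)
pose e : R := (1 - q) / (1 + q).
have e0 : 0 < e by apply: divr_gt0; lra.
have [N HN] := slowly_varying_doubling HL e0.
have Hq m k : (N <= m)%N -> (m <= k <= m.*2)%N -> q * L k%:R <= L m%:R.
  move=> Nm /(proj2 (HN m Nm) k).
  have -> : 1 - e = q * (2 / (1 + q)) by rewrite /e; field; lra.
  have -> : 1 + e = 2 / (1 + q) by rewrite /e; field; lra.
  have h : 0 < 2 / (1 + q) by apply: divr_gt0; lra.
  by rewrite -mulrA (mulrCA q) ler_pM2l.
pose M : R := 1 + \sum_(i < (N.+1).*2.+1) `|L i%:R|.
have S0 : 0 <= \sum_(i < (N.+1).*2.+1) `|L i%:R| by apply: sumr_ge0.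
have M0 : 0 < M by rewrite /M; lra.
exists M => //; exists N.+1 => k Nk.
rewrite (proj1 (HN k (ltnW Nk))) /=.
have [n] := ubnP k; elim: n k Nk => // n IH k Nk kn.
have k1 : 1 <= k%:R :> R by rewrite ler1n; apply: leq_ltn_trans Nk.
have [k2|k2] := leqP k (N.+1).*2.
  have kM : L k%:R <= M.
    apply: (le_trans (ler_norm _)).
    rewrite /M (bigD1 (Ordinal (k2 : (k < (N.+1).*2.+1)%N)))//=.
    have : 0 <= \sum_(i < (N.+1).*2.+1 | i != Ordinal (k2 : (k < (N.+1).*2.+1)%N)) `|L i%:R|.
      by apply: sumr_ge0.
    lra.
  apply: (le_trans kM); rewrite ler_peMr ?(ltW M0)//.
  rewrite -[leLHS]/(cst 1 eta) -[cst 1]/(fun=> 1) -powR1.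
  by apply: ge0_ler_powR; rewrite ?nnegrE ?(ltW eta0)//; lra.
(* Halving: m <= k <= 2m, and m <= 3k/4 since k is at least 2. *)
pose m := uphalf k.
have Nm : (N < m)%N by rewrite /m; lia.
have mk : (m <= k <= m.*2)%N by rewrite /m; lia.
have mn : (m < n)%N by rewrite /m; lia.
have m34 : m%:R <= 3 / 4 * k%:R :> R.
  have : (4 * m <= 3 * k)%N by rewrite /m; lia.
  by rewrite -(ler_nat R) !natrM; lra.
have := IH m Nm mn.
have := Hq m k (ltnW Nm) mk.
have : m%:R `^ eta <= q * k%:R `^ eta.
  rewrite /q -powRM ?divr_ge0 ?ler0n//.
  by apply: ge0_ler_powR; rewrite ?nnegrE ?(ltW eta0)//; lra.
move=> h1 h2 h3.
rewrite -(ler_pM2l q0); apply: (le_trans h2); apply: (le_trans h3).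
by rewrite mulrCA ler_pM2l.
Qed.

Lemma lrd_coefficients_le (c : nat -> R) (gamma : R) (L0 : R -> R) (eta : R) :
  lrd_coefficients c gamma L0 -> 0 < eta < gamma ->
  exists2 C : R, 0 < C & forall k, `|c k| <= C * k.+1%:R `^ (eta - gamma).
Proof.
move=> [/andP[g1 g2] HL Hc] /andP[eta0 etag].
have [C C0 [N HN]] := slowly_varying_nat_le_powR HL eta0.
have : \forall k \near \oo, `|c k - k%:R `^ (- gamma) * L0 k%:R| <=
    1 * `|k%:R `^ (- gamma) * L0 k%:R|.
  by have /eqaddoP := Hc; apply.
move=> [N1 _ HN1].
pose N2 := (maxn N N1).+1.
pose p := gamma - eta.
have p0 : 0 < p by rewrite /p; lra.
have -> : eta - gamma = - p by rewrite /p; lra.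
pose D : R := \sum_(i < N2) `|c i| * N2%:R `^ p.
have D0 : 0 <= D by apply: sumr_ge0 => i _; rewrite mulr_ge0// powR_ge0.
exists (2 * C * 2 `^ p + D).
  have : 0 < 2 * C * 2 `^ p by rewrite !mulr_gt0// powR_gt0.
  by move: D0; lra.
move=> k; rewrite mulrDl.
have k1 : 0 < k.+1%:R :> R by rewrite ltr0n.
have [Nk|Nk] := leqP N2 k.
  have /HN1 /= := (leq_trans (leq_maxr N N1) (ltnW Nk)).
  have /HN /andP[L1 L2] := (leq_trans (leq_maxl N N1) (ltnW Nk)).
  have k0 : 0 < k%:R :> R by rewrite ltr0n; apply: leq_ltn_trans Nk.
  have kg : 0 < k%:R `^ (- gamma) by apply: powR_gt0.
  rewrite mul1r (ger0_norm (mulr_ge0 (ltW kg) (ltW L1))) => h.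
  have h2 : `|c k| <= 2 * (k%:R `^ (- gamma) * L0 k%:R).
    move: h; set w := k%:R `^ _ * _; set v := c k.
    have : `|v| <= `|v - w| + `|w|.
      by rewrite -{1}[v](subrK w); exact: ler_normD.
    have : `|w| = w by apply: ger0_norm; rewrite mulr_ge0 ?ltW.
    by lra.
  apply: (@le_trans _ _ (2 * C * 2 `^ p * k.+1%:R `^ (- p))); last first.
    by rewrite lerDl mulr_ge0// powR_ge0.
  apply: (le_trans h2); rewrite -!mulrA ler_pM2l//.
  apply: (@le_trans _ _ (C * k%:R `^ (- p))).
    have -> : k%:R `^ (- p) = k%:R `^ (- gamma) * k%:R `^ eta :> R.
      by rewrite -powRD ?(gt_eqF k0) ?implybT//; congr (_ `^ _); rewrite /p; lra.
    by rewrite mulrCA ler_pM2l.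
  rewrite ler_pM2l// !powRN ler_pdivlMr ?powR_gt0// mulrC ler_pdivrMr ?powR_gt0//.
  rewrite -powRM//; apply: ge0_ler_powR; rewrite ?nnegrE ?(ltW p0)//.
  by rewrite -natrM ler_nat mul2n -addnn -addn1 leq_add2l (leq_ltn_trans _ Nk).
have : `|c k| <= D * k.+1%:R `^ (- p).
  rewrite powRN ler_pdivlMr ?powR_gt0//.
  rewrite /D (bigD1 (Ordinal Nk))//=.
  apply: (@le_trans _ _ (`|c k| * N2%:R `^ p)).
    rewrite ler_wpM2l//.
    by apply: ge0_ler_powR; rewrite ?nnegrE ?(ltW p0)// ler_nat.
  by rewrite lerDl; apply: sumr_ge0 => i _; rewrite mulr_ge0// powR_ge0.
have : 0 <= 2 * C * 2 `^ p * k.+1%:R `^ (- p).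
  by rewrite !mulr_ge0 ?powR_ge0 ?(ltW C0).
lra.
Qed.

(** Convergence of the Riemann series, from the telescoping bound
    eta (k+2)^(-1-eta) <= (k+1)^(-eta) - (k+2)^(-eta). *)
Lemma sum_powR_le (eta : R) : 0 < eta ->
  exists2 S : R, 0 < S & forall n, \sum_(k < n) k.+1%:R `^ (- (1 + eta)) <= S.
Proof.
move=> eta0; exists (1 + eta^-1); first by rewrite addr_gt0 ?invr_gt0.
pose a (k : nat) : R := k.+1%:R `^ (- eta).
have step k : eta * k.+2%:R `^ (- (1 + eta)) <= a k - a k.+1.
  rewrite /a.
  have k1 : 0 < k.+1%:R :> R by rewrite ltr0n.
  have k2 : 0 < k.+2%:R :> R by rewrite ltr0n.
  have -> : k.+2%:R `^ (- (1 + eta)) = k.+2%:R `^ (- eta) / k.+2%:R :> R.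
    rewrite opprD addrC powRB ?(gt_eqF k2) ?implybT//.
    by rewrite powRr1 ?ltW.
  have -> : k.+1%:R `^ (- eta) = k.+2%:R `^ (- eta) * (k.+1%:R / k.+2%:R) `^ (- eta) :> R.
    rewrite -powRM ?ltW ?divr_gt0//; congr (_ `^ _).
    by field; rewrite ?gt_eqF.
  rewrite -[X in _ <= _ - X]mulr1 -mulrBr mulrCA ler_pM2l ?powR_gt0//.
  rewrite lerBrDl /powR ifF ?gt_eqF ?divr_gt0//.
  apply: le_trans (expR_ge1Dx _).
  rewrite lerD2l mulNr -mulrN ler_pM2l//.
  have -> : k.+1%:R / k.+2%:R = 1 + (- (k.+2%:R)^-1) :> R.
    by rewrite -[k.+1%:R](addrK 1) natr1 mulrBl divff ?gt_eqF// mul1r.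
  rewrite lerNr; apply: le_ln1Dx.
  by rewrite ltrN2 invf_lt1// ltr1n.
case=> [|n]; first by rewrite big_ord0 addr_ge0 ?invr_ge0 ?ltW.
rewrite big_ord_recl powR1 lerD2l -[leRHS]mul1r ler_pdivlMr// mulr_suml.
apply: (@le_trans _ _ (\sum_(i < n) (a i - a i.+1))).
  by apply: ler_sum => i _; rewrite mulrC; exact: step.
rewrite -(big_mkord xpredT (fun i => a i - a i.+1)).
have -> : \sum_(0 <= i < n) (a i - a i.+1) = a 0%N - a n.
  by rewrite -opprB -telescope_sumr// -sumrN; apply: eq_bigr => i _; rewrite opprB.
by rewrite /a powR1 lerBlDr lerDl powR_ge0.
Qed.

End PowerBounds.

(** * Independence, densities and expectations *)

Section Laws.
Context {d : measure_display} {T : measurableType d} {R : realType}.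
Variable P : probability T R.

(** A measurable function bundled with its measurability proof. *)
Definition mkmfun {d1 d2} {T1 : measurableType d1} {T2 : measurableType d2}
    (f : T1 -> T2) (mf : measurable_fun setT f) : {mfun T1 >-> T2} :=
  HB.pack f (isMeasurableFun.Build d1 d2 T1 T2 f mf).

Context {d1 d2 : measure_display} {T1 : measurableType d1} {T2 : measurableType d2}.

(** Decoupling: if U and V are independent, the second variable may be
    replaced by an independent copy, here the same V on another copy of the
    probability space. *)
Lemma ge0_integral_indep (U : {mfun T >-> T1}) (V : {mfun T >-> T2}) :
  (forall A B, measurable A -> measurable B ->
     P ((U : T -> T1) @^-1` A `&` (V : T -> T2) @^-1` B) =
     (P ((U : T -> T1) @^-1` A) * P ((V : T -> T2) @^-1` B))%E) ->
  forall F : T1 * T2 -> \bar R, measurable_fun setT F -> (forall z, 0 <= F z)%E ->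
  (\int[P]_w F (U w, V w) = \int[P]_w \int[P]_w' F (U w, V w'))%E.
Proof.
move=> UV F mF F0.
have mp : measurable_fun setT (fun w => (U w, V w)).
  by apply: measurable_fun_pair.
pose W := mkmfun mp.
pose muU := distribution P U; pose muV := distribution P V.
have E : forall C, measurable C -> (muU \x muV)%E C = distribution P W C.
  by apply: product_measure_unique => A B mA mB; exact: UV.
transitivity (\int[distribution P W]_z F z)%E.
  by rewrite ge0_integral_pushforward.
transitivity (\int[muU \x muV]_z F z)%E.
  by apply: eq_measure_integral => C mC _; exact/esym/E.
rewrite fubini_tonelli1// ge0_integral_pushforward//; last 2 first.
- exact: measurable_fun_fubini_tonelli_F.
- by move=> y _; apply: integral_ge0.
apply: eq_integral => w _ /=; rewrite /fubini_F ge0_integral_pushforward//.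
exact: measurable_fun_pair2.
Qed.

(** Two pairs agreeing on measurable rectangles have the same law. *)
Lemma law_pair_unique (U U' : {mfun T >-> T1}) (V V' : {mfun T >-> T2}) :
  (forall A B, measurable A -> measurable B ->
     P ((U : T -> T1) @^-1` A `&` (V : T -> T2) @^-1` B) =
     P ((U' : T -> T1) @^-1` A `&` (V' : T -> T2) @^-1` B)) ->
  forall C, measurable C ->
  P ((fun w => (U w, V w)) @^-1` C) = P ((fun w => (U' w, V' w)) @^-1` C).
Proof.
move=> UV.
have mp : measurable_fun setT (fun w => (U w, V w)).
  by apply: measurable_fun_pair.
have mp' : measurable_fun setT (fun w => (U' w, V' w)).
  by apply: measurable_fun_pair.
pose W := mkmfun mp; pose W' := mkmfun mp'.
move=> C mC; rewrite -[LHS]/(distribution P W C) -[RHS]/(distribution P W' C).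
apply: (measure_unique
  [set C | exists A, measurable A /\ exists B, measurable B /\ C = A `*` B]
  (fun n => setT)) => //.
- rewrite measurable_prod_measurableType //; congr (<<s _ >>).
  rewrite predeqE; split => [[A mA [B mB <-]]|[A [mA [B [mB ->]]]]].
    by exists A; split => //; exists B.
  by exists A => //; exists B.
- move=> /= _ _ [X1 [mX1 [X2 [mX2 ->]]]] [Y1 [mY1 [Y2 [mY2 ->]]]].
  rewrite -setXI; exists (X1 `&` Y1); split; first exact: measurableI.
  by exists (X2 `&` Y2); split => //; exact: measurableI.
- by move=> n; exists setT; split => //; exists setT; split => //; rewrite setXTT.
- by rewrite bigcup_const.
- by move=> A [A1 [mA1 [A2 [mA2 ->]]]]; exact: UV.
- by move=> k; rewrite /= /distribution /pushforward preimage_setT probability_setT ltry.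
Qed.

End Laws.

Section Density.
Context {d : measure_display} {T : measurableType d} {R : realType}.
Variable P : probability T R.
Context {d1 : measure_display} {S : measurableType d1}.
Variable mu : {measure set S -> \bar R}.

Import HBNNSimple.

(** Transfer of expectations to the density; the general case of a
    nonnegative F follows from simple functions by monotone convergence. *)
Lemma ge0_integral_density (X : {mfun T >-> S}) (p : S -> R) :
  has_density P mu X p ->
  forall F : S -> \bar R, measurable_fun setT F -> (forall z, 0 <= F z)%E ->
  (\int[P]_w F (X w) = \int[mu]_x (F x * (p x)%:E))%E.
Proof.
move=> [mp p0 HX] F mF F0.
have mpE : measurable_fun setT (fun x => (p x)%:E).
  by apply/measurable_EFinP.
have p0E x : (0 <= (p x)%:E)%E by rewrite lee_fin.
pose nu := distribution P X.
have nuE A : measurable A -> nu A = (\int[mu]_(x in A) (p x)%:E)%E by exact: HX.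
transitivity (\int[nu]_x F x)%E; first by rewrite ge0_integral_pushforward.
pose h := nnsfun_approx measurableT mF.
have hF x : F x = lim ((EFin \o h n) x @[n --> \oo]).
  by apply/esym/cvg_lim => //; exact: cvg_nnsfun_approx.
have ndh x : nondecreasing_seq (fun n => h n x).
  by move=> a b ab; exact/lefP/nd_nnsfun_approx.
transitivity (lim (\int[nu]_x (EFin \o h n) x @[n --> \oo]))%E.
  under eq_integral do rewrite hF.
  apply: monotone_convergence => //.
  - by move=> n; apply/measurable_EFinP; exact/measurable_funP.
  - by move=> n x _ /=; rewrite lee_fin.
  - by move=> x _ a b ab; rewrite lee_fin; exact: ndh.
transitivity (lim (\int[mu]_x ((EFin \o h n) x * (p x)%:E) @[n --> \oo]))%E; last first.
  rewrite -monotone_convergence//.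
  - apply: eq_integral => x _; apply/cvg_lim => //.
    by apply: cvgeZr; [|exact: cvg_nnsfun_approx].
  - move=> n; apply/emeasurable_funM => //.
    by apply/measurable_EFinP; exact/measurable_funP.
  - by move=> n x _ /=; rewrite mule_ge0 ?lee_fin.
  - by move=> x _ a b ab; rewrite lee_wpmul2r// lee_fin; exact: ndh.
suff suf n : (\int[nu]_x (EFin \o h n) x =
    \int[mu]_x ((EFin \o h n) x * (p x)%:E))%E.
  by under eq_fun do rewrite suf.
transitivity (\int[nu]_x
   (\sum_(y \in range (h n)) (y * \1_(h n @^-1` [set y]) x)%:E))%E.
  by apply: eq_integral => t tE; rewrite /= fimfunE -fsumEFin.
have indich m r : measurable_fun setT (fun x => (r * \1_(h m @^-1` [set r]) x)%:E).
  by apply: (measurable_comp measurableT) => //; exact: measurable_funM.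
rewrite ge0_integral_fsum//; last by move=> m y Ey; exact: nnfun_muleindic_ge0.
transitivity (\int[mu]_x (\sum_(y \in range (h n))
    (y * \1_(h n @^-1` [set y]) x)%:E * (p x)%:E))%E; last first.
  apply: eq_integral => x xE.
  rewrite -ge0_mule_fsuml => [|y]; last exact: nnfun_muleindic_ge0.
  by rewrite fsumEFin // -(fimfunE _ x).
rewrite ge0_integral_fsum//; last 2 first.
  - by move=> y; apply: emeasurable_funM.
  - by move=> m y Ey; rewrite mule_ge0// nnfun_muleindic_ge0.
apply: eq_fsbigr => r rhn.
have mh : measurable (h n @^-1` [set r]) by exact: measurable_sfunP.
under eq_integral do rewrite EFinM.
rewrite integralZl_indic_nnsfun => //.
under [RHS]eq_integral do rewrite EFinM -muleA.
rewrite ge0_integralZl//.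
- under [in RHS]eq_integral do rewrite muleC.
  rewrite [in RHS](eq_integral ((fun x => (p x)%:E) \_ (h n @^-1` [set r]))); last first.
    by move=> x xE; rewrite epatch_indic.
  by rewrite -integral_mkcond -nuE// integral_indic// setIT.
- by apply: emeasurable_funM => //; exact/measurable_EFinP.
- by move=> t _; rewrite mule_ge0// lee_fin.
- by move: rhn; rewrite inE => -[t _ <-]; rewrite lee_fin.
Qed.

End Density.

Section Expectations.
Context {d : measure_display} {T : measurableType d} {R : realType}.
Variable P : probability T R.
Context {d1 d2 : measure_display} {T1 : measurableType d1} {T2 : measurableType d2}.

Lemma integral_indep (U : {mfun T >-> T1}) (V : {mfun T >-> T2}) :
  (forall A B, measurable A -> measurable B ->
     P ((U : T -> T1) @^-1` A `&` (V : T -> T2) @^-1` B) =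
     (P ((U : T -> T1) @^-1` A) * P ((V : T -> T2) @^-1` B))%E) ->
  forall F : T1 * T2 -> \bar R, measurable_fun setT F ->
  P.-integrable setT (fun w => F (U w, V w)) ->
  (\int[P]_w F (U w, V w) = \int[P]_w \int[P]_w' F (U w, V w'))%E.
Proof.
move=> UV F mF iF.
have mpair : measurable_fun setT (fun z : T * T => (U z.1, V z.2)).
  by apply: measurable_fun_pair; apply: measurableT_comp.
have Ep (S : Type) (g : S -> T1 * T2) : ((fun w => F (g w))^\+ = (fun w => F^\+ (g w)))%E.
  exact: (funepos_comp F g).
have En (S : Type) (g : S -> T1 * T2) : ((fun w => F (g w))^\- = (fun w => F^\- (g w)))%E.
  exact: (funeneg_comp F g).
pose A w := (\int[P]_w' (F^\+ (U w, V w')))%E.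
pose B w := (\int[P]_w' (F^\- (U w, V w')))%E.
have mA : measurable_fun setT A.
  apply: (measurable_fun_fubini_tonelli_F (fun z : T * T => F^\+ (U z.1, V z.2)))%E => //.
  by apply: (measurableT_comp (measurable_funepos mF)).
have mB : measurable_fun setT B.
  apply: (measurable_fun_fubini_tonelli_F (fun z : T * T => F^\- (U z.1, V z.2)))%E => //.
  by apply: (measurableT_comp (measurable_funeneg mF)).
have EA : (\int[P]_w A w = \int[P]_w F^\+ (U w, V w))%E.
  by rewrite -(ge0_integral_indep UV)//; exact: measurable_funepos.
have EB : (\int[P]_w B w = \int[P]_w F^\- (U w, V w))%E.
  by rewrite -(ge0_integral_indep UV)//; exact: measurable_funeneg.
have A0 w : (0 <= A w)%E by apply: integral_ge0.
have B0 w : (0 <= B w)%E by apply: integral_ge0.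
have iA : P.-integrable setT A.
  apply/integrableP; split => //.
  under eq_integral do rewrite gee0_abs//.
  rewrite EA; have := integral_funepos_lt_pinfty measurableT iF.
  by rewrite (Ep _ (fun w => (U w, V w))) => h; exact: h.
have iB : P.-integrable setT B.
  apply/integrableP; split => //.
  under eq_integral do rewrite gee0_abs//.
  rewrite EB; have := integral_funeneg_lt_pinfty measurableT iF.
  by rewrite (En _ (fun w => (U w, V w))) => h; exact: h.
rewrite integralE (Ep _ (fun w => (U w, V w))) (En _ (fun w => (U w, V w))).
rewrite -[X in (X - _)%E]EA -[X in (_ - X)%E]EB -integralB//.
apply: eq_integral => w _ /=.
by rewrite [RHS]integralE (Ep _ (fun v => (U w, V v))) (En _ (fun v => (U w, V v))).
Qed.

End Expectations.

Section RealExpectations.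
Context {d : measure_display} {T : measurableType d} {R : realType}.
Variable P : probability T R.

Lemma Rintegral_prob_cst (r : R) : \int[P]_w r = r.
Proof. by have := expectation_cst P r; rewrite unlock /Rintegral => ->. Qed.

Lemma bounded_integrable {d1} {S : measurableType d1} {mu : {measure set S -> \bar R}}
    (g u : S -> R) (M : R) :
  measurable_fun setT g -> (forall x, `|g x| <= M) ->
  mu.-integrable setT (EFin \o u) ->
  mu.-integrable setT (EFin \o (fun x => g x * u x)).
Proof.
move=> mg gM iu.
apply: (@le_integrable _ _ _ _ _ _ _ (fun x => (M%:E * (u x)%:E)%E)) => //.
- apply/measurable_EFinP; apply: measurable_funM => //.
  by apply/measurable_EFinP; exact: measurable_int iu.
- move=> x _ /=; rewrite lee_fin !normrM ler_wpM2r// (le_trans (gM x))//.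
  exact: ler_norm.
- exact: integrableZl.
Qed.

Lemma bounded_integrable_prob {g : T -> R} (M : R) :
  measurable_fun setT g -> (forall x, `|g x| <= M) ->
  P.-integrable setT (EFin \o g).
Proof.
move=> mg gM; apply: measurable_bounded_integrable => //.
  by apply: fin_num_fun_lty; exact: fin_num_measure.
by exists M; split; [exact: num_real|move=> r Mr x _ /=; apply: (le_trans (gM x)); exact: ltW].
Qed.

Lemma Rintegral_sum {d1} {S : measurableType d1} {mu : {measure set S -> \bar R}}
    (I : Type) (r : seq I) (F : I -> S -> R) :
  (forall i, mu.-integrable setT (EFin \o F i)) ->
  mu.-integrable setT (EFin \o (fun x => \sum_(i <- r) F i x)) /\
  \int[mu]_x (\sum_(i <- r) F i x) = \sum_(i <- r) \int[mu]_x F i x.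
Proof.
move=> iF; elim: r => [|i r [ih1 ih2]].
  rewrite big_nil; under eq_Rintegral do rewrite big_nil.
  have E : (fun x : S => \sum_(i <- [::]) F i x) = cst 0.
    by apply/funext => x; rewrite big_nil.
  split; first by rewrite E; exact: integrable0.
  by rewrite /Rintegral integral0.
have E : (fun x : S => \sum_(i <- i :: r) F i x) =
    (fun x => F i x + \sum_(i <- r) F i x).
  by apply/funext => x; rewrite big_cons.
split; first by rewrite E; exact: (integrableD _ (iF i) ih1).
by rewrite E RintegralD// ih2 big_cons.
Qed.

(** A density has integral one. *)
Lemma has_density_integrable {d1} {S : measurableType d1}
    {mu : {measure set S -> \bar R}} (X : T -> S) (p : S -> R) :
  has_density P mu X p -> mu.-integrable setT (EFin \o p).
Proof.
move=> [mp p0 HX]; apply/integrableP; split; first exact/measurable_EFinP.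
rewrite /=; under eq_integral do rewrite ger0_norm//.
by rewrite -HX// preimage_setT probability_setT ltry.
Qed.

Lemma Rintegral_density {d1} {S : measurableType d1}
    {mu : {measure set S -> \bar R}} (X : {mfun T >-> S}) (p : S -> R)
    (g : S -> R) (M : R) :
  has_density P mu X p -> measurable_fun setT g -> (forall x, `|g x| <= M) ->
  \int[P]_w g (X w) = \int[mu]_x (g x * p x).
Proof.
move=> HX mg gM; rewrite /Rintegral; congr fine.
have [mp p0 _] := HX.
have mgE : measurable_fun setT (EFin \o g) by exact/measurable_EFinP.
rewrite integralE [RHS]integralE.
rewrite (funepos_comp (EFin \o g) X) (funeneg_comp (EFin \o g) X).
congr (_ - _)%E.
  have := ge0_integral_density HX (measurable_funepos mgE) (fun z => funepos_ge0 _ z).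
  move=> /= ->; apply: eq_integral => x _ /=.
  by rewrite !funeposE /= EFinM maxeMl ?lee_fin// mul0e.
have := ge0_integral_density HX (measurable_funeneg mgE) (fun z => funeneg_ge0 _ z).
move=> /= ->; apply: eq_integral => x _ /=.
by rewrite !funenegE /= maxeMl ?lee_fin// mul0e -EFinM mulNr.
Qed.

Lemma Rintegral_indep_mul (U V : {mfun T >-> measurableTypeR R}) :
  (forall A B : set (measurableTypeR R), measurable A -> measurable B ->
     P ((U : T -> R) @^-1` A `&` (V : T -> R) @^-1` B) =
     (P ((U : T -> R) @^-1` A) * P ((V : T -> R) @^-1` B))%E) ->
  P.-integrable setT (EFin \o (U : T -> R)) ->
  P.-integrable setT (EFin \o (V : T -> R)) ->
  P.-integrable setT (EFin \o (fun w => (U w : R) * V w)) ->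
  \int[P]_w ((U w : R) * V w) = (\int[P]_w (U w : R)) * \int[P]_w (V w : R).
Proof.
move=> UV iU iV iUV.
pose F (z : measurableTypeR R * measurableTypeR R) : \bar R := ((z.1 : R) * z.2)%:E.
have mF : measurable_fun setT F.
  by apply/measurable_EFinP; apply: measurable_funM.
have := integral_indep UV mF iUV; rewrite /F /=.
rewrite /Rintegral => ->.
have E w : (\int[P]_w' ((U w : R) * V w')%:E =
   (U w : R)%:E * (\int[P]_w (V w : R))%:E)%E.
  rewrite /Rintegral fineK; last exact: integrable_fin_num.
  by rewrite -integralZl//.
rewrite [in LHS](eq_integral (fun w => ((U w : R)%:E * (\int[P]_w (V w : R))%:E)%E)); last first.
  by move=> w _; exact: E.
rewrite integralZr// fineM//.
exact: integrable_fin_num.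
Qed.

End RealExpectations.

(** * Autocovariances of the linear process *)

Section LinearProcess.
Context {d : measure_display} {T : measurableType d} {R : realType}.
Variable P : probability T R.
Variables (Z X : int -> {mfun T >-> measurableTypeR R}) (c : nat -> R).
Hypothesis HZiid : iid P (fun i w => Z i w : R).
Hypothesis HZ2 : forall i, (Z i : T -> R) \in Lfun P 2%:E.
Hypothesis HZ0 : forall i, 'E_P[(Z i : T -> R)]%E = 0%E.

Lemma innovation_mul_integrable (a b : int) :
  P.-integrable setT (EFin \o (fun w => (Z a w : R) * Z b w)).
Proof. by apply/Lfun1_integrable; exact: Lfun2_mul_Lfun1. Qed.

(** Independent centred innovations are orthogonal, with a common variance. *)
Lemma innovation_cov (a b : int) :
  \int[P]_w ((Z a w : R) * Z b w) =
  (a == b)%:R * \int[P]_w ((Z 0 w : R) ^+ 2).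
Proof.
have Z1 i : P.-integrable setT (EFin \o (Z i : T -> R)).
  apply/Lfun1_integrable; apply: Lfun_subset12 => //.
  exact: fin_num_measure.
have [->|ab] := eqVneq a b.
  rewrite mul1r /Rintegral; congr fine.
  pose F (x : measurableTypeR R) : \bar R := ((x : R) ^+ 2)%:E.
  have mF : measurable_fun setT F.
    by apply/measurable_EFinP; exact: exprn_measurable.
  have F0 x : (0 <= F x)%E by rewrite lee_fin sqr_ge0.
  have H i : (\int[P]_w ((Z i w : R) ^+ 2)%:E = \int[distribution P (Z i)]_x F x)%E.
    by rewrite ge0_integral_pushforward.
  transitivity (\int[P]_w ((Z b w : R) ^+ 2)%:E)%E.
    by apply: eq_integral => w _; rewrite expr2.
  rewrite !H.
  by apply: eq_measure_integral => A mA _; exact: (proj2 HZiid).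
rewrite mul0r Rintegral_indep_mul//.
- by have := HZ0 a; rewrite unlock /Rintegral => ->; rewrite mul0r.
- move=> A B mA mB.
  pose D (i : int) : set (measurableTypeR R) := if i == a then A else B.
  have mD i : measurable (D i) by rewrite /D; case: ifP.
  have := proj1 HZiid [:: a; b] D.
  rewrite !big_cons big_nil mule1 /= inE (negbTE ab) => /(_ erefl mD).
  rewrite {2 3}/D eqxx eq_sym (negbTE ab) => <-; congr (P _).
  apply/seteqP; split=> w /=.
    move=> [wA wB] i /=; rewrite !inE => /orP[] /eqP->; rewrite /D ?eqxx//.
    by rewrite eq_sym (negbTE ab).
  move=> H; split.
    by have := H a; rewrite /D eqxx; apply; rewrite /= ?inE ?eqxx.
  by have := H b; rewrite /D eq_sym (negbTE ab); apply; rewrite /= ?inE ?eqxx ?orbT.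
- exact: innovation_mul_integrable.
Qed.

Let sigma2 : R := \int[P]_w ((Z 0 w : R) ^+ 2).

(** Partial sums of the process, over an arbitrary list [r] of lags. *)
Let S (j : int) (r : seq nat) (w : T) : R := \sum_(l <- r) c l * Z (j - l%:Z) w.

Lemma innovation_var_ge0 : 0 <= sigma2.
Proof. by apply: Rintegral_ge0 => w _; exact: sqr_ge0. Qed.

Lemma linear_sum_cov (i j : int) (r r' : seq nat) :
  P.-integrable setT (EFin \o (fun w => S i r w * S j r' w)) /\
  \int[P]_w (S i r w * S j r' w) =
  \sum_(l <- r) \sum_(l' <- r') c l * c l' * ((i - l%:Z == j - l'%:Z)%:R * sigma2).
Proof.
have E : (fun w => S i r w * S j r' w) = (fun w => \sum_(l <- r) \sum_(l' <- r')
   c l * c l' * ((Z (i - l%:Z) w : R) * Z (j - l'%:Z) w)).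
  apply/funext => w; rewrite /S mulr_suml; apply: eq_bigr => l _.
  by rewrite mulr_sumr; apply: eq_bigr => l' _; rewrite mulrACA.
have i1 l l' : P.-integrable setT (EFin \o (fun w =>
   c l * c l' * ((Z (i - l%:Z) w : R) * Z (j - l'%:Z) w))).
  have := integrableZl measurableT (c l * c l') (innovation_mul_integrable (i - l%:Z) (j - l'%:Z)).
  by apply: eq_integrable => // w _ /=; rewrite EFinM.
have i2 l := (Rintegral_sum r' (i1 l)).
rewrite E; have [i3 ->] := Rintegral_sum r (fun l => proj1 (i2 l)).
split => //; apply: eq_bigr => l _; rewrite (proj2 (i2 l)); apply: eq_bigr => l' _.
rewrite RintegralZl//; last exact: innovation_mul_integrable.
by rewrite innovation_cov.
Qed.

Lemma measurable_linear_sum j r : measurable_fun setT (S j r).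
Proof.
apply: measurable_sum => l; apply: measurable_funM => //.
exact: (measurable_funPT (Z (j - l%:Z))).
Qed.

Hypothesis HX : linear_process P c (fun i w => Z i w) (fun i w => X i w).
Variables (C g eta : R).
Hypothesis C0 : 0 < C.
Hypothesis Hc : forall k, `|c k| <= C * k.+1%:R `^ (- g).
Hypothesis eta0 : 0 < eta.
Hypothesis geta : 1 - g + eta <= g.
Hypothesis g1 : g < 1.

Let p := 2 * g - 1 - eta.

(** The lag-k correlation of the coefficients decays like (k+1)^(-p).  The
    factor (l+k+1)^(-g) is split between l and k as
    (l+1)^(-(1-g+eta)) (k+1)^(-p), which leaves a convergent series in l. *)
Lemma coef_lag_sum_le : exists2 D : R, 0 <= D & forall k n : nat,
  \sum_(l < n) `|c l| * `|c (l + k)%N| <= D * k.+1%:R `^ (- p).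
Proof.
have [Sz Sz0 HS] := sum_powR_le eta0.
exists (C ^+ 2 * Sz); first by rewrite mulr_ge0 ?sqr_ge0// ltW.
move=> k n.
apply: (@le_trans _ _ (\sum_(l < n) C ^+ 2 * k.+1%:R `^ (- p) * l.+1%:R `^ (- (1 + eta)))).
  apply: ler_sum => l _.
  have l1 : 0 < l.+1%:R :> R by rewrite ltr0n.
  have k1 : 0 < k.+1%:R :> R by rewrite ltr0n.
  have lk1 : 0 < (l + k).+1%:R :> R by rewrite ltr0n.
  have lk : (l + k).+1%:R `^ (- g) <= l.+1%:R `^ (- (1 - g + eta)) * k.+1%:R `^ (- p).
    have -> : (l + k).+1%:R `^ (- g) =
        (l + k).+1%:R `^ (- (1 - g + eta)) * (l + k).+1%:R `^ (- p) :> R.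
      rewrite -powRD ?(gt_eqF lk1) ?implybT//; congr (_ `^ _).
      by rewrite /p; ring.
    rewrite ler_pM ?powR_ge0//.
      rewrite !powRN lef_pV2 ?posrE ?powR_gt0//.
      apply: ge0_ler_powR; rewrite ?nnegrE ?ler_nat ?ltnS ?leq_addr//.
      by move: g1 eta0; lra.
    rewrite !powRN lef_pV2 ?posrE ?powR_gt0//.
    apply: ge0_ler_powR; rewrite ?nnegrE ?ler_nat ?ltnS ?leq_addl//.
    by move: geta; rewrite /p; lra.
  apply: (@le_trans _ _ ((C * l.+1%:R `^ (- g)) * (C * (l + k).+1%:R `^ (- g)))).
    by apply: ler_pM => //; exact: Hc.
  have -> : l.+1%:R `^ (- (1 + eta)) = l.+1%:R `^ (- g) * l.+1%:R `^ (- (1 - g + eta)) :> R.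
    by rewrite -powRD ?(gt_eqF l1) ?implybT//; congr (_ `^ _); ring.
  rewrite [leLHS](_ : _ = C ^+ 2 * l.+1%:R `^ (- g) * (l + k).+1%:R `^ (- g)); last by ring.
  rewrite [leRHS](_ : _ = C ^+ 2 * l.+1%:R `^ (- g) *
    (l.+1%:R `^ (- (1 - g + eta)) * k.+1%:R `^ (- p))); last by ring.
  by rewrite ler_wpM2l// mulr_ge0 ?sqr_ge0 ?powR_ge0.
rewrite -mulr_sumr mulrAC ler_wpM2r ?powR_ge0//.
by rewrite ler_pM2l ?exprn_gt0.
Qed.

Let sumsq (n : nat) : R := \sum_(0 <= l < n) c l ^+ 2.

Lemma coef_sqr_cvg : cvgn sumsq.
Proof.
have [D D0 HD] := coef_lag_sum_le.
apply: nondecreasing_is_cvgn.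
  apply/nondecreasing_seqP => n; rewrite /sumsq big_nat_recr//= lerDl; exact: sqr_ge0.
exists D => _ [n _ <-]; have := HD 0%N n; rewrite powR1 mulr1; apply: le_trans.
rewrite /sumsq big_mkord; apply: ler_sum => l _; rewrite addn0 -normrM -expr2.
exact: ler_norm.
Qed.

(** The mean square of the part of the process left out by the partial sum of
    order n. *)
Let tau n : R := sigma2 * (limn sumsq - sumsq n).

Lemma sumsq_le_lim n : sumsq n <= limn sumsq.
Proof.
apply: nondecreasing_cvgn_le; last exact: coef_sqr_cvg.
apply/nondecreasing_seqP => m; rewrite /sumsq big_nat_recr//= lerDl; exact: sqr_ge0.
Qed.

Lemma tau_cvg0 : tau n @[n --> \oo] --> 0.
Proof.
have -> : 0 = sigma2 * (limn sumsq - limn sumsq) by rewrite subrr mulr0.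
apply: cvgMr; apply: cvgB; first exact: cvg_cst.
exact: coef_sqr_cvg.
Qed.

Lemma linear_sum_sqr_le j n m : (n <= m)%N ->
  \int[P]_w (S j (index_iota n m) w * S j (index_iota n m) w) <= tau n.
Proof.
move=> nm; rewrite (proj2 (linear_sum_cov _ _ _ _)).
have -> : \sum_(l <- index_iota n m) \sum_(l' <- index_iota n m)
   c l * c l' * ((j - l%:Z == j - l'%:Z)%:R * sigma2) =
   \sum_(n <= l < m) c l ^+ 2 * sigma2.
  apply: eq_big_seq => l lnm.
  rewrite (bigD1_seq l) ?iota_uniq//= eqxx mul1r big1 ?addr0 ?expr2// => l' l'l.
  rewrite (_ : (_ == _) = false) ?mul0r ?mulr0//.
  apply/negbTE; apply: contra l'l => /eqP h; apply/eqP; lia.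
rewrite -mulr_suml mulrC /tau ler_wpM2l ?innovation_var_ge0//.
rewrite lerBrDl; apply: le_trans (sumsq_le_lim m).
by rewrite /sumsq -big_cat_nat.
Qed.

(** The partial sums converge to the process in mean square, with the rate
    [tau]; Fatou's lemma passes from the almost sure limit to the mean
    square. *)
Lemma linear_process_tail j n :
  (\int[P]_w (((X j w : R) - S j (index_iota 0 n) w) ^+ 2)%:E <= (tau n)%:E)%E.
Proof.
pose f m w := ((S j (index_iota n (n + m)) w) ^+ 2)%:E.
have mf m : measurable_fun setT (f m).
  by apply/measurable_EFinP; apply: measurable_funX; exact: measurable_linear_sum.
have f0 m w : (0 <= f m w)%E by rewrite lee_fin sqr_ge0.
have mX : measurable_fun setT (fun w => (((X j w : R) - S j (index_iota 0 n) w) ^+ 2)%:E).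
  apply/measurable_EFinP; apply: measurable_funX; apply: measurable_funB.
    exact: (measurable_funPT (X j)).
  exact: measurable_linear_sum.
have mlim : measurable_fun setT (fun w => limn_einf (f ^~ w)).
  under eq_fun do rewrite limn_einf_lim.
  apply: (emeasurable_fun_cvg (fun n w => einfs (f ^~ w) n)) => //.
    by move=> n0; exact: measurable_fun_einfs.
  by move=> w _; exact: is_cvg_einfs.
apply: (@le_trans _ _ (\int[P]_w limn_einf (f ^~ w))%E).
  apply: ae_ge0_le_integral => //.
  - by move=> w _; rewrite lee_fin sqr_ge0.
  - move=> w _; rewrite limn_einf_lim; apply: lime_ge; first exact: is_cvg_einfs.
    by apply: nearW => m; apply: le_ereal_inf_tmp => _ [k _ <-].
  - have := HX j; apply: filterS => w Hw _.
    have : f ^~ w @ \oo --> (((X j w : R) - S j (index_iota 0 n) w) ^+ 2)%:E.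
      apply: cvg_EFin; first exact: nearW.
      apply: (@cvg_trans _ ((fun m => (series (fun k => c k * Z (j - k%:Z) w) (n + m)%N
          - S j (index_iota 0 n) w) ^+ 2) @ \oo)).
        apply: near_eq_cvg; apply: nearW => m /=; congr (_ ^+ 2).
        rewrite /S /series /= (@big_cat_nat _ _ _ n)//= ?leq_addr//.
        by rewrite addrAC subrr add0r.
      have Hs : series (fun k => c k * Z (j - k%:Z) w) (n + m)%N @[m --> \oo] -->
          (X j w : R).
        apply: (@cvg_comp _ _ _ (fun m => n + m)%N
          (series (fun k => c k * Z (j - k%:Z) w)) \oo \oo); last exact: Hw.
        exact: cvg_addnl.
      by apply: cvgM; apply: cvgB => //; exact: cvg_cst.
    by move=> /cvg_limn_einf_sup [-> _].
apply: (le_trans (fatou P measurableT mf (fun m w _ => f0 m w))).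
rewrite limn_einf_lim; apply: lime_le; first exact: is_cvg_einfs.
apply: nearW => m; apply: (@le_trans _ _ (\int[P]_w f m w)%E).
  by apply: ereal_inf_lbound; exists m => /=.
have [iS _] := linear_sum_cov j j (index_iota n (n + m)) (index_iota n (n + m)).
have E : (\int[P]_w f m w)%E = (\int[P]_w (S j (index_iota n (n + m)) w *
    S j (index_iota n (n + m)) w))%:E.
  by rewrite /Rintegral fineK ?integrable_fin_num//; exact: eq_integral.
by rewrite E lee_fin; apply: linear_sum_sqr_le; rewrite leq_addr.
Qed.

(** The Cauchy-Schwarz inequality in its weighted arithmetic-geometric
    form. *)
Lemma sqr_integrable_mul (a b : T -> R) :
  measurable_fun setT a -> measurable_fun setT b ->
  P.-integrable setT (EFin \o (fun w => a w ^+ 2)) ->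
  P.-integrable setT (EFin \o (fun w => b w ^+ 2)) ->
  P.-integrable setT (EFin \o (fun w => a w * b w)) /\
  forall lam : R, 0 < lam -> `|\int[P]_w (a w * b w)| <=
    lam * \int[P]_w (a w ^+ 2) + lam^-1 * \int[P]_w (b w ^+ 2).
Proof.
move=> ma mb ia ib.
have iq lam : P.-integrable setT (EFin \o (fun w => lam * a w ^+ 2 + lam^-1 * b w ^+ 2)).
  have := integrableD measurableT (integrableZl measurableT lam ia)
    (integrableZl measurableT lam^-1 ib).
  by apply: eq_integrable => // w _ /=.
have bd lam w : 0 < lam -> `|a w * b w| <= lam * a w ^+ 2 + lam^-1 * b w ^+ 2.
  move=> l0; have h : lam * (lam^-1) = 1 by rewrite divff// gt_eqF.
  have l1 : 0 < lam^-1 by rewrite invr_gt0.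
  have -> : lam * a w ^+ 2 + lam^-1 * b w ^+ 2 =
     (lam * a w ^+ 2 + lam^-1 * b w ^+ 2) / 2 +
     (lam * (`|a w| - lam^-1 * `|b w|) ^+ 2 / 2 + `|a w * b w|).
    rewrite normrM -(real_normK (num_real (a w))) -(real_normK (num_real (b w))).
    rewrite -[X in _ + X * _ = _]mul1r -h; field; rewrite gt_eqF//.
  rewrite addrA lerDr addr_ge0// divr_ge0//.
    by rewrite addr_ge0// mulr_ge0 ?sqr_ge0// ltW.
  by rewrite mulr_ge0 ?sqr_ge0// ltW.
have iab : P.-integrable setT (EFin \o (fun w => a w * b w)).
  apply: (le_integrable _ _ _ (iq 1)) => //.
    by apply/measurable_EFinP; exact: measurable_funM.
  move=> w _ /=; rewrite lee_fin (le_trans (bd 1 w _))//; exact: ler_norm.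
split => // lam l0.
apply: (le_trans (le_normr_Rintegral _ _)) => //.
rewrite -!RintegralZl// -RintegralD//.
- apply: le_Rintegral => //; last by move=> w _; exact: bd.
  exact: (integrable_norm iab).
- by have := integrableZl measurableT lam ia; apply: eq_integrable => // w _ /=.
- by have := integrableZl measurableT lam^-1 ib; apply: eq_integrable => // w _ /=.
Qed.

Lemma linear_sum_lag_cov_le : exists2 D : R, 0 <= D & forall k n : nat,
  `|\int[P]_w (S 0 (index_iota 0 n) w * S k%:Z (index_iota 0 n) w)| <=
    D * k.+1%:R `^ (- p).
Proof.
have [D D0 HD] := coef_lag_sum_le.
exists (sigma2 * D); first by rewrite mulr_ge0// innovation_var_ge0.
move=> k n; rewrite (proj2 (linear_sum_cov _ _ _ _)) -mulrA.
apply: le_trans (ler_wpM2l innovation_var_ge0 (HD k n)).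
apply: (le_trans (ler_norm_sum _ _ _)).
rewrite big_mkord mulr_sumr; apply: ler_sum => l _.
apply: (le_trans (ler_norm_sum _ _ _)).
have s0 : 0 <= sigma2 * (`|c l| * `|c (l + k)%N|).
  by rewrite !mulr_ge0// innovation_var_ge0.
have Z0 (l' : nat) : l' != (l + k)%N ->
    `|c l * c l' * ((0 - l%:Z == k%:Z - l'%:Z)%:R * sigma2)| = 0.
  move=> h; rewrite (_ : (_ == _ :> int) = false) ?mul0r ?mulr0 ?normr0//.
  apply/negbTE; apply: contra h => /eqP h; apply/eqP; lia.
have [lkn|nlk] := ltnP (l + k)%N n.
  rewrite (bigD1_seq (l + k)%N) ?iota_uniq ?mem_index_iota//=.
  rewrite big1 ?addr0; last by move=> l' /Z0.
  rewrite !normrM (ger0_norm innovation_var_ge0).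
  rewrite mulrC ler_wpM2r// ?mulr_ge0//.
  rewrite -[leRHS]mul1r ler_wpM2r ?innovation_var_ge0//.
  by case: eqP; rewrite ?normr1 ?normr0.
rewrite big_seq big1// => l'; rewrite mem_index_iota => /andP[_ l'n].
apply: Z0; apply/eqP => h; move: nlk l'n; rewrite h; lia.
Qed.

(** The autocovariances are bounded by those of the partial sums, up to an
    error controlled by the mean-square tail [tau n], which vanishes. *)
Lemma linear_process_autocovariance_le : exists2 D : R, 0 <= D &
  forall k : nat, `|autocovariance P (fun i w => X i w : R) k| <= D * k.+1%:R `^ (- p).
Proof.
have [D D0 HD] := linear_sum_lag_cov_le.
exists D => // k.
have mS j n : measurable_fun setT (S j (index_iota 0 n)) by exact: measurable_linear_sum.
pose u j n w := (X j w : R) - S j (index_iota 0 n) w.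
have mu j n : measurable_fun setT (u j n).
  by apply: measurable_funB => //; exact: (measurable_funPT (X j)).
have iu j n : P.-integrable setT (EFin \o (fun w => u j n w ^+ 2)).
  apply/integrableP; split; first by apply/measurable_EFinP; exact: measurable_funX.
  under eq_integral do rewrite /= ger0_norm ?sqr_ge0//.
  by apply: (le_lt_trans (linear_process_tail j n)); rewrite ltry.
have tu j n : \int[P]_w (u j n w ^+ 2) <= tau n.
  rewrite -lee_fin /Rintegral fineK; first exact: linear_process_tail.
  exact: (integrable_fin_num measurableT (iu j n)).
have iS j n : P.-integrable setT (EFin \o (fun w => S j (index_iota 0 n) w ^+ 2)).
  by have [+ _] := linear_sum_cov j j (index_iota 0 n) (index_iota 0 n).
have tS j n : \int[P]_w (S j (index_iota 0 n) w ^+ 2) <= tau 0%N.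
  exact: linear_sum_sqr_le.
pose rho := autocovariance P (fun i w => X i w : R) k.
have key n lam : 0 < lam ->
    `|rho| <= D * k.+1%:R `^ (- p) + lam * (2 * tau 0%N) + (lam^-1 * (2 * tau n) + 2 * tau n).
  move=> l0.
  have [i1 _] := linear_sum_cov 0 k%:Z (index_iota 0 n) (index_iota 0 n).
  have [i2 h2] := sqr_integrable_mul (mS 0 n) (mu k%:Z n) (iS 0 n) (iu k%:Z n).
  have [i3 h3] := sqr_integrable_mul (mS k%:Z n) (mu 0 n) (iS k%:Z n) (iu 0 n).
  have [i4 h4] := sqr_integrable_mul (mu 0 n) (mu k%:Z n) (iu 0 n) (iu k%:Z n).
  have E : rho = \int[P]_w (S 0 (index_iota 0 n) w * S k%:Z (index_iota 0 n) w) +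
     (\int[P]_w (S 0 (index_iota 0 n) w * u k%:Z n w) +
     (\int[P]_w (S k%:Z (index_iota 0 n) w * u 0 n w) +
      \int[P]_w (u 0 n w * u k%:Z n w))).
    rewrite -RintegralD// -RintegralD//; last exact: (integrableD measurableT i3 i4).
    rewrite -RintegralD//; last first.
      exact: (integrableD measurableT i2 (integrableD measurableT i3 i4)).
    rewrite /rho /autocovariance unlock; congr fine; apply: eq_integral => w _.
    by rewrite /u; congr (_%:E); ring.
  rewrite E.
  have {}h2 := h2 _ l0; have {}h3 := h3 _ l0; have {}h4 := h4 1 ltr01.
  have a1 := HD k n.
  have l1 : 0 < lam^-1 by rewrite invr_gt0.
  have b1 := ler_wpM2l (ltW l0) (tS 0 n).
  have b2 := ler_wpM2l (ltW l0) (tS k%:Z n).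
  have b3 := ler_wpM2l (ltW l1) (tu 0 n).
  have b4 := ler_wpM2l (ltW l1) (tu k%:Z n).
  have b5 := tu 0 n; have b6 := tu k%:Z n.
  move: h4; rewrite invr1 !mul1r => h4.
  apply: (le_trans (ler_normD _ _)); apply: (@le_trans _ _ (D * k.+1%:R `^ (- p) +
    (lam * tau 0%N + lam^-1 * tau n + ((lam * tau 0%N + lam^-1 * tau n) + (tau n + tau n))))).
    apply: lerD => //.
    apply: (le_trans (ler_normD _ _)); apply: lerD; first lra.
    by apply: (le_trans (ler_normD _ _)); apply: lerD; lra.
  by lra.
(* Let n tend to infinity, then lam to 0. *)
have key2 lam : 0 < lam -> `|rho| <= D * k.+1%:R `^ (- p) + lam * (2 * tau 0%N).
  move=> l0.
  have : (D * k.+1%:R `^ (- p) + lam * (2 * tau 0%N) + (lam^-1 * (2 * tau n) + 2 * tau n))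
     @[n --> \oo] --> D * k.+1%:R `^ (- p) + lam * (2 * tau 0%N) + (lam^-1 * (2 * 0) + 2 * 0).
    apply: cvgD; first exact: cvg_cst.
    by apply: cvgD; repeat apply: cvgMr; exact: tau_cvg0.
  rewrite !mulr0 !addr0 => h.
  rewrite -(cvg_lim _ h)//; apply: limr_ge.
    by apply/cvg_ex; eexists; exact: h.
  by apply: nearW => n; exact: key.
have t0 : 0 <= tau 0%N.
  apply: le_trans (tS 0 0%N); apply: Rintegral_ge0 => w _; exact: sqr_ge0.
apply/ler_addgt0Pr => e e0.
have d0 : 0 < 2 * tau 0%N + 1 by lra.
apply: (le_trans (key2 (e / (2 * tau 0%N + 1)) _)); first exact: divr_gt0.
rewrite lerD2l mulrAC ler_pdivrMr// ler_pM2l//; lra.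
Qed.

End LinearProcess.

(** * Joint laws of the observations and variance of empirical means *)

Section PairLaw.
Context {d : measure_display} {T : measurableType d} {R : realType}.
Variable P : probability T R.
Notation RR := (measurableTypeR R).
Variables (X : int -> {mfun T >-> RR}) (eps : nat -> {mfun T >-> RR}).
Hypothesis HXstat : strictly_stationary P (fun i w => X i w : R).
Hypothesis Hepsiid : iid P (fun j w => eps j w : R).
Hypothesis HXeps : independent_processes P (fun i w => X i w : R) (fun j w => eps j w : R).

(** Events about two coordinates belong to the sigma-algebra of the
    process. *)
Lemma sigma_process_pair {I : Type} (V : I -> {mfun T >-> RR}) (i j : I)
    (A : set (RR * RR)) : measurable A ->
  sigma_process (fun i w => V i w : R) ((fun w => (V i w, V j w)) @^-1` A).
Proof.
move=> mA.
pose G := \bigcup_i preimage_set_system setT (V i : T -> R) (@measurable _ RR).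
have mV k : measurable_fun (setT : set (g_sigma_algebraType G)) (V k : g_sigma_algebraType G -> RR).
  move=> _ B mB; apply: sub_sigma_algebra; exists k => //.
  by exists B.
have mp : measurable_fun (setT : set (g_sigma_algebraType G))
    (fun w : g_sigma_algebraType G => (V i w, V j w) : RR * RR).
  by apply: measurable_fun_pair.
by have := mp measurableT _ mA; rewrite setTI.
Qed.

(** The law of (Y_i, Y_(i+k)) does not depend on i: signal and noise are
    independent, the signal is stationary and the noise is i.i.d. *)
Lemma observations_pair_law (i k : nat) (C : set (RR * RR)) : (0 < k)%N -> measurable C ->
  P ((fun w => (X i%:Z w + eps i w : RR, X (i + k)%N%:Z w + eps (i + k)%N w : RR)) @^-1` C) =
  P ((fun w => (X 0 w + eps 0%N w : RR, X k%:Z w + eps k w : RR)) @^-1` C).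
Proof.
move=> k0 mC.
have mU n : measurable_fun setT (fun w => (X n%:Z w, X (n + k)%N%:Z w)).
  by apply: measurable_fun_pair.
have mV n : measurable_fun setT (fun w => (eps n w, eps (n + k)%N w)).
  by apply: measurable_fun_pair.
pose U n := mkmfun (mU n); pose V n := mkmfun (mV n).
have UE A : measurable A -> P ((U i : T -> _) @^-1` A) = P ((U 0%N : T -> _) @^-1` A).
  move=> mA; apply: (law_pair_unique (U := X i%:Z) (V := X (i + k)%N%:Z)
    (U' := X 0) (V' := X k%:Z)) => // A' B' mA' mB'.
  pose D (l : int) : set RR := if l == 0 then A' else B'.
  have mD l : measurable (D l) by rewrite /D; case: ifP.
  have kn0 : (k%:Z == 0) = false by apply/negbTE; rewrite -lt0n in k0 *; lia.
  have := HXstat [:: 0; k%:Z] i%:Z mD.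
  have E (W : int -> T -> R) : \bigcap_(l in [set` [:: 0; k%:Z]]) (W l @^-1` D l) =
      (W 0 @^-1` A' `&` W k%:Z @^-1` B').
    apply/seteqP; split=> w /=.
      move=> H; split.
        by have := H 0; rewrite /D eqxx; apply; rewrite /= ?inE ?eqxx.
      by have := H k%:Z; rewrite /D kn0; apply; rewrite /= ?inE ?eqxx ?orbT.
    move=> [wA wB] l /=; rewrite !inE => /orP[] /eqP->; rewrite /D ?eqxx//.
    by rewrite kn0.
  rewrite (E (fun l w => X (l + i%:Z) w)) (E (fun l w => X l w)) add0r.
  by rewrite -PoszD addnC.
have epsE n A' B' : measurable A' -> measurable B' ->
    P ((eps n : T -> RR) @^-1` A' `&` (eps (n + k)%N : T -> RR) @^-1` B') =
    (P ((eps 0%N : T -> RR) @^-1` A') * P ((eps 0%N : T -> RR) @^-1` B'))%E.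
  move=> mA' mB'.
  pose D (l : nat) : set RR := if l == n then A' else B'.
  have mD l : measurable (D l) by rewrite /D; case: ifP.
  have nk : ((n + k)%N == n) = false by apply/negbTE; apply/eqP; lia.
  have := proj1 Hepsiid [:: n; (n + k)%N] D.
  rewrite !big_cons big_nil mule1 /= inE eq_sym nk => /(_ erefl mD).
  rewrite {2 3}/D eqxx nk.
  have h1 : P ((eps 0%N : T -> RR) @^-1` A') = P ((eps n : T -> RR) @^-1` A').
    exact: (proj2 Hepsiid).
  have h2 : P ((eps 0%N : T -> RR) @^-1` B') = P ((eps (n + k)%N : T -> RR) @^-1` B').
    exact: (proj2 Hepsiid).
  rewrite h1 h2 => <-.
  congr (P _); apply/seteqP; split=> w /=.
    move=> [wA wB] l /=; rewrite !inE => /orP[] /eqP->; rewrite /D ?eqxx//.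
    by rewrite nk.
  move=> H; split.
    by have := H n; rewrite /D eqxx; apply; rewrite /= ?inE ?eqxx.
  by have := H (n + k)%N; rewrite /D nk; apply; rewrite /= ?inE ?eqxx ?orbT.
have VE A : measurable A -> P ((V i : T -> _) @^-1` A) = P ((V 0%N : T -> _) @^-1` A).
  move=> mA; apply: (law_pair_unique (U := eps i) (V := eps (i + k)%N)
    (U' := eps 0%N) (V' := eps k)) => // A' B' mA' mB'.
  by rewrite epsE//; have := epsE 0%N A' B' mA' mB' => <-.
have indep n A B : measurable A -> measurable B ->
    P ((U n : T -> _) @^-1` A `&` (V n : T -> _) @^-1` B) =
    (P ((U n : T -> _) @^-1` A) * P ((V n : T -> _) @^-1` B))%E.
  by move=> mA mB; apply: HXeps; exact: sigma_process_pair.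
(* The pair of observations is the sum of the signal pair and the noise pair. *)
pose s (z : (RR * RR) * (RR * RR)) : RR * RR :=
  ((z.1.1 : R) + z.2.1, (z.1.2 : R) + z.2.2).
have ms : measurable_fun setT s.
  apply: measurable_fun_pair; apply: measurable_funD.
  - by apply: (measurableT_comp measurable_fst); exact: measurable_fst.
  - by apply: (measurableT_comp measurable_fst); exact: measurable_snd.
  - by apply: (measurableT_comp measurable_snd); exact: measurable_fst.
  - by apply: (measurableT_comp measurable_snd); exact: measurable_snd.
have mS : measurable (s @^-1` C) by rewrite -[_ @^-1` _]setTI; exact: ms.
have := law_pair_unique (U := U i) (V := V i) (U' := U 0%N) (V' := V 0%N) _ mS.
by apply=> A B mA mB; rewrite !indep// UE// VE.
Qed.

End PairLaw.

Section ProductIntegral.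
Context {R : realType} {d1 d2 : measure_display}.
Context {S1 : measurableType d1} {S2 : measurableType d2}.
Variables (m1 : {sigma_finite_measure set S1 -> \bar R})
          (m2 : {sigma_finite_measure set S2 -> \bar R}).

Lemma Rintegral_prod_mul (u : S1 -> R) (v : S2 -> R) :
  m1.-integrable setT (EFin \o u) -> m2.-integrable setT (EFin \o v) ->
  (m1 \x m2)%E.-integrable setT (EFin \o (fun z => u z.1 * v z.2)) /\
  \int[(m1 \x m2)%E]_z (u z.1 * v z.2) = (\int[m1]_x u x) * \int[m2]_y v y.
Proof.
move=> iu iv.
have mu : measurable_fun setT u by apply/measurable_EFinP; exact: measurable_int iu.
have mv : measurable_fun setT v by apply/measurable_EFinP; exact: measurable_int iv.
have muv : measurable_fun setT (EFin \o (fun z : S1 * S2 => u z.1 * v z.2)).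
  apply/measurable_EFinP; apply: measurable_funM.
    by apply: (measurableT_comp mu); exact: measurable_fst.
  by apply: (measurableT_comp mv); exact: measurable_snd.
have iuv : (m1 \x m2)%E.-integrable setT (EFin \o (fun z => u z.1 * v z.2)).
  apply/integrable12ltyP => //=.
  have E x : (\int[m2]_y `|(u x * v y)%:E| = `|u x|%:E * \int[m2]_y `|(v y)%:E|)%E.
    rewrite -ge0_integralZl//.
    - by apply: eq_integral => y _ /=; rewrite normrM.
    - by apply/measurable_EFinP; exact: measurableT_comp.
  under eq_integral do rewrite E.
  rewrite ge0_integralZr//.
  - have /integrableP[_ h1] := iu; have /integrableP[_ h2] := iv.
    rewrite lte_mul_pinfty//; first exact: integral_ge0.
    rewrite ge0_fin_numE//; exact: integral_ge0.
  - by apply/measurable_EFinP; exact: measurableT_comp.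
  - exact: integral_ge0.
split => //.
rewrite /Rintegral -integral12_prod_meas1//= /fubini_F /=.
rewrite -fineM; try exact: integrable_fin_num.
congr fine.
have E x : (\int[m2]_y (u x * v y)%:E = (u x)%:E * (\int[m2]_y (v y)%:E))%E.
  by rewrite -integralZl//.
under eq_integral do rewrite E.
have fv := integrable_fin_num measurableT iv.
by rewrite -(fineK fv) integralZr.
Qed.

End ProductIntegral.

Section Variance.
Context {d : measure_display} {T : measurableType d} {R : realType}.
Variable P : probability T R.
Notation RR := (measurableTypeR R).
Notation leb := (@lebesgue_measure R).
Variables (X : int -> {mfun T >-> RR}) (eps : nat -> {mfun T >-> RR}).
Hypothesis HXstat : strictly_stationary P (fun i w => X i w : R).
Hypothesis Hepsiid : iid P (fun j w => eps j w : R).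
Hypothesis HXeps : independent_processes P (fun i w => X i w : R) (fun j w => eps j w : R).
Let Y (j : nat) (w : T) : R := X j%:Z w + eps j w.
Variables (fY : R -> R).
Hypothesis HYdens : forall j : nat,
    has_density P leb (fun w => Y j w : RR) fY.
Variables (fk hk : nat -> R -> R -> R) (h : R -> R) (delta : R) (rho : nat -> R).
Hypothesis HfYi : leb.-integrable setT (fun x => (derive1 fY x)%:E).
Hypothesis Hdelta : 0 < delta.
Hypothesis Hhi : leb.-integrable setT (fun x => (h x)%:E).
Hypothesis Hfk : forall k : nat, (0 < k)%N ->
    has_density P (leb \x leb)%E
      (fun w => (Y 0%N w : RR, Y k w : RR))
      (fun z => fk k z.1 z.2).
Hypothesis Hfkhk : forall (k : nat) (x y : R), (0 < k)%N ->
    fk k x y = fY x * fY y + rho k * derive1 fY x * derive1 fY y + hk k x y.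
Hypothesis Hhk : forall (k : nat) (x y : R), (0 < k)%N ->
    `|hk k x y| <= `|rho k| `^ (1 + delta) * h x * h y.

Lemma measurable_obs j : measurable_fun setT (Y j : T -> RR).
Proof.
by apply: measurable_funD; [exact: (measurable_funPT (X j%:Z))|exact: (measurable_funPT (eps j))].
Qed.

Lemma observations_pair_density (i k : nat) : (0 < k)%N ->
  has_density P (leb \x leb)%E
      (fun w => (Y i w : RR, Y (i + k)%N w : RR)) (fun z => fk k z.1 z.2).
Proof.
move=> k0; have [mp p0 HA] := Hfk k0; split => // A mA.
by rewrite -HA//; exact: observations_pair_law.
Qed.

Variables (G : R -> R) (M : R).
Hypothesis mG : measurable_fun setT (G : RR -> RR).
Hypothesis GM : forall x, `|G x| <= M.
Hypothesis G0 : \int[leb]_x (G x * fY x) = 0.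

Let I1 : R := \int[leb]_x `|derive1 fY x|.
Let I2 : R := \int[leb]_x `|h x|.

(** Covariance of G(Y_i) and G(Y_(i+k)) for a bounded G centred under fY:
    the product term of the expansion of the joint density contributes
    nothing. *)
Lemma observations_cov_le (i k : nat) : (0 < k)%N ->
  `|\int[P]_w (G (Y i w) * G (Y (i + k)%N w))| <=
    M ^+ 2 * (`|rho k| * I1 ^+ 2 + `|rho k| `^ (1 + delta) * I2 ^+ 2).
Proof.
move=> k0.
have M0 : 0 <= M by apply: le_trans (GM 0).
have mp : measurable_fun setT (fun w => (Y i w : RR, Y (i + k)%N w : RR)).
  by apply: measurable_fun_pair; exact: measurable_obs.
pose W := mkmfun mp.
have HD : has_density P (leb \x leb)%E W (fun z => fk k z.1 z.2).
  exact: observations_pair_density.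
pose GG (z : RR * RR) : R := G z.1 * G z.2.
have mGG : measurable_fun setT GG.
  apply: measurable_funM.
    by apply: (measurableT_comp mG); exact: measurable_fst.
  by apply: (measurableT_comp mG); exact: measurable_snd.
have GGM z : `|GG z| <= M ^+ 2.
  by rewrite /GG normrM expr2 ler_pM.
have EW := Rintegral_density (X := W) HD mGG GGM.
rewrite (_ : \int[P]_w (G (Y i w) * G (Y (i + k)%N w)) =
  \int[(leb \x leb)%E]_z (GG z * fk k z.1 z.2)); last exact: EW.
have ifY := has_density_integrable (HYdens 0%N).
have [iff ff] := Rintegral_prod_mul ifY ifY.
have ifk := has_density_integrable HD.
have iGfY : leb.-integrable setT (EFin \o (fun x => G x * fY x)).
  exact: bounded_integrable mG GM ifY.
have [_ GGff] := Rintegral_prod_mul iGfY iGfY.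
have -> : \int[(leb \x leb)%E]_x (GG x * fk k x.1 x.2) =
    \int[(leb \x leb)%E]_x (GG x * (fk k x.1 x.2 - fY x.1 * fY x.2)).
  under [RHS]eq_Rintegral do rewrite mulrBr.
  rewrite RintegralB//; last 2 first.
  - exact: bounded_integrable mGG GGM ifk.
  - exact: bounded_integrable mGG GGM iff.
  rewrite [X in _ = _ - X](_ : _ = 0) ?subr0//.
  transitivity (\int[(leb \x leb)%E]_z ((G z.1 * fY z.1) * (G z.2 * fY z.2))).
    by apply: eq_Rintegral => z _; rewrite /GG mulrACA.
  by rewrite GGff G0 mul0r.
have ifkff : (leb \x leb)%E.-integrable setT
   (EFin \o (fun z : RR * RR => fk k z.1 z.2 - fY z.1 * fY z.2)).
  by have := integrableB measurableT ifk iff; apply: eq_integrable.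
have [in1 n1] := Rintegral_prod_mul (integrable_norm HfYi) (integrable_norm HfYi).
have [in2 n2] := Rintegral_prod_mul (integrable_norm Hhi) (integrable_norm Hhi).
have iB : (leb \x leb)%E.-integrable setT (EFin \o (fun z : RR * RR =>
    M ^+ 2 * `|rho k| * (`|derive1 fY z.1| * `|derive1 fY z.2|) +
    M ^+ 2 * `|rho k| `^ (1 + delta) * (`|h z.1| * `|h z.2|))).
  have := integrableD measurableT (integrableZl measurableT (M ^+ 2 * `|rho k|) in1)
    (integrableZl measurableT (M ^+ 2 * `|rho k| `^ (1 + delta)) in2).
  by apply: eq_integrable => // z _ /=.
have iGG := bounded_integrable mGG GGM ifkff.
apply: (le_trans (le_normr_Rintegral _ _)) => //.
apply: (@le_trans _ _ (\int[(leb \x leb)%E]_z (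
    M ^+ 2 * `|rho k| * (`|derive1 fY z.1| * `|derive1 fY z.2|) +
    M ^+ 2 * `|rho k| `^ (1 + delta) * (`|h z.1| * `|h z.2|)))).
  apply: le_Rintegral => //; first exact: (integrable_norm iGG).
  move=> z _; rewrite normrM -(mulrA (M ^+ 2) `|rho k|) -(mulrA (M ^+ 2)) -mulrDr.
  apply: ler_pM => //.
  rewrite Hfkhk// [X in `|X|](_ : _ = rho k * derive1 fY z.1 * derive1 fY z.2 + hk k z.1 z.2); last by ring.
  apply: (le_trans (ler_normD _ _)); apply: lerD.
    by rewrite !normrM mulrA.
  apply: (le_trans (Hhk _ _ k0)).
  rewrite -mulrA ler_wpM2l ?powR_ge0// -normrM; exact: ler_norm.
rewrite RintegralD//; last 2 first.
- have := integrableZl measurableT (M ^+ 2 * `|rho k|) in1.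
  by apply: eq_integrable => // z _ /=.
- have := integrableZl measurableT (M ^+ 2 * `|rho k| `^ (1 + delta)) in2.
  by apply: eq_integrable => // z _ /=.
rewrite RintegralZl// RintegralZl// n1 n2 -/I1 -/I2.
by rewrite le_eqVlt; apply/orP; left; apply/eqP; ring.
Qed.

End Variance.

Section SumVariance.
Context {d : measure_display} {T : measurableType d} {R : realType}.
Variable P : probability T R.

Lemma sum_lag_le (a : nat -> R) (n i : nat) : (forall k, 0 <= a k) -> (i < n)%N ->
  \sum_(j < n) (if (i <= j)%N then a (j - i)%N else a (i - j)%N) <=
    2 * \sum_(k < n) a k.
Proof.
move=> a0 i_n.
apply: (@le_trans _ _ (\sum_(j < n) \sum_(k < n)
   (((j == (i + k)%N :> nat) + (i == (j + k)%N :> nat))%N%:R * a k))).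
  apply: ler_sum => j _; case: leqP => ij.
    have jn : (j - i < n)%N by apply: leq_ltn_trans (ltn_ord j); exact: leq_subr.
    rewrite (bigD1 (Ordinal jn))//= subnKC// eqxx.
    apply: (@le_trans _ _ (1 * a (j - i)%N)); first by rewrite mul1r.
    rewrite -[leLHS]addr0; apply: lerD.
      by rewrite ler_wpM2r// ler1n.
    by apply: sumr_ge0 => k _; rewrite mulr_ge0.
  have jn : (i - j < n)%N by apply: leq_ltn_trans i_n; exact: leq_subr.
  rewrite (bigD1 (Ordinal jn))//= subnKC ?(ltnW ij)// eqxx.
  apply: (@le_trans _ _ (1 * a (i - j)%N)); first by rewrite mul1r.
  rewrite -[leLHS]addr0; apply: lerD.
    by rewrite ler_wpM2r// ler1n addn1.
  by apply: sumr_ge0 => k _; rewrite mulr_ge0.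
rewrite exchange_big /= mulr_sumr; apply: ler_sum => k _.
rewrite -mulr_suml ler_wpM2r// -natr_sum ler_nat big_split /=.
have H (Q : pred 'I_n) : (forall x y : 'I_n, Q x -> Q y -> x = y) ->
    (\sum_(j < n) Q j <= 1)%N.
  move=> HQ; have -> : (\sum_(j < n) Q j = \sum_(j < n | Q j) 1)%N.
    by rewrite [RHS]big_mkcond; apply: eq_bigr => j _; case: (Q j).
  by rewrite sum1_card; apply/card_le1_eqP => x y hx hy; exact: HQ.
by apply: (@leq_add _ _ 1 1); apply: H => x y /eqP h1 /eqP h2; apply: val_inj => /=; lia.
Qed.

(** Second moment of a sum whose covariances are bounded by a function of
    the lag. *)
Lemma sum_second_moment_le (W : nat -> T -> R) (M : R) (a : nat -> R) :
  (forall j, measurable_fun setT (W j)) -> (forall j w, `|W j w| <= M) ->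
  (forall k, 0 <= a k) ->
  (forall i k, `|\int[P]_w (W i w * W (i + k)%N w)| <= a k) ->
  forall n, \int[P]_w ((\sum_(j < n) W j w) ^+ 2) <= n%:R * (2 * \sum_(k < n) a k).
Proof.
move=> mW WM a0 Wa n.
have iW i j : P.-integrable setT (EFin \o (fun w => W i w * W j w)).
  apply: (@bounded_integrable_prob _ _ _ P _ (M ^+ 2)); first exact: measurable_funM.
  by move=> w; rewrite normrM expr2 ler_pM.
have i1 i := Rintegral_sum (index_enum 'I_n) (fun j : 'I_n => iW i j).
have E : (fun w => (\sum_(j < n) W j w) ^+ 2) =
   (fun w => \sum_(i < n) \sum_(j < n) W i w * W j w).
  apply/funext => w; rewrite expr2 mulr_suml; apply: eq_bigr => i _.
  by rewrite mulr_sumr.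
rewrite E (proj2 (Rintegral_sum (index_enum 'I_n) (fun i : 'I_n => proj1 (i1 i)))).
rewrite -[X in _ <= X%:R * _](card_ord n) -sum1_card natr_sum mulr_suml.
apply: ler_sum => i _; rewrite mul1r (proj2 (i1 i)).
apply: le_trans (sum_lag_le a0 (ltn_ord i)).
apply: ler_sum => j _; case: leqP => ij.
  by apply: le_trans (Wa i (j - i)%N); rewrite subnKC// ler_norm.
have := Wa j (i - j)%N; rewrite subnKC ?(ltnW ij)// => h.
apply: le_trans h; apply: le_trans (ler_norm _).
by under eq_Rintegral do rewrite mulrC.
Qed.

Lemma sum_powR_lag_le (p eta : R) : 0 < eta -> 0 <= 1 - p + eta ->
  exists2 S : R, 0 < S & forall n, (0 < n)%N ->
    \sum_(k < n) k.+1%:R `^ (- p) <= S * n%:R `^ (1 - p + eta).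
Proof.
move=> eta0 pe; have [S S0 HS] := sum_powR_le eta0.
exists S => // n n0.
apply: (@le_trans _ _ (\sum_(k < n) k.+1%:R `^ (- (1 + eta)) * n%:R `^ (1 - p + eta))).
  apply: ler_sum => k _.
  have -> : k.+1%:R `^ (- p) = k.+1%:R `^ (- (1 + eta)) * k.+1%:R `^ (1 - p + eta) :> R.
    rewrite -powRD ?pnatr_eq0 ?implybT//; congr (_ `^ _); ring.
  rewrite ler_wpM2l ?powR_ge0//.
  by apply: ge0_ler_powR; rewrite ?nnegrE// ler_nat.
by rewrite -mulr_suml ler_wpM2r ?powR_ge0.
Qed.

End SumVariance.

Section EmpiricalMean.
Context {d : measure_display} {T : measurableType d} {R : realType}.
Variable P : probability T R.
Notation RR := (measurableTypeR R).
Notation leb := (@lebesgue_measure R).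
Variables (X : int -> {mfun T >-> RR}) (eps : nat -> {mfun T >-> RR}).
Hypothesis HXstat : strictly_stationary P (fun i w => X i w : R).
Hypothesis Hepsiid : iid P (fun j w => eps j w : R).
Hypothesis HXeps : independent_processes P (fun i w => X i w : R) (fun j w => eps j w : R).
Let Y (j : nat) (w : T) : R := X j%:Z w + eps j w.
Variables (fY : R -> R).
Hypothesis HYdens : forall j : nat,
    has_density P leb (fun w => Y j w : RR) fY.
Variables (fk hk : nat -> R -> R -> R) (h : R -> R) (delta : R) (rho : nat -> R).
Hypothesis HfYi : leb.-integrable setT (fun x => (derive1 fY x)%:E).
Hypothesis Hdelta : 0 < delta.
Hypothesis Hhi : leb.-integrable setT (fun x => (h x)%:E).
Hypothesis Hfk : forall k : nat, (0 < k)%N ->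
    has_density P (leb \x leb)%E
      (fun w => (Y 0%N w : RR, Y k w : RR))
      (fun z => fk k z.1 z.2).
Hypothesis Hfkhk : forall (k : nat) (x y : R), (0 < k)%N ->
    fk k x y = fY x * fY y + rho k * derive1 fY x * derive1 fY y + hk k x y.
Hypothesis Hhk : forall (k : nat) (x y : R), (0 < k)%N ->
    `|hk k x y| <= `|rho k| `^ (1 + delta) * h x * h y.
Variables (D p eta : R).
Hypothesis D0 : 0 <= D.
Hypothesis rho_le : forall k, `|rho k| <= D * k.+1%:R `^ (- p).
Hypothesis p0 : 0 <= p.
Hypothesis eta0 : 0 < eta.
Hypothesis pe : 0 <= 1 - p + eta.

(** Variance of the empirical mean of a bounded function of the
    observations; the constant does not depend on the function. *)
Lemma empirical_mean_variance_le : exists2 V : R, 0 <= V &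
  forall (g : R -> R) (M : R) (n : nat), (0 < n)%N ->
    measurable_fun setT (g : RR -> RR) -> (forall x, `|g x| <= M) ->
    \int[P]_w ((n%:R^-1 * (\sum_(1 <= j < n.+1) g (Y j w)) -
       \int[P]_w g (Y 0%N w)) ^+ 2) <= V * M ^+ 2 * n%:R `^ (eta - p).
Proof.
have [S S0 HS] := sum_powR_lag_le eta0 pe.
pose I1 : R := \int[leb]_x `|derive1 fY x|.
pose I2 : R := \int[leb]_x `|h x|.
pose A := 1 + D * I1 ^+ 2 + D `^ (1 + delta) * I2 ^+ 2.
have I10 : 0 <= I1 by apply: Rintegral_ge0.
have I20 : 0 <= I2 by apply: Rintegral_ge0.
have A0 : 0 <= A.
  by rewrite /A !addr_ge0 ?mulr_ge0 ?sqr_ge0 ?powR_ge0.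
exists (8 * A * S); first by rewrite !mulr_ge0// ltW.
move=> g M n n0 mg gM.
have M0 : 0 <= M by apply: le_trans (gM 0).
have mY j : measurable_fun setT (Y j : T -> RR).
  exact: measurable_obs.
have mgY j : measurable_fun setT (fun w => g (Y j w)).
  by apply: (measurableT_comp mg).
have igY j : P.-integrable setT (EFin \o (fun w => g (Y j w))).
  exact: bounded_integrable_prob (mgY j) (fun w => gM _).
have icst (r : R) : P.-integrable setT (EFin \o (fun=> r)).
  exact: finite_measure_integrable_cst.
have Ecst := Rintegral_prob_cst P.
set m := \int[P]_w g (Y 0%N w).
have mM : `|m| <= M.
  apply: (le_trans (le_normr_Rintegral measurableT (igY 0%N))).
  rewrite -[leRHS]Ecst; apply: le_Rintegral => //.
  exact: (integrable_norm (igY 0%N)).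
pose G x := g x - m.
have mG : measurable_fun setT (G : RR -> RR).
  by apply: measurable_funB.
have GM x : `|G x| <= 2 * M.
  by apply: (le_trans (ler_normB _ _)); have := gM x; lra.
have GfY0 : \int[leb]_x (G x * fY x) = 0.
  have := Rintegral_density (X := mkmfun (mY 0%N)) (HYdens 0%N) mG GM => <- /=.
  by rewrite /G RintegralB// Ecst subrr.
pose a (k : nat) : R := (2 * M) ^+ 2 * A * k.+1%:R `^ (- p).
have a0 k : 0 <= a k by rewrite !mulr_ge0 ?sqr_ge0 ?powR_ge0.
have Ga i k : `|\int[P]_w (G (Y i w) * G (Y (i + k)%N w))| <= a k.
  have mGY j : measurable_fun setT (fun w => G (Y j w)).
    by apply: (measurableT_comp mG).
  have [->|k0] := posnP k.
    have iGG : P.-integrable setT (EFin \o (fun w => G (Y i w) * G (Y (i + 0)%N w))).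
      apply: (@bounded_integrable_prob _ _ _ P _ ((2 * M) ^+ 2)); first exact: measurable_funM.
      by move=> w; rewrite normrM expr2 ler_pM.
    apply: (le_trans (le_normr_Rintegral measurableT iGG)).
    rewrite /a powR1 mulr1.
    apply: (@le_trans _ _ ((2 * M) ^+ 2)).
      rewrite -[leRHS]Ecst; apply: le_Rintegral => //.
        exact: (integrable_norm iGG).
      by move=> w _; rewrite normrM expr2 ler_pM.
    rewrite ler_peMr ?sqr_ge0// /A -addrA lerDl.
    by rewrite !addr_ge0 ?mulr_ge0 ?sqr_ge0 ?powR_ge0.
  apply: (le_trans (observations_cov_le HXstat Hepsiid HXeps HYdens HfYi Hhi Hfk Hfkhk Hhk mG GM GfY0 i k0)).
  rewrite /a -mulrA ler_wpM2l ?sqr_ge0// -/I1 -/I2.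
  have kp0 : 0 <= k.+1%:R `^ (- p) :> R by exact: powR_ge0.
  have kp1 : k.+1%:R `^ (- p) <= 1 :> R.
    rewrite powRN invf_le1 ?powR_gt0//.
    have : 1 `^ p <= k.+1%:R `^ p :> R.
      by apply: ge0_ler_powR => //; rewrite ?nnegrE// ler1n.
    by rewrite powR1.
  rewrite /A !mulrDl mul1r -addrA; apply: (@le_trans _ _
     (D * I1 ^+ 2 * k.+1%:R `^ (- p) + D `^ (1 + delta) * I2 ^+ 2 * k.+1%:R `^ (- p))); last by rewrite lerDr.
  apply: lerD; first by rewrite mulrAC ler_wpM2r ?sqr_ge0.
  rewrite mulrAC ler_wpM2r ?sqr_ge0//.
  apply: (@le_trans _ _ ((D * k.+1%:R `^ (- p)) `^ (1 + delta))).
    apply: ge0_ler_powR; rewrite ?nnegrE ?mulr_ge0 ?rho_le//.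
    by rewrite addr_ge0// ltW.
  rewrite powRM// ler_wpM2l ?powR_ge0//.
  rewrite -[leRHS]powRr1//.
  apply: ger_powR; last by rewrite lerDl ltW.
  by rewrite kp1 powR_gt0.
have n1 : n%:R != 0 :> R by rewrite pnatr_eq0 -lt0n.
have E w : (n%:R^-1 * (\sum_(1 <= j < n.+1) g (Y j w)) - m) =
    n%:R^-1 * \sum_(j < n) G (Y j.+1 w).
  rewrite /G sumrB sumr_const card_ord mulrBr -(mulr_natl m n) mulKf//.
  by rewrite big_add1 /= big_mkord.
under eq_Rintegral do rewrite E exprMn.
have mS : measurable_fun setT (fun w => \sum_(j < n) G (Y j.+1 w)).
  by apply: measurable_sum => j; apply: (measurableT_comp mG).
rewrite RintegralZl//; last first.
  apply: (@bounded_integrable_prob _ _ _ P _ ((n%:R * (2 * M)) ^+ 2)); first exact: measurable_funX.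
  move=> w; rewrite normrX lerXn2r ?nnegrE ?mulr_ge0//.
  apply: (le_trans (ler_norm_sum _ _ _)).
  rewrite -[X in _ <= X%:R * _](card_ord n) -sum1_card natr_sum mulr_suml.
  by apply: ler_sum => i _; rewrite mul1r.
have := @sum_second_moment_le _ _ _ P (fun j w => G (Y j.+1 w)) (2 * M) a.
move=> /(_ _ (fun j w => GM _) a0 (fun i k => Ga i.+1 k) n) H.
apply: (@le_trans _ _ (n%:R^-1 ^+ 2 * (n%:R * (2 * ((2 * M) ^+ 2 * A * (S * n%:R `^ (1 - p + eta))))))).
  rewrite ler_wpM2l ?sqr_ge0//; apply: le_trans (H _) _.
    by move=> j; apply: (measurableT_comp mG).
  rewrite ler_wpM2l// ler_wpM2l//.
  rewrite /a -mulr_sumr ler_wpM2l ?mulr_ge0 ?sqr_ge0//.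
  exact: HS.
have -> : n%:R `^ (1 - p + eta) = n%:R * n%:R `^ (eta - p) :> R.
  rewrite (_ : 1 - p + eta = 1 + (eta - p)); last by ring.
  by rewrite [LHS]powRD ?n1 ?implybT// powRr1.
rewrite le_eqVlt; apply/orP; left; apply/eqP; field; exact: n1.
Qed.

End EmpiricalMean.

(** * A damping factor and its Fourier transform *)

Section Reflection.
Context {R : realType}.
Notation RR := (measurableTypeR R).
Notation leb := (@lebesgue_measure R).

Lemma ge0_integral_shift (F : R -> \bar R) (b : R) :
  measurable_fun setT (F : RR -> \bar R) -> (forall x, 0 <= F x)%E ->
  (\int[leb]_x F ((x : R) + b)%R = \int[leb]_x F x)%E.
Proof.
move=> mF F0.
have ms : measurable_fun setT ((fun x : R => x + b) : RR -> RR).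
  by apply: measurable_funD.
rewrite -(ge0_integral_pushforward ms leb measurableT mF (fun x _ => F0 x)).
by apply: eq_measure_integral => A mA _; exact: lebesgue_measure_shift.
Qed.

Lemma Rintegral_odd0 (f : R -> R) :
  leb.-integrable setT (EFin \o f) -> (forall x, f (- x) = - f x) ->
  \int[leb]_x f x = 0.
Proof.
move=> iF fN.
have ms : measurable_fun setT ((-%R : R -> R) : RR -> RR).
  exact: oppr_measurable.
have mf : measurable_fun setT (EFin \o f) by exact: measurable_int iF.
have iFN : leb.-integrable (setT : set RR) ((EFin \o f) \o (-%R : R -> R)).
  have := integrableN iF; apply: eq_integrable => // x _ /=.
  by rewrite fN.
have E : (\int[leb]_x (f x)%:E = \int[leb]_x (f (- (x : R)))%:E)%E.
  transitivity (\int[pushforward leb ((-%R : R -> R) : RR -> RR)]_x (f x)%:E)%E.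
    apply: eq_measure_integral => A mA _.
    exact/esym/lebesgue_measureN.
  exact: (integral_pushforward ms mf iFN measurableT).
have : \int[leb]_x f x = - \int[leb]_x f x.
  rewrite {1}/Rintegral [X in fine X]E.
  transitivity (\int[leb]_x (-1 * f x)).
    rewrite /Rintegral; congr fine; apply: eq_integral => x _ /=.
    by rewrite fN mulN1r.
  by rewrite RintegralZl// mulN1r.
by lra.
Qed.

End Reflection.

Section Cauchy.
Context {R : realType}.
Notation RR := (measurableTypeR R).
Notation leb := (@lebesgue_measure R).

(** The Cauchy density of scale s, multiplied by pi. *)
Definition cauchy_kernel (s x : R) : R := s / (s ^+ 2 + x ^+ 2).

Lemma cauchy_kernel_ge0 s x : 0 < s -> 0 <= cauchy_kernel s x.
Proof. by move=> s0; rewrite divr_ge0 ?addr_ge0 ?sqr_ge0// ltW. Qed.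

Lemma continuous_cauchy_kernel s : 0 < s -> continuous (cauchy_kernel s).
Proof.
move=> s0 x; apply: cvgM; first exact: cvg_cst.
apply: cvgV.
  by rewrite gt_eqF// ltr_pwDl ?exprn_gt0// sqr_ge0.
by apply: cvgD; [exact: cvg_cst|apply: cvgM; exact: cvg_id].
Qed.

Lemma integral_cauchy_kernel s : 0 < s -> (\int[leb]_x (cauchy_kernel s x)%:E = pi%:E)%E.
Proof.
move=> s0; rewrite ge0_symfun_integralT//; last 3 first.
- by move=> x; exact: cauchy_kernel_ge0.
- exact: continuous_cauchy_kernel.
- by move=> x /=; rewrite /cauchy_kernel sqrrN.
have H (x : R) : is_derive x (1 : R) (fun x : R => atan (s^-1 * x)) (cauchy_kernel s x).
  apply: is_derive_eq; rewrite /cauchy_kernel /GRing.scale /= ?mulr1 ?mulr0 ?addr0.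
  have s1 : s != 0 by rewrite gt_eqF.
  have s2 : s ^+ 2 + x ^+ 2 != 0 by rewrite gt_eqF// ltr_pwDl ?exprn_gt0// sqr_ge0.
  by field; rewrite s1 s2.
rewrite -set_itvcy (@ge0_continuous_FTC2y _ _ (fun x => atan (s^-1 * x)) _ (pi / 2)).
- rewrite mulr0 atan0 sube0 -EFinM; congr (_%:E); by field.
- by move=> x _; exact: cauchy_kernel_ge0.
- by apply: continuous_subspaceT => x; exact: continuous_cauchy_kernel.
- apply: (@cvg_comp _ _ _ (fun x => s^-1 * x) (@atan R) +oo +oo); last exact: cvgy_atan.
  by apply: gt0_cvgMry; [rewrite invr_gt0|exact: cvg_id].
- move=> x _; apply: ex_derive.
- apply: cvg_at_right_filter; apply: cvg_comp; last exact: continuous_atan.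
  by apply: cvgMr; exact: cvg_id.
- move=> x _; rewrite /cauchy_kernel.
  rewrite derive1E; apply: derive_val.
Qed.
End Cauchy.

Section Damping.
Context {R : realType}.
Notation RR := (measurableTypeR R).
Notation leb := (@lebesgue_measure R).

(** The cosine transform of exp(-s|t|), with 1 + cos in place of cos so
    that the integrand is nonnegative. *)
Lemma integral_1Dcos_expN (s z : R) : 0 < s ->
  (\int[leb]_t ((1 + cos ((t : R) * z)) * expR (- (s * `|t : R|)))%:E =
   (2 * (s^-1 + cauchy_kernel s z))%:E)%E.
Proof.
move=> s0.
pose f (t : R) := (1 + cos (t * z)) * expR (- (s * `|t|)).
pose g (t : R) := (1 + cos (t * z)) * expR (- (s * t)).
(* A primitive of g, vanishing at infinity. *)
pose F (t : R) := expR (- (s * t)) * (- s^-1 + (z * sin (t * z) - s * cos (t * z)) / (s ^+ 2 + z ^+ 2)).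
have s1 : s != 0 by rewrite gt_eqF.
have sz : 0 < s ^+ 2 + z ^+ 2 by rewrite ltr_pwDl ?exprn_gt0// sqr_ge0.
have s2 : s ^+ 2 + z ^+ 2 != 0 by rewrite gt_eqF.
have HF (t : R) : is_derive t (1 : R) F (g t).
  rewrite /F; apply: is_derive_eq; rewrite /g /GRing.scale /= ?mulr1 ?mulr0 ?addr0 ?add0r.
  by field; rewrite s1 s2.
have g0 t : 0 <= g t.
  rewrite mulr_ge0 ?expR_ge0//; have := cos_geN1 (t * z); lra.
have f0 t : 0 <= f t.
  rewrite mulr_ge0 ?expR_ge0//; have := cos_geN1 (t * z); lra.
have cf : continuous f.
  move=> t; apply: cvgM.
    apply: cvgD; first exact: cvg_cst.
    apply: cvg_comp; last exact: continuous_cos.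
    by apply: cvgMl; exact: cvg_id.
  apply: cvg_comp; last exact: continuous_expR.
  by apply: cvgN; apply: cvgMr; apply: cvg_norm; exact: cvg_id.
have cg : continuous g.
  move=> t; apply: cvgM.
    apply: cvgD; first exact: cvg_cst.
    apply: cvg_comp; last exact: continuous_cos.
    by apply: cvgMl; exact: cvg_id.
  apply: cvg_comp; last exact: continuous_expR.
  by apply: cvgN; apply: cvgMr; exact: cvg_id.
rewrite (@ge0_symfun_integralT _ f)//; last first.
  by move=> t /=; rewrite /f normrN mulNr cosN.
have -> : (\int[leb]_(x in [set x | (0 <= x)%R]) (f x)%:E =
    \int[leb]_(x in `[0%R, +oo[%classic) (g x)%:E)%E.
  rewrite -set_itvcy; apply: eq_integral => x; rewrite inE /= in_itv /= andbT => x0.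
  by rewrite /f /g ger0_norm.
rewrite (@ge0_continuous_FTC2y _ _ F _ 0)//.
- rewrite -EFinB -EFinM; congr (_%:E).
  rewrite /F /cauchy_kernel !(mulr0, mul0r) oppr0 expR0 sin0 cos0.
  by field; rewrite s1 s2.
- by apply: continuous_subspaceT => x; exact: cg.
- pose M := s^-1 + (`|z| + s) / (s ^+ 2 + z ^+ 2).
  have FM t : `|F t| <= expR (- (s * t)) * M.
    rewrite normrM ger0_norm ?expR_ge0// ler_wpM2l ?expR_ge0//.
    apply: (le_trans (ler_normD _ _)); apply: lerD.
      by rewrite normrN gtr0_norm// invr_gt0.
    rewrite normrM [X in _ * X]gtr0_norm ?invr_gt0// ler_pM2r ?invr_gt0//.
    apply: (le_trans (ler_normB _ _)); apply: lerD.
      by rewrite normrM ler_piMr// ler_norml sin_geN1 sin_le1.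
    by rewrite normrM (gtr0_norm s0) ler_piMr ?(ltW s0)// ler_norml cos_geN1 cos_le1.
  have e0 : expR (- (s * t)) * M @[t --> +oo] --> 0.
    rewrite -(mul0r M); apply: cvgMl.
    apply: (@cvg_comp _ _ _ (fun t => s * t) (fun x => expR (- x)) +oo +oo).
      by apply: gt0_cvgMry; [|exact: cvg_id].
    exact: cvgr_expR.
  apply/norm_cvg0P; apply: (squeeze_cvgr _ (cvg_cst 0) e0).
  by apply: nearW => t; rewrite normr_ge0 FM.
- apply: cvg_at_right_filter; apply: differentiable_continuous.
  by apply/derivable1_diffP; have := HF 0; move=> /@ex_derive.
- by move=> x _; rewrite derive1E; have := HF x => h; exact: derive_val.
Qed.

Lemma measurable_expNabs (s : R) :
  measurable_fun setT ((fun t : R => expR (- (s * `|t|))) : RR -> RR).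
Proof.
apply: (measurableT_comp (@measurable_expR R)).
apply: measurable_funN; apply: measurable_funM => //.
Qed.

Lemma integrable_expNabs (s : R) : 0 < s ->
  leb.-integrable setT (EFin \o (fun t : R => expR (- (s * `|t|)))).
Proof.
move=> s0; apply/integrableP; split.
  by apply/measurable_EFinP; exact: measurable_expNabs.
apply: (@le_lt_trans _ _ (\int[leb]_t ((1 + cos ((t : R) * 0)) * expR (- (s * `|t : R|)))%:E)%E).
  apply: ge0_le_integral => //.
  - by apply/measurable_EFinP; apply: measurableT_comp => //; exact: measurable_expNabs.
  - apply/measurable_EFinP; apply: measurable_funM; last exact: measurable_expNabs.
    by under eq_fun do rewrite mulr0 cos0; exact: measurable_cst.
  - move=> t _ /=; rewrite lee_fin ger0_norm ?expR_ge0// mulr0 cos0.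
    by rewrite ler_peMl ?expR_ge0// lerDl.
by rewrite integral_1Dcos_expN// ltry.
Qed.

Lemma measurable_cosM (z : R) : measurable_fun setT ((fun t : R => cos (t * z)) : RR -> RR).
Proof.
apply: (measurableT_comp (f := @cos R)); first exact: (continuous_measurable_fun (@continuous_cos R)).
exact: mulrr_measurable.
Qed.

Lemma measurable_sinM (z : R) : measurable_fun setT ((fun t : R => sin (t * z)) : RR -> RR).
Proof.
apply: (measurableT_comp (f := @sin R)); first exact: (continuous_measurable_fun (@continuous_sin R)).
exact: mulrr_measurable.
Qed.

Lemma Rintegral_expNabs (s : R) : 0 < s ->
  \int[leb]_t expR (- (s * `|t : R|)) = 2 / s.
Proof.
move=> s0; have := integral_1Dcos_expN 0 s0.
rewrite /cauchy_kernel expr0n/= addr0 => H.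
have : \int[leb]_t (2 * expR (- (s * `|t : R|))) = 2 * (s^-1 + s / s ^+ 2).
  rewrite /Rintegral -[RHS]/(fine (2 * (s^-1 + s / s ^+ 2))%:E) -H.
  by congr fine; apply: eq_integral => t _; rewrite mulr0 cos0.
rewrite RintegralZl//; last exact: integrable_expNabs.
move=> /mulfI -> //; field; exact: lt0r_neq0.
Qed.

Lemma integrable_cos_expN (s z : R) : 0 < s ->
  leb.-integrable setT (EFin \o (fun t : R => cos (t * z) * expR (- (s * `|t|)))).
Proof.
move=> s0; apply: (le_integrable _ _ _ (integrable_expNabs s0)) => //.
  apply/measurable_EFinP; apply: measurable_funM; first exact: measurable_cosM.
  exact: measurable_expNabs.
move=> t _ /=; rewrite lee_fin normrM ler_piMl//.
by rewrite ler_norml cos_geN1 cos_le1.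
Qed.

Lemma integrable_sin_expN (s z : R) : 0 < s ->
  leb.-integrable setT (EFin \o (fun t : R => sin (t * z) * expR (- (s * `|t|)))).
Proof.
move=> s0; apply: (le_integrable _ _ _ (integrable_expNabs s0)) => //.
  apply/measurable_EFinP; apply: measurable_funM; first exact: measurable_sinM.
  exact: measurable_expNabs.
move=> t _ /=; rewrite lee_fin normrM ler_piMl//.
by rewrite ler_norml sin_geN1 sin_le1.
Qed.

Lemma Rintegral_cos_expN (s z : R) : 0 < s ->
  \int[leb]_t (cos ((t : R) * z) * expR (- (s * `|t : R|))) = 2 * cauchy_kernel s z.
Proof.
move=> s0; have H := integral_1Dcos_expN z s0.
have : \int[leb]_t (expR (- (s * `|t : R|)) + cos ((t : R) * z) * expR (- (s * `|t : R|)))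
    = 2 * (s^-1 + cauchy_kernel s z).
  rewrite /Rintegral -[RHS]/(fine (2 * (s^-1 + cauchy_kernel s z))%:E) -H.
  by congr fine; apply: eq_integral => t _; rewrite mulrDl mul1r.
rewrite RintegralD//; [|exact: integrable_expNabs|exact: integrable_cos_expN].
by rewrite Rintegral_expNabs// mulrDr => /addrI.
Qed.

(** The damping factor.  Compared with exp(-s|t|) alone, the combination
    has a transform decaying like z^(-4), hence with a second moment. *)
Definition damp (s t : R) : R := 2 * expR (- (s * `|t|)) - expR (- (2 * s * `|t|)).

(** Half the Fourier transform of [damp]; its integral is pi. *)
Definition damp_kernel (s z : R) : R := 2 * cauchy_kernel s z - cauchy_kernel (2 * s) z.

(** With e = exp(-s|t|) the damping factor is 1 - (1 - e)^2. *)
Lemma damp_bounds (s t : R) : 0 < s ->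
  [/\ 0 <= damp s t, damp s t <= 1 & 1 - damp s t <= (s * t) ^+ 2].
Proof.
move=> s0; rewrite /damp; set e := expR (- (s * `|t|)).
have st0 : 0 <= s * `|t| by rewrite mulr_ge0// ltW.
have e0 : 0 < e by exact: expR_gt0.
have e1 : e <= 1 by rewrite /e -expR0 ler_expR; lra.
have -> : expR (- (2 * s * `|t|)) = e ^+ 2.
  by rewrite -expRM_natl; congr expR; ring.
have e2 : 1 - s * `|t| <= e by apply: le_trans (expR_ge1Dx _); lra.
have -> : (s * t) ^+ 2 = (s * `|t|) ^+ 2 by rewrite !exprMn real_normK ?num_real.
by split; nra.
Qed.

Lemma measurable_damp s : measurable_fun setT (damp s : RR -> RR).
Proof.
apply: measurable_funB.
  by apply: measurable_funM => //; exact: measurable_expNabs.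
exact: measurable_expNabs.
Qed.

Lemma integrable_damp s : 0 < s -> leb.-integrable setT (EFin \o damp s).
Proof.
move=> s0; have s20 : 0 < 2 * s by rewrite mulr_gt0.
have := integrableB measurableT (integrableZl measurableT 2 (integrable_expNabs s0))
   (integrable_expNabs s20).
by apply: eq_integrable => // t _ /=.
Qed.

Lemma Rintegral_cos_damp (s z : R) : 0 < s ->
  \int[leb]_t (cos ((t : R) * z) * damp s t) = 2 * damp_kernel s z.
Proof.
move=> s0; have s20 : 0 < 2 * s by rewrite mulr_gt0.
transitivity (\int[leb]_t (2 * (cos ((t : R) * z) * expR (- (s * `|t : R|))) -
   cos ((t : R) * z) * expR (- (2 * s * `|t : R|)))).
  by apply: eq_Rintegral => t _; rewrite /damp; ring.
have i1 := integrable_cos_expN z s0.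
have i2 := integrable_cos_expN z s20.
rewrite RintegralB//; last first.
  by have := integrableZl measurableT 2 i1; apply: eq_integrable.
rewrite RintegralZl// !Rintegral_cos_expN// /damp_kernel; ring.
Qed.

Lemma Rintegral_sin_damp (s z : R) : 0 < s ->
  \int[leb]_t (sin ((t : R) * z) * damp s t) = 0.
Proof.
move=> s0; have s20 : 0 < 2 * s by rewrite mulr_gt0.
apply: Rintegral_odd0; last first.
  by move=> t; rewrite mulNr sinN mulNr /damp !normrN.
have i1 := integrable_sin_expN z s0.
have i2 := integrable_sin_expN z s20.
have := integrableB measurableT (integrableZl measurableT 2 i1) i2.
apply: eq_integrable => // t _ /=; rewrite -EFinM -EFinB; congr (_%:E).
by rewrite /damp; ring.
Qed.

Lemma damp_kernelE (s z : R) : 0 < s -> damp_kernel s z =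
  6 * s ^+ 3 / ((s ^+ 2 + z ^+ 2) * (4 * s ^+ 2 + z ^+ 2)).
Proof.
move=> s0.
have s2 : s ^+ 2 + z ^+ 2 != 0 by rewrite gt_eqF// ltr_pwDl ?exprn_gt0// sqr_ge0.
have s3 : 4 * s ^+ 2 + z ^+ 2 != 0.
  by rewrite gt_eqF// ltr_pwDl ?sqr_ge0// mulr_gt0// exprn_gt0.
rewrite /damp_kernel /cauchy_kernel exprMn -natrX; field.
by rewrite s2 s3.
Qed.

Lemma damp_kernel_ge0 (s z : R) : 0 < s -> 0 <= damp_kernel s z.
Proof.
move=> s0; rewrite damp_kernelE//.
have a : 0 <= s ^+ 2 + z ^+ 2 by rewrite addr_ge0// sqr_ge0.
have b : 0 <= 4 * s ^+ 2 + z ^+ 2 by rewrite addr_ge0 ?sqr_ge0// mulr_ge0// sqr_ge0.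
apply: divr_ge0; last exact: mulr_ge0.
by apply: mulr_ge0 => //; apply: exprn_ge0; exact: ltW.
Qed.

Lemma damp_kernel_sqr_le (s z : R) : 0 < s ->
  z ^+ 2 * damp_kernel s z <= 3 * s ^+ 2 * cauchy_kernel (2 * s) z.
Proof.
move=> s0; rewrite damp_kernelE// /cauchy_kernel exprMn -natrX.
have s2 : 0 < s ^+ 2 + z ^+ 2 by rewrite ltr_pwDl ?exprn_gt0// sqr_ge0.
have s3 : 0 < 4 * s ^+ 2 + z ^+ 2.
  by rewrite ltr_pwDl ?sqr_ge0// mulr_gt0// exprn_gt0.
have -> : z ^+ 2 * (6 * s ^+ 3 / ((s ^+ 2 + z ^+ 2) * (4 * s ^+ 2 + z ^+ 2))) =
   (6 * s ^+ 3 / (4 * s ^+ 2 + z ^+ 2)) * (z ^+ 2 / (s ^+ 2 + z ^+ 2)).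
  by field; rewrite !gt_eqF.
have -> : 3 * s ^+ 2 * (2 * s / ((2 ^ 2)%:R * s ^+ 2 + z ^+ 2)) =
   (6 * s ^+ 3 / (4 * s ^+ 2 + z ^+ 2)).
  by field; rewrite gt_eqF.
rewrite ler_piMr//; first by rewrite divr_ge0 ?mulr_ge0 ?exprn_ge0// ltW.
by rewrite ler_pdivrMr// mul1r lerDr sqr_ge0.
Qed.

Lemma continuous_damp_kernel (s : R) : 0 < s -> continuous (damp_kernel s).
Proof.
move=> s0 x; apply: cvgB.
  by apply: cvgMr; exact: continuous_cauchy_kernel.
by apply: continuous_cauchy_kernel; rewrite mulr_gt0.
Qed.

Lemma cauchy_kernel_scale (s x h : R) : 0 < h -> 0 < s ->
  h^-1 * cauchy_kernel s (x / h) = cauchy_kernel (h * s) x.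
Proof.
move=> h0 s0; rewrite /cauchy_kernel.
have s2 : 0 < s ^+ 2 + (x / h) ^+ 2 by rewrite ltr_pwDl ?exprn_gt0// sqr_ge0.
have s3 : 0 < (h * s) ^+ 2 + x ^+ 2.
  by rewrite ltr_pwDl ?sqr_ge0// exprn_gt0// mulr_gt0.
have -> : (h * s) ^+ 2 + x ^+ 2 = h ^+ 2 * (s ^+ 2 + (x / h) ^+ 2).
  by field; rewrite gt_eqF.
have hn : h != 0 by rewrite gt_eqF.
move: s2; set q := s ^+ 2 + _ => q0; have qn : q != 0 by rewrite gt_eqF.
by field; rewrite hn qn.
Qed.

Lemma damp_kernel_scale (s x h : R) : 0 < h -> 0 < s ->
  h^-1 * damp_kernel s (x / h) = damp_kernel (h * s) x.
Proof.
move=> h0 s0; rewrite /damp_kernel (mulrCA 2 h) -!(cauchy_kernel_scale x h0) ?mulr_gt0//.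
by rewrite mulrBr (mulrCA h^-1).
Qed.

End Damping.

(** * Smoothing the density with the damping kernel *)

Section LocalBias.
Context {R : realType}.
Notation RR := (measurableTypeR R).
Notation leb := (@lebesgue_measure R).

(** A function with bounded second derivative grows at most quadratically
    around each point. *)
Lemma quadratic_growth (f : R -> R) (x0 : R) :
  twice_differentiable f -> bounded_fct (derive1n 2 f) ->
  exists2 C : R, 0 <= C & forall x, `|f x - f x0| <= C * (`|x - x0| + (x - x0) ^+ 2).
Proof.
move=> df [M HM].
have M0 : 0 <= M by exact: (le_trans (normr_ge0 _) (HM 0)).
have mvt (g : R -> R) (a b : R) : (forall x, derivable g x 1) ->
    exists2 c, `|c - a| <= `|b - a| & g b - g a = derive1 g c * (b - a).
  move=> dg.
  have dgi x : is_derive x (1 : R) g (derive1 g x).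
    by rewrite derive1E; apply: DeriveDef.
  have cg : continuous g.
    by move=> x; apply: differentiable_continuous; apply/derivable1_diffP.
  have cgs (u v : R) : {within `[u, v], continuous g}.
    by apply: continuous_subspaceT.
  have [ab|ab|->] := ltgtP a b.
  - have [c + E] := MVT ab (fun x _ => dgi x) (cgs a b).
    rewrite in_itv /= => /andP[ac cb]; exists c => //.
    by rewrite !ger0_norm; lra.
  - have [c + E] := MVT ab (fun x _ => dgi x) (cgs b a).
    rewrite in_itv /= => /andP[ac cb]; exists c; last by lra.
    by rewrite !ler0_norm; lra.
  - by exists b => //; rewrite !subrr mulr0.
exists (`|derive1 f x0| + M); first by rewrite addr_ge0.
move=> x.
have [c cx ->] := mvt f x0 x (fun y => proj1 (df y)).
have [e _ E] := mvt (derive1 f) x0 c (fun y => proj2 (df y)).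
have He : `|derive1 (derive1 f) e| <= M by exact: HM.
rewrite normrM.
have h1 : `|derive1 f c| <= `|derive1 f x0| + M * `|x - x0|.
  rewrite -[derive1 f c](subrK (derive1 f x0)) E addrC.
  apply: (le_trans (ler_normD _ _)); rewrite lerD2l normrM.
  by apply: ler_pM.
have -> : (x - x0) ^+ 2 = `|x - x0| ^+ 2 by rewrite real_normK ?num_real.
move: h1; set A := `|derive1 f c|; set B := `|derive1 f x0|; set z := `|x - x0| => h1.
have z0 : 0 <= z by exact: normr_ge0.
have B0 : 0 <= B by exact: normr_ge0.
apply: (@le_trans _ _ ((B + M * z) * z)); first exact: ler_wpM2r.
have := mulr_ge0 M0 z0; have := mulr_ge0 B0 (sqr_ge0 z); lra.
Qed.

Lemma cauchy_kernel_le (s x : R) : 0 < s -> cauchy_kernel s x <= s^-1.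
Proof.
move=> s0; rewrite /cauchy_kernel.
have s2 : 0 < s ^+ 2 + x ^+ 2 by rewrite ltr_pwDl ?exprn_gt0// sqr_ge0.
rewrite ler_pdivrMr// mulrDr expr2 mulrA mulVf ?gt_eqF// mul1r lerDl mulr_ge0 ?sqr_ge0//.
by rewrite invr_ge0 ltW.
Qed.

Lemma measurable_cauchy_kernel_shift (s b : R) : 0 < s ->
  measurable_fun setT ((fun x : R => cauchy_kernel s (x + b)) : RR -> RR).
Proof.
move=> s0; apply: (measurableT_comp (f := cauchy_kernel s)).
  exact: (continuous_measurable_fun (continuous_cauchy_kernel s0)).
by apply: measurable_funD.
Qed.

Lemma integral_cauchy_kernel_shift (s b : R) : 0 < s ->
  (\int[leb]_x (cauchy_kernel s ((x : R) + b))%:E = pi%:E)%E.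
Proof.
move=> s0; rewrite -(integral_cauchy_kernel s0).
apply: (ge0_integral_shift (F := fun x => (cauchy_kernel s x)%:E)).
  apply/measurable_EFinP; exact: (continuous_measurable_fun (continuous_cauchy_kernel s0)).
by move=> x; rewrite lee_fin cauchy_kernel_ge0.
Qed.

Lemma integrable_cauchy_kernel_shift (s b : R) : 0 < s ->
  leb.-integrable setT (EFin \o (fun x : R => cauchy_kernel s (x + b))).
Proof.
move=> s0; apply/integrableP; split.
  by apply/measurable_EFinP; exact: measurable_cauchy_kernel_shift.
under eq_integral do rewrite /= ger0_norm ?cauchy_kernel_ge0//.
by rewrite integral_cauchy_kernel_shift// ltry.
Qed.

Lemma Rintegral_cauchy_kernel_shift (s b : R) : 0 < s ->
  \int[leb]_x cauchy_kernel s ((x : R) + b) = pi.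
Proof. by move=> s0; rewrite /Rintegral integral_cauchy_kernel_shift. Qed.

Lemma integrable_damp_kernel_shift (s b : R) : 0 < s ->
  leb.-integrable setT (EFin \o (fun x : R => damp_kernel s (x + b))) /\
  \int[leb]_x damp_kernel s ((x : R) + b) = pi.
Proof.
move=> s0; have s20 : 0 < 2 * s by rewrite mulr_gt0.
have i1 := integrable_cauchy_kernel_shift b s0; have i2 := integrable_cauchy_kernel_shift b s20.
have i3 : leb.-integrable setT (EFin \o (fun x : R => 2 * cauchy_kernel s (x + b))).
  by have := integrableZl measurableT 2 i1; apply: eq_integrable.
split.
  by have := integrableB measurableT i3 i2; apply: eq_integrable.
rewrite RintegralB// RintegralZl// !Rintegral_cauchy_kernel_shift//; lra.
Qed.

Context {d : measure_display} {T : measurableType d}.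
Variables (P : probability T R) (X : {mfun T >-> RR}) (f : R -> R) (x0 : R).
Hypothesis HXdens : has_density P leb (X : T -> RR) f.
Hypothesis Hf : twice_differentiable f.
Hypothesis Hf2 : bounded_fct (derive1n 2 f).

(** Smoothing at scale h s around x0 - h u moves f(x0) by O(h), with a
    constant growing quadratically in u. *)
Lemma local_bias_le : exists2 C : R, 0 <= C & forall h s u : R,
  0 < h <= 1 -> 0 < s <= 1 ->
  `|\int[P]_w damp_kernel (h * s) ((X w : R) - (x0 - h * u)) - pi * f x0| <=
    C * h * (1 + u ^+ 2).
Proof.
have [C0 C00 HC] := quadratic_growth x0 Hf Hf2.
exists (C0 * pi * 11); first by rewrite !mulr_ge0// pi_ge0.
move=> h s u /andP[h0 h1] /andP[s0 s1].
set b := - (x0 - h * u); set sg := h * s.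
have sg0 : 0 < sg by rewrite mulr_gt0.
have sg20 : 0 < 2 * sg by rewrite mulr_gt0.
have sgh : sg <= h by rewrite ler_piMr// ltW.
have [ik ek] := integrable_damp_kernel_shift b sg0.
have k0 x : 0 <= damp_kernel sg (x + b) by exact: damp_kernel_ge0.
have kM x : `|damp_kernel sg (x + b)| <= 2 * sg^-1.
  rewrite ger0_norm// /damp_kernel.
  have := cauchy_kernel_le (x + b) sg0; have := cauchy_kernel_ge0 (x + b) sg20; lra.
have mk : measurable_fun setT ((fun x : R => damp_kernel sg (x + b)) : RR -> RR).
  by apply/measurable_EFinP; exact: measurable_int ik.
have iF := has_density_integrable HXdens.
have ikf := bounded_integrable mk kM iF.
rewrite (Rintegral_density HXdens mk kM).
have ikx0 : leb.-integrable setT (EFin \o (fun x : R => damp_kernel sg (x + b) * f x0)).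
  have := integrableZr measurableT (f x0) ik; apply: eq_integrable => // x _ /=.
have -> : pi * f x0 = \int[leb]_x (damp_kernel sg ((x : R) + b) * f x0).
  by rewrite RintegralZr// ek.
rewrite -RintegralB//.
have ikB : leb.-integrable setT (EFin \o (fun x : R => damp_kernel sg (x + b) * f x -
    damp_kernel sg (x + b) * f x0)).
  by have := integrableB measurableT ikf ikx0; apply: eq_integrable.
apply: (le_trans (le_normr_Rintegral measurableT ikB)).
pose A := C0 * (sg + h * `|u| + 2 * h ^+ 2 * u ^+ 2).
pose B := C0 * (sg^-1 + 2) * (3 * sg ^+ 2).
have A0 : 0 <= A.
  rewrite mulr_ge0//; have := mulr_ge0 (ltW h0) (normr_ge0 u).
  have := mulr_ge0 (sqr_ge0 h) (sqr_ge0 u); lra.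
have B0 : 0 <= B.
  apply: mulr_ge0; last by rewrite mulr_ge0// sqr_ge0.
  by apply: mulr_ge0 => //; rewrite addr_ge0// invr_ge0 ltW.
have iA : leb.-integrable setT (EFin \o (fun x : R => A * damp_kernel sg (x + b))).
  by have := integrableZl measurableT A ik; apply: eq_integrable.
have iB : leb.-integrable setT (EFin \o (fun x : R => B * cauchy_kernel (2 * sg) (x + b))).
  have := integrableZl measurableT B (integrable_cauchy_kernel_shift b sg20).
  by apply: eq_integrable.
apply: (@le_trans _ _ (\int[leb]_x (A * damp_kernel sg ((x : R) + b) +
    B * cauchy_kernel (2 * sg) ((x : R) + b)))).
  apply: le_Rintegral => //.
  - exact: (integrable_norm ikB).
  - by have := integrableD measurableT iA iB; apply: eq_integrable.
  move=> x _; rewrite -mulrBr normrM (ger0_norm (k0 x)).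
  have y2k := damp_kernel_sqr_le (x + b) sg0.
  set y := (x : R) + b in y2k *; set k := damp_kernel sg y in y2k *.
  have k00 : 0 <= k by exact: k0.
  apply: (@le_trans _ _ (k * (C0 * ((sg + sg^-1 * y ^+ 2 + h * `|u|) + (2 * y ^+ 2 + 2 * h ^+ 2 * u ^+ 2))))).
    rewrite ler_wpM2l//; apply: (le_trans (HC x)); rewrite ler_wpM2l//.
    have -> : x - x0 = y - h * u by rewrite /y /b; ring.
    apply: lerD.
      apply: (le_trans (ler_normB _ _)); rewrite normrM (gtr0_norm h0) lerD2r.
      have sV : sg * sg^-1 = 1 by rewrite divff// gt_eqF.
      have sV0 : 0 < sg^-1 by rewrite invr_gt0.
      have -> : y ^+ 2 = `|y| ^+ 2 by rewrite real_normK ?num_real.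
      have -> : sg + sg^-1 * `|y| ^+ 2 = sg^-1 * (sg - `|y|) ^+ 2 + 2 * `|y|.
        by field; rewrite gt_eqF.
      have := mulr_ge0 (ltW sV0) (sqr_ge0 (sg - `|y|)); have := normr_ge0 y; lra.
    rewrite -subr_ge0 (_ : _ - _ = (y + h * u) ^+ 2) ?sqr_ge0//; ring.
  have -> : k * (C0 * ((sg + sg^-1 * y ^+ 2 + h * `|u|) + (2 * y ^+ 2 + 2 * h ^+ 2 * u ^+ 2))) =
     A * k + C0 * (sg^-1 + 2) * (y ^+ 2 * k) by rewrite /A; ring.
  rewrite lerD2l /B -[leRHS]mulrA ler_wpM2l// mulr_ge0// addr_ge0// invr_ge0 ltW//.
have EA : \int[leb]_x (A * damp_kernel sg ((x : R) + b)) = A * pi.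
  by rewrite RintegralZl// ek.
have EB : \int[leb]_x (B * cauchy_kernel (2 * sg) ((x : R) + b)) = B * pi.
  rewrite RintegralZl//; last exact: integrable_cauchy_kernel_shift.
  by rewrite Rintegral_cauchy_kernel_shift.
rewrite RintegralD// EA EB -mulrDl mulrC.
have -> : C0 * pi * 11 * h * (1 + u ^+ 2) = pi * (C0 * (11 * h * (1 + u ^+ 2))) by ring.
rewrite ler_wpM2l ?pi_ge0//.
have -> : B = C0 * (3 * sg + 6 * sg ^+ 2).
  by rewrite /B; field; rewrite gt_eqF.
rewrite /A -mulrDr ler_wpM2l//.
have u1 : `|u| <= 1 + u ^+ 2.
  have -> : u ^+ 2 = `|u| ^+ 2 by rewrite real_normK ?num_real.
  have := sqr_ge0 (`|u| - 1); have := normr_ge0 u; nra.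
have u2 := sqr_ge0 u.
have e1 : h * `|u| <= h * (1 + u ^+ 2) by rewrite ler_wpM2l// ltW.
have e2 : h ^+ 2 * u ^+ 2 <= h * u ^+ 2.
  by rewrite ler_wpM2r// expr2 ler_piMr// ltW.
have e3 : sg ^+ 2 <= h.
  rewrite expr2; apply: (@le_trans _ _ (h * 1)); last by rewrite mulr1.
  apply: ler_pM => //; try exact: ltW. by apply: le_trans h1.
have e4 : 0 <= h * u ^+ 2 by rewrite mulr_ge0// ltW.
lra.
Qed.

End LocalBias.

(** * Complex integrals and characteristic functions *)

Section ComplexFubini.
Context {R : realType}.
Notation RR := (measurableTypeR R).
Notation leb := (@lebesgue_measure R).
Notation Rc := complex.Re.
Notation Ic := complex.Im.

Lemma ReM (x y : R[i]) : Rc (x * y) = Rc x * Rc y - Ic x * Ic y.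
Proof. by case: x => a b; case: y => u v. Qed.

Lemma ImM (x y : R[i]) : Ic (x * y) = Rc x * Ic y + Ic x * Rc y.
Proof. by case: x => a b; case: y => u v. Qed.

Lemma complex_ext (x y : R[i]) : Rc x = Rc y -> Ic x = Ic y -> x = y.
Proof. by case: x => a b; case: y => u v /= -> ->. Qed.

Lemma normc_ge0 (x : R[i]) : 0 <= Normc.normc x.
Proof. by case: x => a b; exact: sqrtr_ge0. Qed.

Lemma Re_le_normc (x : R[i]) : `|Rc x| <= Normc.normc x.
Proof.
case: x => a b /=; rewrite -[leLHS]sqrtr_sqr.
by rewrite ler_wsqrtr// lerDl sqr_ge0.
Qed.

Lemma Im_le_normc (x : R[i]) : `|Ic x| <= Normc.normc x.
Proof.
case: x => a b /=; rewrite -[leLHS]sqrtr_sqr.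
by rewrite ler_wsqrtr// lerDr sqr_ge0.
Qed.

Lemma normc_le_ReIm (x : R[i]) : Normc.normc x <= `|Rc x| + `|Ic x|.
Proof.
case: x => a b /=.
rewrite -[leRHS]ger0_norm ?addr_ge0// -sqrtr_sqr ler_wsqrtr//.
rewrite sqrrD -(real_normK (num_real a)) -(real_normK (num_real b)).
by rewrite -addrA lerD2l lerDr mulrn_wge0// mulr_ge0.
Qed.

Lemma expiD (s t : R) : expi (s + t) = expi s * expi t.
Proof. by apply: complex_ext; rewrite ?ReM ?ImM /= ?cosD ?sinD//; rewrite addrC (mulrC (cos s)). Qed.

Lemma normc_expi (t : R) : Normc.normc (expi t) = 1.
Proof. by rewrite /= cos2Dsin2 sqrtr1. Qed.

Context {d1 d2 : measure_display} {S1 : measurableType d1} {S2 : measurableType d2}.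

Lemma measurable_Rintegral_param (m2 : {sigma_finite_measure set S2 -> \bar R})
    (G : S1 * S2 -> R) : measurable_fun setT G ->
  measurable_fun setT (fun x => \int[m2]_y G (x, y)).
Proof.
move=> mG; have mGE : measurable_fun setT (EFin \o G) by apply/measurable_EFinP.
have E : (fun x => \int[m2]_y G (x, y)) = fine \o (fun x =>
   \int[m2]_y ((EFin \o G)^\+ (x, y)) - \int[m2]_y ((EFin \o G)^\- (x, y)))%E.
  apply/funext => x; rewrite /Rintegral /=; congr fine.
  rewrite integralE (funepos_comp (EFin \o G) (fun y => (x, y))).
  by rewrite (funeneg_comp (EFin \o G) (fun y => (x, y))).
rewrite E; apply: measurableT_comp; first exact: fine_measurable.
apply: emeasurable_funB.
  apply: (measurable_fun_fubini_tonelli_F (fun z => (EFin \o G)^\+ z)%E) => //.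
  exact: measurable_funepos.
apply: (measurable_fun_fubini_tonelli_F (fun z => (EFin \o G)^\- z)%E) => //.
exact: measurable_funeneg.
Qed.

(** Fubini's theorem for a x * F (x, y) * b y with F bounded and a, b
    integrable. *)
Lemma Rintegral_fubini_bounded (m1 : {sigma_finite_measure set S1 -> \bar R})
    (m2 : {sigma_finite_measure set S2 -> \bar R})
    (F : S1 * S2 -> R) (a : S1 -> R) (b : S2 -> R) (M : R) :
  measurable_fun setT F -> (forall z, `|F z| <= M) ->
  m1.-integrable setT (EFin \o a) -> m2.-integrable setT (EFin \o b) ->
  [/\ m1.-integrable setT (EFin \o (fun x => a x * \int[m2]_y (F (x, y) * b y))),
      m2.-integrable setT (EFin \o (fun y => b y * \int[m1]_x (F (x, y) * a x))) &
      \int[m1]_x (a x * \int[m2]_y (F (x, y) * b y)) =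
      \int[m2]_y (b y * \int[m1]_x (F (x, y) * a x))].
Proof.
move=> mF FM ia ib.
have [iab _] := Rintegral_prod_mul ia ib.
have iG := bounded_integrable mF FM iab.
have iFb x : m2.-integrable setT (EFin \o (fun y => F (x, y) * b y)).
  by apply: bounded_integrable (measurable_fun_pair2 _ mF) (fun y => FM _) ib.
have iFa y : m1.-integrable setT (EFin \o (fun x => F (x, y) * a x)).
  by apply: bounded_integrable (measurable_fun_pair1 _ mF) (fun x => FM _) ia.
pose G (z : S1 * S2) : \bar R := (F z * (a z.1 * b z.2))%:E.
have E1 x : (\int[m2]_y G (x, y) = (a x * \int[m2]_y (F (x, y) * b y))%:E)%E.
  rewrite -RintegralZl// /Rintegral fineK; last first.
    apply: integrable_fin_num => //.
    by have := integrableZl measurableT (a x) (iFb x); apply: eq_integrable.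
  by apply: eq_integral => y _; rewrite /G /= mulrCA.
have E2 y : (\int[m1]_x G (x, y) = (b y * \int[m1]_x (F (x, y) * a x))%:E)%E.
  rewrite -RintegralZl// /Rintegral fineK; last first.
    apply: integrable_fin_num => //.
    by have := integrableZl measurableT (b y) (iFa y); apply: eq_integrable.
  by apply: eq_integral => x _; rewrite /G /= mulrA mulrC.
split.
- have := integrable_fubini_F iG; apply: eq_integrable => // x _.
  exact: E1.
- have mE : measurable_fun setT (fun y => (b y * \int[m1]_x (F (x, y) * a x))%:E).
    by have := measurable_fubini_G iG; apply: eq_measurable_fun => y _; exact: E2.
  have iK := integrableZl measurableT (M * \int[m1]_x `|a x|) ib.
  apply: (le_integrable measurableT mE _ iK) => y _ /=.
  rewrite lee_fin !normrM mulrC ler_wpM2r//.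
  apply: (le_trans (le_normr_Rintegral measurableT (iFa y))).
  apply: (@le_trans _ _ (M * \int[m1]_x `|a x|)); last first.
    by rewrite -normrM ler_norm.
  have iM := integrableZl measurableT M (integrable_norm ia).
  rewrite -RintegralZl//; last exact: (integrable_norm ia).
  apply: le_Rintegral => //; first exact: (integrable_norm (iFa y)).
  by move=> x _; rewrite normrM ler_wpM2r.
- have H := Fubini iG.
  rewrite /Rintegral; congr fine.
  transitivity (\int[m1]_x \int[m2]_y G (x, y))%E.
    by apply: eq_integral => x _; rewrite E1.
  rewrite [LHS]H; apply: eq_integral => y _; rewrite -E2//.
Qed.

End ComplexFubini.

Section FourierFubini.
Context {R : realType}.
Notation RR := (measurableTypeR R).
Notation leb := (@lebesgue_measure R).
Notation Rc := complex.Re.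
Notation Ic := complex.Im.

(** Integrability of a complex function: both components are integrable. *)
Definition Cintegrable {d} {S : measurableType d} (mu : {measure set S -> \bar R})
    (a : S -> R[i]) : Prop :=
  mu.-integrable setT (EFin \o (fun x => Rc (a x))) /\
  mu.-integrable setT (EFin \o (fun x => Ic (a x))).

Context {d2 : measure_display} {S2 : measurableType d2}.
Variable m2 : {sigma_finite_measure set S2 -> \bar R}.

Lemma measurable_cos_prod (v : S2 -> R) : measurable_fun setT (v : S2 -> RR) ->
  measurable_fun setT (fun z : RR * S2 => cos ((z.1 : R) * v z.2)).
Proof.
move=> mv; apply: (measurableT_comp (f := @cos R)).
  exact: (continuous_measurable_fun (@continuous_cos R)).
apply: measurable_funM; first exact: measurable_fst.
by apply: (measurableT_comp mv); exact: measurable_snd.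
Qed.

Lemma measurable_sin_prod (v : S2 -> R) : measurable_fun setT (v : S2 -> RR) ->
  measurable_fun setT (fun z : RR * S2 => sin ((z.1 : R) * v z.2)).
Proof.
move=> mv; apply: (measurableT_comp (f := @sin R)).
  exact: (continuous_measurable_fun (@continuous_sin R)).
apply: measurable_funM; first exact: measurable_fst.
by apply: (measurableT_comp mv); exact: measurable_snd.
Qed.

Lemma normr_cos_le1 (x : R) : `|cos x| <= 1.
Proof. by rewrite ler_norml cos_geN1 cos_le1. Qed.

Lemma normr_sin_le1 (x : R) : `|sin x| <= 1.
Proof. by rewrite ler_norml sin_geN1 sin_le1. Qed.

(** Exchange of a Fourier integral with a second integral. *)
Lemma Cintegral_fubini (v : S2 -> R) (a : R -> R[i]) (b : S2 -> R) :
  measurable_fun setT (v : S2 -> RR) ->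
  Cintegrable leb a -> m2.-integrable setT (EFin \o b) ->
  Cintegral leb (fun t : R => a t * Cintegral m2 (fun s => expi (t * v s) * (b s)%:C%C)) =
  Cintegral m2 (fun s => (b s)%:C%C * Cintegral leb (fun t : R => expi (t * v s) * a t)).
Proof.
move=> mv [iar iai] ib.
have mc := measurable_cos_prod mv; have ms := measurable_sin_prod mv.
have [l1 r1 e1] := Rintegral_fubini_bounded mc (fun z => normr_cos_le1 _) iar ib.
have [l2 r2 e2] := Rintegral_fubini_bounded mc (fun z => normr_cos_le1 _) iai ib.
have [l3 r3 e3] := Rintegral_fubini_bounded ms (fun z => normr_sin_le1 _) iar ib.
have [l4 r4 e4] := Rintegral_fubini_bounded ms (fun z => normr_sin_le1 _) iai ib.
have Cre t : \int[m2]_s Rc (expi (t * v s) * (b s)%:C%C) = \int[m2]_s (cos (t * v s) * b s).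
  by apply: eq_Rintegral => s _; rewrite ReM /= mulr0 subr0.
have Cim t : \int[m2]_s Ic (expi (t * v s) * (b s)%:C%C) = \int[m2]_s (sin (t * v s) * b s).
  by apply: eq_Rintegral => s _; rewrite ImM /= mulr0 add0r.
have mvs s : measurable_fun setT ((fun t : R => cos (t * v s)) : RR -> RR).
  exact: measurable_cosM.
have mvs' s : measurable_fun setT ((fun t : R => sin (t * v s)) : RR -> RR).
  exact: measurable_sinM.
have i1 s := bounded_integrable (mvs s) (fun t => normr_cos_le1 _) iar.
have i2 s := bounded_integrable (mvs s) (fun t => normr_cos_le1 _) iai.
have i3 s := bounded_integrable (mvs' s) (fun t => normr_sin_le1 _) iar.
have i4 s := bounded_integrable (mvs' s) (fun t => normr_sin_le1 _) iai.
have Dre s : \int[leb]_t Rc (expi ((t : R) * v s) * a t) =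
    \int[leb]_t (cos ((t : R) * v s) * Rc (a t)) - \int[leb]_t (sin ((t : R) * v s) * Ic (a t)).
  rewrite -RintegralB//.
  by apply: eq_Rintegral => t _; rewrite ReM.
have Dim s : \int[leb]_t Ic (expi ((t : R) * v s) * a t) =
    \int[leb]_t (cos ((t : R) * v s) * Ic (a t)) + \int[leb]_t (sin ((t : R) * v s) * Rc (a t)).
  rewrite -RintegralD//.
  by apply: eq_Rintegral => t _; rewrite ImM.
apply: complex_ext => /=.
  transitivity (\int[leb]_t (Rc (a t) * (\int[m2]_s (cos ((t : R) * v s) * b s)) -
     Ic (a t) * (\int[m2]_s (sin ((t : R) * v s) * b s)))).
    by apply: eq_Rintegral => t _; rewrite ReM /= Cre Cim.
  rewrite (RintegralB measurableT l1 l4) e1 e4 -(RintegralB measurableT r1 r4).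
  by apply: eq_Rintegral => s _; rewrite /= mul0r subr0 Dre mulrBr.
transitivity (\int[leb]_t (Rc (a t) * (\int[m2]_s (sin ((t : R) * v s) * b s)) +
     Ic (a t) * (\int[m2]_s (cos ((t : R) * v s) * b s)))).
  by apply: eq_Rintegral => t _; rewrite ImM /= Cre Cim.
rewrite (RintegralD measurableT l3 l2) e3 e2 -(RintegralD measurableT r3 r2).
by apply: eq_Rintegral => s _; rewrite /= mul0r addr0 Dim mulrDr addrC.
Qed.

End FourierFubini.

Section Charfun.
Context {R : realType} {d : measure_display} {T : measurableType d}.
Variable P : probability T R.
Notation RR := (measurableTypeR R).
Notation Rc := complex.Re.
Notation Ic := complex.Im.

Lemma integrable_cos_rv (V : {mfun T >-> RR}) (t : R) :
  P.-integrable setT (EFin \o (fun w => cos (t * V w))).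
Proof.
apply: (@bounded_integrable_prob _ _ _ P _ 1); last by move=> w; exact: normr_cos_le1.
apply: (measurableT_comp (f := @cos R)).
  exact: (continuous_measurable_fun (@continuous_cos R)).
by apply: measurable_funM => //; exact: (measurable_funPT V).
Qed.

Lemma integrable_sin_rv (V : {mfun T >-> RR}) (t : R) :
  P.-integrable setT (EFin \o (fun w => sin (t * V w))).
Proof.
apply: (@bounded_integrable_prob _ _ _ P _ 1); last by move=> w; exact: normr_sin_le1.
apply: (measurableT_comp (f := @sin R)).
  exact: (continuous_measurable_fun (@continuous_sin R)).
by apply: measurable_funM => //; exact: (measurable_funPT V).
Qed.

Lemma charfunE (V : T -> R) (t : R) : characteristic_fun P V t =
  ((\int[P]_w cos (t * V w)) +i* (\int[P]_w sin (t * V w)))%C.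
Proof. by []. Qed.

(** The characteristic function of a sum of independent variables is the
    product of the characteristic functions. *)
Lemma charfun_add_indep (U V : {mfun T >-> RR}) (t : R) :
  (forall A B : set RR, measurable A -> measurable B ->
     P ((U : T -> R) @^-1` A `&` (V : T -> R) @^-1` B) =
     (P ((U : T -> R) @^-1` A) * P ((V : T -> R) @^-1` B))%E) ->
  characteristic_fun P (fun w => (U w : R) + V w) t =
  characteristic_fun P (fun w => U w : R) t * characteristic_fun P (fun w => V w : R) t.
Proof.
move=> UV.
have ic := integrable_cos_rv ; have is' := integrable_sin_rv.
have mcU : measurable_fun setT ((fun x : R => cos (t * x)) : RR -> RR).
  apply: (measurableT_comp (f := @cos R)).
    exact: (continuous_measurable_fun (@continuous_cos R)).
  exact: mulrl_measurable.
have msU : measurable_fun setT ((fun x : R => sin (t * x)) : RR -> RR).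
  apply: (measurableT_comp (f := @sin R)).
    exact: (continuous_measurable_fun (@continuous_sin R)).
  exact: mulrl_measurable.
have key (p q : R -> R) : measurable_fun setT (p : RR -> RR) -> measurable_fun setT (q : RR -> RR) ->
    (forall x, `|p x| <= 1) -> (forall x, `|q x| <= 1) ->
    P.-integrable setT (EFin \o (fun w => p (U w) * q (V w))) /\
    \int[P]_w (p (U w) * q (V w)) = (\int[P]_w p (U w)) * \int[P]_w q (V w).
  move=> mp mq p1 q1.
  have mpU : measurable_fun setT ((fun w => p (U w)) : T -> RR).
    by apply: (measurableT_comp mp); exact: (measurable_funPT U).
  have mqV : measurable_fun setT ((fun w => q (V w)) : T -> RR).
    by apply: (measurableT_comp mq); exact: (measurable_funPT V).
  pose pU := mkmfun mpU; pose qV := mkmfun mqV.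
  have i1 : P.-integrable setT (EFin \o (fun w => p (U w))).
    exact: (@bounded_integrable_prob _ _ _ P _ 1).
  have i2 : P.-integrable setT (EFin \o (fun w => q (V w))).
    exact: (@bounded_integrable_prob _ _ _ P _ 1).
  have i3 : P.-integrable setT (EFin \o (fun w => p (U w) * q (V w))).
    exact: bounded_integrable mpU (fun w => p1 _) i2.
  split => //; apply: (Rintegral_indep_mul (U := pU) (V := qV)) => // A B mA mB.
  have mA' : measurable (p @^-1` A : set RR) by rewrite -[_ @^-1` _]setTI; exact: mp.
  have mB' : measurable (q @^-1` B : set RR) by rewrite -[_ @^-1` _]setTI; exact: mq.
  exact: (UV _ _ mA' mB').
have [cc1 cc2] := key _ _ mcU mcU (fun x => normr_cos_le1 _) (fun x => normr_cos_le1 _).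
have [ss1 ss2] := key _ _ msU msU (fun x => normr_sin_le1 _) (fun x => normr_sin_le1 _).
have [cs1 cs2] := key _ _ mcU msU (fun x => normr_cos_le1 _) (fun x => normr_sin_le1 _).
have [sc1 sc2] := key _ _ msU mcU (fun x => normr_sin_le1 _) (fun x => normr_cos_le1 _).
rewrite !charfunE; apply: complex_ext => /=.
  rewrite -cc2 -ss2 -RintegralB//.
  by apply: eq_Rintegral => w _; rewrite mulrDr cosD.
rewrite -cs2 -sc2 -RintegralD//.
by apply: eq_Rintegral => w _; rewrite mulrDr sinD addrC.
Qed.

End Charfun.

(** * Bias of the estimator *)

Section ComplexIntegralFacts.
Context {R : realType}.
Notation Rc := complex.Re.
Notation Ic := complex.Im.
Context {d1 : measure_display} {S : measurableType d1}.
Variable mu : {measure set S -> \bar R}.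

Lemma eq_Cintegral (F G : S -> R[i]) : (forall x, F x = G x) ->
  Cintegral mu F = Cintegral mu G.
Proof. by move=> FG; congr Cintegral; apply/funext. Qed.

Lemma CintegralZl (r : R) (F : S -> R[i]) : Cintegrable mu F ->
  Cintegral mu (fun x => r%:C%C * F x) = r%:C%C * Cintegral mu F.
Proof.
move=> [iR iI]; apply: complex_ext; rewrite ?ReM ?ImM /= ?mul0r ?subr0 ?addr0.
  rewrite -RintegralZl//; apply: eq_Rintegral => x _.
  by rewrite ReM /= mul0r subr0.
rewrite -RintegralZl//; apply: eq_Rintegral => x _.
by rewrite ImM /= mul0r addr0.
Qed.

Lemma Cintegrable_Zl (r : R) (F : S -> R[i]) : Cintegrable mu F ->
  Cintegrable mu (fun x => r%:C%C * F x).
Proof.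
move=> [iR iI]; split.
  have := integrableZl measurableT r iR; apply: eq_integrable => // x _ /=.
  by rewrite ReM /= mul0r subr0.
have := integrableZl measurableT r iI; apply: eq_integrable => // x _ /=.
by rewrite ImM /= mul0r addr0.
Qed.

Lemma Cintegrable_bounded_mul (g F : S -> R[i]) (M : R) :
  measurable_fun setT (fun x => Rc (g x)) -> measurable_fun setT (fun x => Ic (g x)) ->
  (forall x, Normc.normc (g x) <= M) ->
  Cintegrable mu F -> Cintegrable mu (fun x => g x * F x).
Proof.
move=> mR mI gM [iR iI].
have RM x : `|Rc (g x)| <= M by apply: le_trans (gM x); exact: Re_le_normc.
have IM x : `|Ic (g x)| <= M by apply: le_trans (gM x); exact: Im_le_normc.
have i1 := bounded_integrable mR RM iR; have i2 := bounded_integrable mI IM iI.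
have i3 := bounded_integrable mR RM iI; have i4 := bounded_integrable mI IM iR.
split.
  have := integrableB measurableT i1 i2; apply: eq_integrable => // x _ /=.
  by rewrite ReM.
have := integrableD measurableT i3 i4; apply: eq_integrable => // x _ /=.
by rewrite ImM.
Qed.

End ComplexIntegralFacts.

Section Expi.
Context {R : realType}.
Notation RR := (measurableTypeR R).
Notation leb := (@lebesgue_measure R).
Notation Rc := complex.Re.
Notation Ic := complex.Im.

Lemma Cintegrable_expi (z : R) (F : R -> R[i]) : Cintegrable leb F ->
  Cintegrable leb (fun t : R => expi (t * z) * F t).
Proof.
apply: (Cintegrable_bounded_mul (M := 1)).
- exact: measurable_cosM.
- exact: measurable_sinM.
- by move=> t; rewrite normc_expi.
Qed.

Lemma Cintegral_expi_damp (s z : R) : 0 < s ->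
  Cintegral leb (fun t : R => expi (t * z) * (damp s t)%:C%C) = (2 * damp_kernel s z)%:C%C.
Proof.
move=> s0; apply: complex_ext => /=.
  rewrite -Rintegral_cos_damp//; apply: eq_Rintegral => t _.
  by rewrite mulr0 subr0.
by rewrite -[RHS](Rintegral_sin_damp z s0); apply: eq_Rintegral => t _; rewrite mulr0 add0r.
Qed.

Lemma Cintegrable_real (g : R -> R) : leb.-integrable setT (EFin \o g) ->
  Cintegrable leb (fun t : R => (g t)%:C%C).
Proof.
move=> ig; split => //=.
exact: integrable0.
Qed.

End Expi.

Section Bias.
Context {R : realType} {d : measure_display} {T : measurableType d}.
Variable P : probability T R.
Notation RR := (measurableTypeR R).
Notation leb := (@lebesgue_measure R).
Notation Rc := complex.Re.
Notation Ic := complex.Im.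
Variables (X e : {mfun T >-> RR}) (f K : R -> R) (x0 d0 : R).
Hypothesis indep : forall A B : set RR, measurable A -> measurable B ->
     P ((X : T -> R) @^-1` A `&` (e : T -> R) @^-1` B) =
     (P ((X : T -> R) @^-1` A) * P ((e : T -> R) @^-1` B))%E.
Hypothesis HXdens : has_density P leb (X : T -> RR) f.
Hypothesis Hf : twice_differentiable f.
Hypothesis Hf2 : bounded_fct (derive1n 2 f).
Hypothesis HKint : leb.-integrable setT (fun u => (K u)%:E).
Hypothesis HK1 : \int[leb]_u K u = 1.
Hypothesis HKm2int : leb.-integrable setT (fun u => (u ^+ 2 * K u)%:E).
Hypothesis Hd0 : 0 < d0.
Let phiK := fourier K.
Hypothesis Hii : forall t, d0 <= `|t| -> phiK t = 0.
Hypothesis mphiKRe : measurable_fun setT ((fun t => Rc (phiK t)) : RR -> RR).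
Hypothesis mphiKIm : measurable_fun setT ((fun t => Ic (phiK t)) : RR -> RR).
Let phie := characteristic_fun P (fun w => e w : R).
Hypothesis Hphie0 : forall t, 0 < Normc.normc (phie t).
Let Y (w : T) : R := (X w : R) + e w.
Let chX := characteristic_fun P (fun w => X w : R).
Let c : R := (2 * pi)^-1.

Lemma phie_neq0 t : phie t != 0.
Proof. by apply/eqP => h; have := Hphie0 t; rewrite h /= expr0n /= addr0 sqrtr0 ltxx. Qed.

Lemma normc_charfun_le (V : {mfun T >-> RR}) t :
  Normc.normc (characteristic_fun P (fun w => V w : R) t) <= 2.
Proof.
apply: (le_trans (normc_le_ReIm _)).
have -> : 2 = 1 + 1 :> R by [].
have ic := integrable_cos_rv P V t; have is' := integrable_sin_rv P V t.
apply: lerD => /=.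
  apply: (le_trans (le_normr_Rintegral measurableT ic)).
  rewrite -[leRHS](Rintegral_prob_cst P); apply: le_Rintegral => //.
  - exact: (integrable_norm ic).
  - exact: finite_measure_integrable_cst.
  - by move=> w _; exact: normr_cos_le1.
apply: (le_trans (le_normr_Rintegral measurableT is')).
rewrite -[leRHS](Rintegral_prob_cst P); apply: le_Rintegral => //.
- exact: (integrable_norm is').
- exact: finite_measure_integrable_cst.
- by move=> w _; exact: normr_sin_le1.
Qed.

Lemma normc_fourier_le t : Normc.normc (phiK t) <= 2 * \int[leb]_u `|K u|.
Proof.
apply: (le_trans (normc_le_ReIm _)).
have HKi : leb.-integrable setT (EFin \o K) by [].
have mc : measurable_fun setT ((fun x : R => cos (t * x)) : RR -> RR).
  by under eq_fun do rewrite mulrC; exact: measurable_cosM.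
have ms : measurable_fun setT ((fun x : R => sin (t * x)) : RR -> RR).
  by under eq_fun do rewrite mulrC; exact: measurable_sinM.
have ic := bounded_integrable mc (fun x => normr_cos_le1 _) HKi.
have is' := bounded_integrable ms (fun x => normr_sin_le1 _) HKi.
have ER : Rc (phiK t) = \int[leb]_u (cos (t * u) * K u).
  by apply: eq_Rintegral => u _; rewrite ReM /= mulr0 subr0.
have EI : Ic (phiK t) = \int[leb]_u (sin (t * u) * K u).
  by apply: eq_Rintegral => u _; rewrite ImM /= mulr0 add0r.
rewrite ER EI mulr_natl mulr2n; apply: lerD.
  apply: (le_trans (le_normr_Rintegral measurableT ic)).
  apply: le_Rintegral => //; [exact: (integrable_norm ic)|exact: (integrable_norm HKi)|].
  by move=> u _; rewrite normrM ler_piMl// normr_cos_le1.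
apply: (le_trans (le_normr_Rintegral measurableT is')).
apply: le_Rintegral => //; [exact: (integrable_norm is')|exact: (integrable_norm HKi)|].
by move=> u _; rewrite normrM ler_piMl// normr_sin_le1.
Qed.

Lemma measurable_charfun_Re (h : R) :
  measurable_fun setT ((fun t => Rc (chX (t / h))) : RR -> RR).
Proof.
have mXh : measurable_fun setT ((fun w => h^-1 * X w) : T -> RR).
  by apply: measurable_funM => //; exact: (measurable_funPT X).
have := measurable_Rintegral_param P (measurable_cos_prod mXh).
by apply: eq_measurable_fun => t _; apply: eq_Rintegral => w _ /=; rewrite mulrA.
Qed.

Lemma measurable_charfun_Im (h : R) :
  measurable_fun setT ((fun t => Ic (chX (t / h))) : RR -> RR).
Proof.
have mXh : measurable_fun setT ((fun w => h^-1 * X w) : T -> RR).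
  by apply: measurable_funM => //; exact: (measurable_funPT X).
have := measurable_Rintegral_param P (measurable_sin_prod mXh).
by apply: eq_measurable_fun => t _; apply: eq_Rintegral => w _ /=; rewrite mulrA.
Qed.

(** The integrand of the inversion integral giving the mean of the
    estimator. *)
Let alpha (h t : R) : R[i] := expi (t * (- (x0 / h))) * (phiK t * chX (t / h)).

(** In the mean, the characteristic function of the noise cancels. *)
Lemma mean_deconv_kernel (h : R) : 0 < h ->
  Cintegrable leb (fun t : R => phiK t / phie (t / h)) ->
  Cintegral P (fun w => deconv_kernel phiK phie h ((x0 - Y w) / h)) =
  Cintegral leb (fun t => c%:C%C * alpha h t).
Proof.
move=> h0 ipsi.
pose a (t : R) := c%:C%C * (expi (t * (- (x0 / h))) * (phiK t / phie (t / h))).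
have ia : Cintegrable leb a.
  by apply: Cintegrable_Zl; exact: Cintegrable_expi.
pose v (w : T) := Y w / h.
have mv : measurable_fun setT (v : T -> RR).
  apply: measurable_funM => //; apply: measurable_funD.
    exact: (measurable_funPT X).
  exact: (measurable_funPT e).
have i1 : P.-integrable setT (EFin \o (fun=> 1 : R)).
  exact: finite_measure_integrable_cst.
transitivity (Cintegral P (fun w => 1%:C%C * Cintegral leb (fun t : R => expi (t * v w) * a t))).
  apply: eq_Cintegral => w; rewrite mul1r /deconv_kernel -/c -CintegralZl; last first.
    have := Cintegrable_expi (- ((x0 - Y w) / h)) ipsi.
    by under eq_fun do rewrite mulrN.
  apply: eq_Cintegral => t; rewrite /a [RHS]mulrCA; congr (_ * _).
  rewrite [RHS]mulrA -expiD; congr (expi _ * _).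
  by rewrite /v; ring.
rewrite -(Cintegral_fubini mv ia i1).
apply: eq_Cintegral => t.
have -> : Cintegral P (fun w => expi (t * v w) * 1%:C%C) = characteristic_fun P Y (t / h).
  apply: eq_Cintegral => w; rewrite mulr1; congr expi; rewrite /v; ring.
rewrite [characteristic_fun P Y _](charfun_add_indep (t / h) indep) -/chX -/phie.
rewrite /a /alpha -!mulrA; congr (_ * (_ * (_ * _))).
by rewrite [chX _ * _]mulrC mulKf// phie_neq0.
Qed.

(** The damped inversion integral is an average of smoothed densities. *)
Lemma damped_mean (h s : R) : 0 < h -> 0 < s ->
  Cintegral leb (fun t : R => alpha h t * (damp s t)%:C%C) =
  (\int[leb]_u (K u * (2 * h * \int[P]_w damp_kernel (h * s) ((X w : R) - (x0 - h * u)))))%:C%C.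
Proof.
move=> h0 s0.
have i1 : P.-integrable setT (EFin \o (fun=> 1 : R)).
  exact: finite_measure_integrable_cst.
have idamp := Cintegrable_real (integrable_damp s0).
pose a2 (t : R) := expi (t * (- (x0 / h))) * (chX (t / h) * (damp s t)%:C%C).
have ia2 : Cintegrable leb a2.
  apply: Cintegrable_expi; apply: (Cintegrable_bounded_mul (M := 2)) => //.
  - exact: measurable_charfun_Re.
  - exact: measurable_charfun_Im.
  - by move=> t; exact: normc_charfun_le.
transitivity (Cintegral leb (fun t : R => a2 t * Cintegral leb (fun u : RR => expi (t * u) * (K u)%:C%C))).
  apply: eq_Cintegral => t; rewrite /alpha /a2 -/(fourier K t) -/phiK -!mulrA; congr (_ * _).
  by rewrite [RHS]mulrA [RHS]mulrC mulrA.
have HKi : leb.-integrable setT (EFin \o K) by [].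
rewrite (@Cintegral_fubini R _ RR leb id a2 K (@measurable_id _ RR setT) ia2 HKi).
have mXh : measurable_fun setT ((fun w => (X w : R) / h) : T -> RR).
  by apply: measurable_funM => //; exact: (measurable_funPT X).
transitivity (Cintegral leb (fun u : RR => (K u)%:C%C *
    (2 * h * \int[P]_w damp_kernel (h * s) ((X w : R) - (x0 - h * u)))%:C%C)); last first.
  apply: complex_ext => /=; first by apply: eq_Rintegral => u _; rewrite ?ReM /= mulr0 subr0.
  rewrite -[RHS](Rintegral_set0 leb (fun=> 0 : R)) Rintegral_set0 /Rintegral integral0_eq//.
  by move=> u _; rewrite ?ImM /= mulr0 mul0r addr0.
apply: eq_Cintegral => u; congr (_ * _).
pose a3 (t : R) := expi (t * (u - x0 / h)) * (damp s t)%:C%C.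
have ia3 : Cintegrable leb a3 by exact: Cintegrable_expi.
transitivity (Cintegral leb (fun t : R => a3 t *
    Cintegral P (fun w => expi (t * ((X w : R) / h)) * 1%:C%C))).
  apply: eq_Cintegral => t.
  have -> : Cintegral P (fun w => expi (t * ((X w : R) / h)) * 1%:C%C) = chX (t / h).
    apply: eq_Cintegral => w; rewrite mulr1; congr expi; ring.
  rewrite /a2 /a3 [RHS]mulrAC -[RHS]mulrA mulrA -expiD -mulrDr; congr (expi (t * _) * _).
rewrite (Cintegral_fubini mXh ia3 i1).
transitivity (Cintegral P (fun w => (2 * h * damp_kernel (h * s) ((X w : R) - (x0 - h * u)))%:C%C)).
  apply: eq_Cintegral => w; rewrite mul1r.
  transitivity (Cintegral leb (fun t : R => expi (t * (((X w : R) - (x0 - h * u)) / h)) * (damp s t)%:C%C)).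
    apply: eq_Cintegral => t; rewrite /a3 mulrA -expiD; congr (expi _ * _).
    by field; rewrite gt_eqF.
  rewrite Cintegral_expi_damp//; congr (_%:C%C).
  by rewrite -damp_kernel_scale//; field; rewrite gt_eqF.
have hs0 : 0 < h * s by rewrite mulr_gt0.
apply: complex_ext => /=; last by rewrite /Rintegral integral0.
rewrite RintegralZl//.
apply: (@bounded_integrable_prob _ _ _ P _ (2 * (h * s)^-1)).
  apply: (measurableT_comp (f := damp_kernel (h * s))).
    exact: (continuous_measurable_fun (continuous_damp_kernel hs0)).
  by apply: measurable_funB => //; exact: (measurable_funPT X).
move=> w; rewrite ger0_norm ?damp_kernel_ge0// /damp_kernel.
have hs20 : 0 < 2 * (h * s) by rewrite mulr_gt0.
have := cauchy_kernel_le ((X w : R) - (x0 - h * u)) hs0.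
have := cauchy_kernel_ge0 ((X w : R) - (x0 - h * u)) hs20; lra.
Qed.

Let Kn : R := 2 * \int[leb]_u `|K u|.

Lemma Kn_ge0 : 0 <= Kn.
Proof. by rewrite mulr_ge0//; apply: Rintegral_ge0. Qed.

Lemma itv_indic_integral :
  leb.-integrable setT (EFin \o (\1_(`[- d0, d0]%classic : set RR) : RR -> R)) /\
  \int[leb]_t (\1_(`[- d0, d0]%classic : set RR) t : R) = 2 * d0.
Proof.
split; first exact: integrable_indic_itv.
rewrite /Rintegral integral_indic// setIT.
have E := @lebesgue_measure_itv R `[- d0, d0].
rewrite /= lte_fin gt0_cp// in E.
by rewrite [X in fine X]E -EFinB /= opprK; ring.
Qed.

Lemma phiK_le_indic t : Normc.normc (phiK t) <= Kn * \1_(`[- d0, d0]%classic : set RR) t.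
Proof.
rewrite indicE; have [td|td] := boolP (t \in (`[- d0, d0]%classic : set RR)).
  by rewrite mulr1; exact: normc_fourier_le.
rewrite mulr0 Hii ?Normc.normc0//.
move: td; rewrite notin_setE /= in_itv /= => /negP; rewrite -ler_norml -ltNge.
exact: ltW.
Qed.

Lemma Cintegrable_fourier : Cintegrable leb phiK.
Proof.
have [ii _] := itv_indic_integral.
have iK : leb.-integrable setT (EFin \o (fun t : RR => Kn * \1_(`[- d0, d0]%classic : set RR) t)).
  by have := integrableZl measurableT Kn ii; apply: eq_integrable.
split; apply: (le_integrable measurableT _ _ iK).
- exact/measurable_EFinP.
- move=> t _.
  have h1 := le_trans (Re_le_normc (phiK t)) (le_trans (phiK_le_indic t) (ler_norm _)).
  by rewrite /= lee_fin; exact: h1.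
- exact/measurable_EFinP.
- move=> t _.
  have h1 := le_trans (Im_le_normc (phiK t)) (le_trans (phiK_le_indic t) (ler_norm _)).
  by rewrite /= lee_fin; exact: h1.
Qed.

Lemma Cintegrable_alpha h : Cintegrable leb (alpha h).
Proof.
apply: Cintegrable_expi; under eq_fun do rewrite mulrC.
apply: (Cintegrable_bounded_mul (M := 2)).
- exact: measurable_charfun_Re.
- exact: measurable_charfun_Im.
- by move=> t; exact: normc_charfun_le.
- exact: Cintegrable_fourier.
Qed.

Lemma normc_alpha_le h t : Normc.normc (alpha h t) <=
  2 * Kn * \1_(`[- d0, d0]%classic : set RR) t.
Proof.
rewrite /alpha !Normc.normcM normc_expi mul1r mulrC -mulrA.
apply: ler_pM; rewrite ?normc_ge0//.
- exact: normc_charfun_le.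
- exact: phiK_le_indic.
Qed.

(** Damping costs O(s^2) on the support of phiK.  It is stated for a
    component p of complex numbers, either the real or the imaginary part. *)
Lemma damping_error_le (h s : R) (p : R[i] -> R) :
  (forall (z : R[i]) (r : R), p (z * r%:C%C) = p z * r) ->
  (forall z, `|p z| <= Normc.normc z) ->
  leb.-integrable setT (EFin \o (fun t => p (alpha h t))) -> 0 < s ->
  `|\int[leb]_t p (alpha h t) - \int[leb]_t p (alpha h t * (damp s t)%:C%C)| <=
    4 * Kn * d0 ^+ 3 * s ^+ 2.
Proof.
move=> pZ pn ip s0.
have dM t : `|damp s t| <= 1.
  by have [? ? _] := damp_bounds t s0; rewrite ger0_norm.
have ipd0 := bounded_integrable (measurable_damp s) dM ip.
have ipd : leb.-integrable setT (EFin \o (fun t => p (alpha h t * (damp s t)%:C%C))).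
  by move: ipd0; apply: eq_integrable => // t _ /=; rewrite pZ mulrC.
rewrite -RintegralB//.
have iD : leb.-integrable setT (EFin \o (fun t => p (alpha h t) - p (alpha h t * (damp s t)%:C%C))).
  by have := integrableB measurableT ip ipd; apply: eq_integrable.
apply: (le_trans (le_normr_Rintegral measurableT iD)).
have [ii ei] := itv_indic_integral.
pose Q := 2 * Kn * (s * d0) ^+ 2.
have iQ : leb.-integrable setT (EFin \o (fun t : RR => Q * \1_(`[- d0, d0]%classic : set RR) t)).
  by have := integrableZl measurableT Q ii; apply: eq_integrable.
apply: (@le_trans _ _ (\int[leb]_t (Q * \1_(`[- d0, d0]%classic : set RR) t))).
  apply: le_Rintegral => //; first exact: (integrable_norm iD).
  move=> t _; rewrite pZ -{1}[p _]mulr1 -mulrBr normrM.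
  have [e0 e1 e2] := damp_bounds t s0.
  rewrite [X in _ * X]ger0_norm ?subr_ge0//.
  have h1 := le_trans (pn _) (normc_alpha_le h t).
  apply: (@le_trans _ _ (2 * Kn * \1_(`[- d0, d0]%classic : set RR) t * (s * t) ^+ 2)).
    by apply: ler_pM => //; rewrite subr_ge0.
  rewrite indicE; case: (boolP (_ \in _)) => td; last by rewrite !mulr0 mul0r.
  rewrite !mulr1 /Q; apply: ler_wpM2l; first by rewrite mulr_ge0// Kn_ge0.
  rewrite !exprMn; apply: ler_wpM2l; first exact: sqr_ge0.
  move: td; rewrite inE /= in_itv /= -ler_norml => td.
  by rewrite -(real_normK (num_real t)) lerXn2r ?nnegrE// ltW.
rewrite RintegralZl// ei le_eqVlt; apply/orP; left; apply/eqP; rewrite /Q; ring.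
Qed.

(** The mean of the estimator is within O(h) of f x0: its real part
    approximates f x0, and its imaginary part is O(h). *)
Lemma bias_le : exists2 C : R, 0 <= C & forall h : R, 0 < h <= 1 ->
  Cintegrable leb (fun t : R => phiK t / phie (t / h)) ->
  let EG := Cintegral P (fun w => deconv_kernel phiK phie h ((x0 - Y w) / h)) in
  `|h^-1 * Rc EG - f x0| <= C * h /\ `|h^-1 * Ic EG| <= C * h.
Proof.
have [C0 C00 HC] := local_bias_le x0 HXdens Hf Hf2.
have HKi : leb.-integrable setT (EFin \o K) by [].
have pi0 : 0 < pi :> R by exact: pi_gt0.
have c0 : 0 < c by rewrite invr_gt0 mulr_gt0.
pose K2 : R := \int[leb]_u `|u ^+ 2 * K u|.
pose K0 : R := \int[leb]_u `|K u|.
have K20 : 0 <= K2 by exact: Rintegral_ge0.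
have K00 : 0 <= K0 by exact: Rintegral_ge0.
pose C1 := c * (4 * Kn * d0 ^+ 3); pose C2 := pi^-1 * (C0 * (K0 + K2)).
have C10 : 0 <= C1.
  exact: (mulr_ge0 (ltW c0) (mulr_ge0 (mulr_ge0 (ler0n _ 4) Kn_ge0) (exprn_ge0 3 (ltW Hd0)))).
have C20 : 0 <= C2.
  by rewrite mulr_ge0 ?invr_ge0 ?(ltW pi0)// mulr_ge0// addr_ge0.
exists (C1 + C2); first exact: addr_ge0.
move=> h /andP[h0 h1] ipsi EG.
have ia := Cintegrable_alpha h.
have EGE : EG = c%:C%C * Cintegral leb (alpha h).
  by rewrite /EG mean_deconv_kernel// CintegralZl.
have RcEG : Rc EG = c * \int[leb]_t Rc (alpha h t).
  by rewrite EGE ReM /= mul0r subr0.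
have IcEG : Ic EG = c * \int[leb]_t Ic (alpha h t).
  by rewrite EGE ImM /= mul0r addr0.
(* The damping parameter is s = h. *)
have DM := damped_mean h0 h0.
have RcDM := congr1 (fun z : R[i] => Rc z) DM.
have IcDM := congr1 (fun z : R[i] => Ic z) DM.
rewrite /= in RcDM IcDM.
have eR := damping_error_le (h := h) (p := fun z => Rc z) _ Re_le_normc (proj1 ia) h0.
have eI := damping_error_le (h := h) (p := fun z => Ic z) _ Im_le_normc (proj2 ia) h0.
have {}eR := eR (fun z r => ltac:(by rewrite ReM /= mulr0 subr0)).
have {}eI := eI (fun z r => ltac:(by rewrite ImM /= mulr0 add0r)).
rewrite RcDM in eR; rewrite IcDM subr0 in eI.
have hh : h^-1 * (c * (4 * Kn * d0 ^+ 3 * h ^+ 2)) = C1 * h.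
  have -> : h^-1 * (c * (4 * Kn * d0 ^+ 3 * h ^+ 2)) = (h^-1 * h) * (C1 * h).
    by rewrite /C1; ring.
  by rewrite mulVf ?mul1r// gt_eqF.
have hc0 : 0 <= h^-1 * c by apply: mulr_ge0; [rewrite invr_ge0 ltW|exact: ltW].
split; last first.
  rewrite IcEG mulrA normrM (ger0_norm hc0).
  apply: (le_trans (ler_wpM2l hc0 eI)).
  by rewrite -(mulrA h^-1 c) hh ler_wpM2r ?(ltW h0)// lerDl.
pose e1 u := \int[P]_w damp_kernel (h * h) ((X w : R) - (x0 - h * u)).
have hs0 : 0 < h * h by rewrite mulr_gt0.
have hs20 : 0 < 2 * (h * h) by rewrite mulr_gt0.
have me1 : measurable_fun setT (e1 : RR -> RR).
  apply: (measurable_Rintegral_param P (G := fun z : RR * T => damp_kernel (h * h) ((X z.2 : R) - (x0 - h * z.1)))).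
  apply: (measurableT_comp (f := damp_kernel (h * h))).
    exact: (continuous_measurable_fun (continuous_damp_kernel hs0)).
  apply: measurable_funB.
    by apply: (measurableT_comp (measurable_funPT X)); exact: measurable_snd.
  by apply: measurable_funB => //; apply: measurable_funM => //; exact: measurable_fst.
have e1M u : `|e1 u - pi * f x0| <= C0 * h * (1 + u ^+ 2) by apply: HC; rewrite h0.
have iKe : leb.-integrable setT (EFin \o (fun u => K u * (2 * h * e1 u))).
  have me : measurable_fun setT ((fun u => 2 * h * e1 u) : RR -> RR).
    by apply: measurable_funM.
  have eM u : `|2 * h * e1 u| <= 2 * h * (2 * (h * h)^-1).
    rewrite normrM ger0_norm ?mulr_ge0 ?(ltW h0)// ler_wpM2l ?mulr_ge0 ?(ltW h0)//.
    have kM w : `|damp_kernel (h * h) ((X w : R) - (x0 - h * u))| <= 2 * (h * h)^-1.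
      rewrite ger0_norm ?damp_kernel_ge0// /damp_kernel.
      have := cauchy_kernel_le ((X w : R) - (x0 - h * u)) hs0.
      have := cauchy_kernel_ge0 ((X w : R) - (x0 - h * u)) hs20; lra.
    have ik : P.-integrable setT (EFin \o (fun w => damp_kernel (h * h) ((X w : R) - (x0 - h * u)))).
      apply: (@bounded_integrable_prob _ _ _ P _ (2 * (h * h)^-1)) => //.
      apply: (measurableT_comp (f := damp_kernel (h * h))).
        exact: (continuous_measurable_fun (continuous_damp_kernel hs0)).
      by apply: measurable_funB => //; exact: (measurable_funPT X).
    apply: (le_trans (le_normr_Rintegral measurableT ik)).
    rewrite -[leRHS](Rintegral_prob_cst P); apply: le_Rintegral => //.
      exact: (integrable_norm ik).
    exact: finite_measure_integrable_cst.
  have := bounded_integrable me eM HKi.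
  by apply: eq_integrable => // u _ /=; rewrite mulrC.
rewrite RcEG.
set A := \int[leb]_t Rc (alpha h t) in eR *.
set B := \int[leb]_u (K u * _) in eR.
rewrite [X in `|X|](_ : _ = h^-1 * (c * (A - B)) + (h^-1 * (c * B) - f x0)); last by ring.
apply: (le_trans (ler_normD _ _)); rewrite mulrDl; apply: lerD.
  rewrite mulrA normrM (ger0_norm hc0).
  apply: (le_trans (ler_wpM2l hc0 eR)).
  by rewrite -(mulrA h^-1 c) hh.
have hn : h != 0 by rewrite gt_eqF.
have i1 : leb.-integrable setT (EFin \o (fun u => (2 * h)^-1 * (K u * (2 * h * e1 u)))).
  by have := integrableZl measurableT (2 * h)^-1 iKe; apply: eq_integrable.
have i2 : leb.-integrable setT (EFin \o (fun u => pi * f x0 * K u)).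
  by have := integrableZl measurableT (pi * f x0) HKi; apply: eq_integrable.
have Ke1 u : K u * (e1 u - pi * f x0) =
    (2 * h)^-1 * (K u * (2 * h * e1 u)) - pi * f x0 * K u.
  by field.
have -> : h^-1 * (c * B) - f x0 = pi^-1 * \int[leb]_u (K u * (e1 u - pi * f x0)).
  under eq_Rintegral do rewrite Ke1.
  rewrite (RintegralB measurableT i1 i2) (RintegralZl _ measurableT iKe).
  rewrite (RintegralZl _ measurableT HKi) HK1 -/B.
  have pin : pi != 0 :> R by rewrite gt_eqF.
  by rewrite /c; move: (pi : R) pin => q qn; field; rewrite ?hn ?qn.
have iKd : leb.-integrable setT (EFin \o (fun u => K u * (e1 u - pi * f x0))).
  have := integrableB measurableT i1 i2; apply: eq_integrable => // u _ /=.
  by rewrite Ke1.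
rewrite normrM ger0_norm ?invr_ge0 ?(ltW pi0)// /C2 -mulrA ler_wpM2l ?invr_ge0 ?(ltW pi0)//.
apply: (le_trans (le_normr_Rintegral measurableT iKd)).
have iK0 := integrable_norm HKi.
have iK2 := integrable_norm HKm2int.
have iK0' : leb.-integrable setT (EFin \o (fun u => C0 * h * `|K u|)).
  by have := integrableZl measurableT (C0 * h) iK0; apply: eq_integrable.
have iK2' : leb.-integrable setT (EFin \o (fun u : RR => C0 * h * `|(u : R) ^+ 2 * K u|)).
  by have := integrableZl measurableT (C0 * h) iK2; apply: eq_integrable.
apply: (@le_trans _ _ (\int[leb]_u (C0 * h * `|K u| + C0 * h * `|(u : R) ^+ 2 * K u|))).
  apply: le_Rintegral => //; first exact: (integrable_norm iKd).
    by have := integrableD measurableT iK0' iK2'; apply: eq_integrable.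
  move=> u _; rewrite normrM; apply: (le_trans (ler_wpM2l (normr_ge0 _) (e1M u))).
  rewrite [X in _ <= _ + _ * X](_ : _ = (u : R) ^+ 2 * `|K u|); last first.
    by rewrite normrM ger0_norm ?sqr_ge0.
  rewrite le_eqVlt; apply/orP; left; apply/eqP; ring.
rewrite RintegralD// !RintegralZl// -/K0 -/K2.
by rewrite le_eqVlt; apply/orP; left; apply/eqP; ring.
Qed.

End Bias.

(** * Size of the deconvolution kernel *)

Section InverseCharfun.
Context {R : realType}.
Notation RR := (measurableTypeR R).
Notation leb := (@lebesgue_measure R).
Notation Rc := complex.Re.
Notation Ic := complex.Im.

Lemma twice_differentiable_bounded_continuous (u : R -> R) :
  twice_differentiable_bounded u -> continuous u.
Proof.
move=> [du _ _] x; apply: differentiable_continuous.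
by apply/derivable1_diffP; exact: (proj1 (du x)).
Qed.

Lemma continuous_normc (phi : R -> R[i]) :
  continuous (fun t => Rc (phi t)) -> continuous (fun t => Ic (phi t)) ->
  continuous (fun t => Normc.normc (phi t)).
Proof.
move=> cr ci t.
have E : (fun t => Normc.normc (phi t)) =
    (fun t => Num.sqrt (Rc (phi t) ^+ 2 + Ic (phi t) ^+ 2)).
  by apply/funext => s; case: (phi s).
rewrite E; apply: cvg_comp; last exact: sqrt_continuous.
by apply: cvgD; apply: cvgM; (exact: cr || exact: ci).
Qed.

(** Bound on 1/|phi| over [-A, A]: the lower bound at infinity covers
    large arguments, continuity and positivity cover a compact interval. *)
Lemma inverse_charfun_bound (phi : R -> R[i]) (a beta beta0 B1 : R) :
  continuous (fun t => Rc (phi t)) -> continuous (fun t => Ic (phi t)) ->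
  (forall t, 0 < Normc.normc (phi t)) ->
  (forall t, Normc.normc (phi (- t)) = Normc.normc (phi t)) ->
  0 < a -> 0 < beta -> 0 < B1 ->
  (\forall t \near pinfty_nbhs R,
    B1 * `|t| `^ beta0 * expR (- a * `|t| `^ beta) <= Normc.normc (phi t)) ->
  exists2 B : R, 0 <= B & forall A t : R, 1 <= A -> `|t| <= A ->
    (Normc.normc (phi t))^-1 <= B * A `^ `|beta0| * expR (a * A `^ beta).
Proof.
move=> cr ci phi0 phiN a0 b0 B10 [M0 [_ HM]].
pose M := Num.max M0 1.
have M1 : 1 <= M by rewrite le_max lexx orbT.
have cn := continuous_normc cr ci.
have M0' : 0 <= M by lra.
have [t0 _ Ht0] : exists2 c, c \in `[0, M] &
    forall t, t \in `[0, M] -> Normc.normc (phi c) <= Normc.normc (phi t).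
  by apply: EVT_min => //; exact: continuous_subspaceT.
pose m0 := Normc.normc (phi t0).
have m00 : 0 < m0 by exact: phi0.
have Bp : 0 <= B1^-1 by rewrite invr_ge0 ltW.
have mp : 0 <= m0^-1 by rewrite invr_ge0 ltW.
exists (B1^-1 + m0^-1); first exact: addr_ge0.
move=> A t A1 tA.
have -> : Normc.normc (phi t) = Normc.normc (phi `|t|).
  by case: (ger0P t) => _; rewrite ?phiN.
move: tA; move: `|t| (normr_ge0 t) => {}t tge0 tA.
have A0 : 0 < A by lra.
have e1 : 1 <= expR (a * A `^ beta).
  by rewrite -expR0 ler_expR mulr_ge0 ?powR_ge0// ltW.
have Ab1 : 1 <= A `^ `|beta0|.
  have : 1 `^ `|beta0| <= A `^ `|beta0| by apply: ge0_ler_powR; rewrite ?nnegrE//; lra.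
  by rewrite powR1.
have [tM|Mt] := leP t M.
  have h1 : (Normc.normc (phi t))^-1 <= m0^-1.
    by rewrite lef_pV2 ?posrE//; apply: Ht0; rewrite in_itv /= tge0.
  apply: (le_trans h1); rewrite -mulrA.
  have h2 : 1 <= A `^ `|beta0| * expR (a * A `^ beta).
    by rewrite -[leLHS]mulr1; apply: ler_pM.
  apply: (@le_trans _ _ ((B1^-1 + m0^-1) * 1)).
    by rewrite mulr1 lerDr.
  by apply: ler_wpM2l => //; exact: addr_ge0.
have t1 : 1 <= t by lra.
have t00 : 0 < t by lra.
have M0t : M0 < t by apply: le_lt_trans Mt; rewrite le_max lexx.
have := HM t M0t; rewrite (ger0_norm tge0) => h1.
have p0 : 0 < B1 * t `^ beta0 * expR (- a * t `^ beta).
  by rewrite !mulr_gt0 ?powR_gt0 ?expR_gt0.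
have h2 : (Normc.normc (phi t))^-1 <= (B1 * t `^ beta0 * expR (- a * t `^ beta))^-1.
  by rewrite lef_pV2 ?posrE.
apply: (le_trans h2).
rewrite !invfM -powRN -expRN mulNr opprK.
apply: ler_pM; [by rewrite mulr_ge0 ?powR_ge0|exact: expR_ge0| |].
  apply: ler_pM => //; first exact: powR_ge0.
    by rewrite lerDl.
  apply: (@le_trans _ _ (t `^ `|beta0|)).
    by apply: ler_powR => //; rewrite -normrN ler_norm.
  by apply: ge0_ler_powR; rewrite ?nnegrE ?(ltW A0).
rewrite ler_expR ler_pM2l//.
by apply: ge0_ler_powR; rewrite ?nnegrE ?(ltW A0) ?(ltW b0).
Qed.

Lemma Re_div (x y : R[i]) :
  Rc (x / y) = (Rc x * Rc y + Ic x * Ic y) / (Rc y ^+ 2 + Ic y ^+ 2).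
Proof. by case: x => u v; case: y => p q /=; rewrite mulrN opprK !mulrA -mulrDl. Qed.

Lemma Im_div (x y : R[i]) :
  Ic (x / y) = (Ic x * Rc y - Rc x * Ic y) / (Rc y ^+ 2 + Ic y ^+ 2).
Proof. by case: x => u v; case: y => p q /=; rewrite mulrN !mulrA addrC -mulrBl. Qed.

Section Psi.
Variables (phiK phie : R -> R[i]) (d0 h : R).
Hypothesis Hd0 : 0 < d0.
Hypothesis cKr : continuous (fun t => Rc (phiK t)).
Hypothesis cKi : continuous (fun t => Ic (phiK t)).
Hypothesis cer : continuous (fun t => Rc (phie t)).
Hypothesis cei : continuous (fun t => Ic (phie t)).
Hypothesis phie0 : forall t, 0 < Normc.normc (phie t).

Lemma sqr_normc_gt0 t : 0 < Rc (phie t) ^+ 2 + Ic (phie t) ^+ 2.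
Proof.
have := phie0 t; case: (phie t) => x y /=; rewrite sqrtr_gt0//.
Qed.

Lemma measurable_psi :
  measurable_fun setT ((fun t => Rc (phiK t / phie (t / h))) : RR -> RR) /\
  measurable_fun setT ((fun t => Ic (phiK t / phie (t / h))) : RR -> RR).
Proof.
have cdiv : continuous (fun s : R => s / h).
  by move=> t; apply: cvgMl; exact: cvg_id.
have cR : continuous (fun t : R => Rc (phie (t / h))).
  move=> t; apply: (continuous_comp (f := fun s : R => s / h) (g := fun s => Rc (phie s))).
    exact: cdiv.
  exact: cer.
have cI : continuous (fun t : R => Ic (phie (t / h))).
  move=> t; apply: (continuous_comp (f := fun s : R => s / h) (g := fun s => Ic (phie s))).
    exact: cdiv.
  exact: cei.
have cV : continuous (fun t : R => (Rc (phie (t / h)) ^+ 2 + Ic (phie (t / h)) ^+ 2)^-1).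
  move=> t; apply: cvgV; first by rewrite gt_eqF// sqr_normc_gt0.
  by apply: cvgD; apply: cvgM; (exact: cR || exact: cI).
split; apply: continuous_measurable_fun => t.
  under eq_fun do rewrite Re_div.
  by apply: cvgM; [apply: cvgD; apply: cvgM|]; (exact: cR || exact: cI || exact: cV || exact: cKr || exact: cKi).
under eq_fun do rewrite Im_div.
by apply: cvgM; [apply: cvgB; apply: cvgM|]; (exact: cR || exact: cI || exact: cV || exact: cKr || exact: cKi).
Qed.

Variable Q : R.
Hypothesis psi_le : forall t, Normc.normc (phiK t / phie (t / h)) <=
  Q * \1_(`[- d0, d0]%classic : set RR) t.

Lemma Cintegrable_psi : Cintegrable leb (fun t : R => phiK t / phie (t / h)).
Proof.
have [m1 m2] := measurable_psi.
have ii : leb.-integrable setT (EFin \o (\1_(`[- d0, d0]%classic : set RR) : RR -> R)).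
  exact: integrable_indic_itv.
have iQ : leb.-integrable setT (EFin \o (fun t : RR => Q * \1_(`[- d0, d0]%classic : set RR) t)).
  by have := integrableZl measurableT Q ii; apply: eq_integrable.
split; apply: (le_integrable measurableT _ _ iQ).
- exact/measurable_EFinP.
- move=> t _.
  have h1 := le_trans (Re_le_normc (phiK t / phie (t / h))) (le_trans (psi_le t) (ler_norm _)).
  by rewrite /= lee_fin; exact: h1.
- exact/measurable_EFinP.
- move=> t _.
  have h1 := le_trans (Im_le_normc (phiK t / phie (t / h))) (le_trans (psi_le t) (ler_norm _)).
  by rewrite /= lee_fin; exact: h1.
Qed.

Lemma deconv_kernel_part_bounded (p : R[i] -> R) (x : R) :
  (forall z, `|p z| <= Normc.normc z) ->
  leb.-integrable setT (EFin \o (fun t => p (expi (- (t * x)) * (phiK t / phie (t / h))))) ->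
  `|\int[leb]_t p (expi (- ((t : R) * x)) * (phiK t / phie (t / h)))| <= Q * (2 * d0).
Proof.
move=> pn ip.
apply: (le_trans (le_normr_Rintegral measurableT ip)).
have [ii ei] := itv_indic_integral Hd0.
have iQ : leb.-integrable setT (EFin \o (fun t : RR => Q * \1_(`[- d0, d0]%classic : set RR) t)).
  by have := integrableZl measurableT Q ii; apply: eq_integrable.
rewrite -ei -RintegralZl//; apply: le_Rintegral => //; first exact: (integrable_norm ip).
move=> t _; apply: (le_trans (pn _)); rewrite Normc.normcM normc_expi mul1r.
exact: psi_le.
Qed.

Let c : R := (2 * pi)^-1.

(** The components of the deconvolution kernel and their supremum bound. *)
Lemma deconv_kernel_Re_Im (x : R) :
  [/\ Rc (deconv_kernel phiK phie h x) =
        c * \int[leb]_t Rc (expi (- ((t : R) * x)) * (phiK t / phie (t / h))),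
      Ic (deconv_kernel phiK phie h x) =
        c * \int[leb]_t Ic (expi (- ((t : R) * x)) * (phiK t / phie (t / h))),
      `|Rc (deconv_kernel phiK phie h x)| <= c * (Q * (2 * d0)) &
      `|Ic (deconv_kernel phiK phie h x)| <= c * (Q * (2 * d0))].
Proof.
have c0 : 0 <= c by rewrite invr_ge0 mulr_ge0// pi_ge0.
have [i1 i2] := Cintegrable_expi (- x) Cintegrable_psi.
have ER : Rc (deconv_kernel phiK phie h x) =
    c * \int[leb]_t Rc (expi (- ((t : R) * x)) * (phiK t / phie (t / h))).
  by rewrite /deconv_kernel ReM /= mul0r subr0.
have EI : Ic (deconv_kernel phiK phie h x) =
    c * \int[leb]_t Ic (expi (- ((t : R) * x)) * (phiK t / phie (t / h))).
  by rewrite /deconv_kernel ImM /= mul0r addr0.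
split => //.
  rewrite ER normrM (ger0_norm c0) ler_wpM2l//.
  apply: (deconv_kernel_part_bounded (p := fun z => Rc z) Re_le_normc).
  by under [X in EFin \o X]eq_fun do rewrite -mulrN.
rewrite EI normrM (ger0_norm c0) ler_wpM2l//.
apply: (deconv_kernel_part_bounded (p := fun z => Ic z) Im_le_normc).
by under [X in EFin \o X]eq_fun do rewrite -mulrN.
Qed.

Lemma measurable_deconv_kernel (x0 : R) :
  measurable_fun setT ((fun y => Rc (deconv_kernel phiK phie h ((x0 - y) / h))) : RR -> RR) /\
  measurable_fun setT ((fun y => Ic (deconv_kernel phiK phie h ((x0 - y) / h))) : RR -> RR).
Proof.
have [m1 m2] := measurable_psi.
have mx : measurable_fun setT ((fun y : R => - ((x0 - y) / h)) : RR -> RR).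
  apply: measurable_funN; apply: measurable_funM => //.
  by apply: measurable_funB.
have ms1 : measurable_fun setT (fun z : RR * RR => cos (z.2 * (- ((x0 - z.1) / h)) : R)).
  apply: (measurableT_comp (f := @cos R)).
    exact: (continuous_measurable_fun (@continuous_cos R)).
  apply: measurable_funM; first exact: measurable_snd.
  by apply: (measurableT_comp mx); exact: measurable_fst.
have ms2 : measurable_fun setT (fun z : RR * RR => sin (z.2 * (- ((x0 - z.1) / h)) : R)).
  apply: (measurableT_comp (f := @sin R)).
    exact: (continuous_measurable_fun (@continuous_sin R)).
  apply: measurable_funM; first exact: measurable_snd.
  by apply: (measurableT_comp mx); exact: measurable_fst.
have p1 : measurable_fun setT (fun z : RR * RR => Rc (phiK z.2 / phie (z.2 / h))).
  by apply: (measurableT_comp m1); exact: measurable_snd.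
have p2 : measurable_fun setT (fun z : RR * RR => Ic (phiK z.2 / phie (z.2 / h))).
  by apply: (measurableT_comp m2); exact: measurable_snd.
split.
  have E y : Rc (deconv_kernel phiK phie h ((x0 - y) / h)) =
    c * \int[leb]_t Rc (expi (- ((t : R) * ((x0 - y) / h))) * (phiK t / phie (t / h))).
    by have [] := deconv_kernel_Re_Im ((x0 - y) / h).
  under eq_fun do rewrite E.
  apply: measurable_funM => //.
  apply: (measurable_Rintegral_param leb (G := fun z : RR * RR =>
    Rc (expi (- ((z.2 : R) * ((x0 - z.1) / h))) * (phiK z.2 / phie (z.2 / h))))).
  have := measurable_funB (measurable_funM ms1 p1) (measurable_funM ms2 p2).
  by apply: eq_measurable_fun => z _; rewrite -(mulrN (z.2 : R)) ReM.
have E y : Ic (deconv_kernel phiK phie h ((x0 - y) / h)) =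
    c * \int[leb]_t Ic (expi (- ((t : R) * ((x0 - y) / h))) * (phiK t / phie (t / h))).
  by have [] := deconv_kernel_Re_Im ((x0 - y) / h).
under eq_fun do rewrite E.
apply: measurable_funM => //.
apply: (measurable_Rintegral_param leb (G := fun z : RR * RR =>
    Ic (expi (- ((z.2 : R) * ((x0 - z.1) / h))) * (phiK z.2 / phie (z.2 / h))))).
have := measurable_funD (measurable_funM ms1 p2) (measurable_funM ms2 p1).
by apply: eq_measurable_fun => z _; rewrite -(mulrN (z.2 : R)) ImM.
Qed.

End Psi.
End InverseCharfun.

(** * Mean squared error and rates *)

Section Risk.
Context {R : realType}.
Notation RR := (measurableTypeR R).
Notation leb := (@lebesgue_measure R).
Notation Rc := complex.Re.
Notation Ic := complex.Im.

(** Every power of the logarithm is dominated by every positive power. *)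
Lemma ln_powR_le (r omega : R) : 0 < r -> 0 < omega ->
  exists2 C : R, 0 <= C & forall n : nat, (0 < n)%N ->
    ln n%:R `^ r <= C * n%:R `^ omega.
Proof.
move=> r0 w0; pose k := omega / r.
have k0 : 0 < k by rewrite divr_gt0.
exists (k^-1 `^ r); first exact: powR_ge0.
move=> n n0.
have n1 : 1 <= n%:R :> R by rewrite ler1n.
have n00 : 0 < n%:R :> R by rewrite ltr0n.
have l0 : 0 <= ln n%:R :> R by exact: ln_ge0.
have h : ln n%:R <= k^-1 * n%:R `^ k :> R.
  rewrite mulrC ler_pdivlMr// mulrC -ln_powR.
  have p0 : 0 < n%:R `^ k :> R by exact: powR_gt0.
  have := expR_ge1Dx (ln (n%:R `^ k : R)); rewrite lnK ?posrE//; lra.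
have -> : omega = k * r by rewrite /k; field; rewrite gt_eqF.
rewrite powRrM -powRM ?powR_ge0 ?invr_ge0 ?(ltW k0)//.
by apply: ge0_ler_powR; rewrite ?nnegrE ?(ltW r0)// mulr_ge0 ?powR_ge0// invr_ge0 ltW.
Qed.

Context {d : measure_display} {T : measurableType d}.
Variable P : probability T R.

Lemma normc_charfunN (V : {mfun T >-> RR}) (t : R) :
  Normc.normc (characteristic_fun P (fun w => V w : R) (- t)) =
  Normc.normc (characteristic_fun P (fun w => V w : R) t).
Proof.
rewrite !charfunE /=.
have -> : \int[P]_w cos (- t * V w) = \int[P]_w cos (t * V w).
  by apply: eq_Rintegral => w _; rewrite mulNr cosN.
have -> : \int[P]_w sin (- t * V w) = - \int[P]_w sin (t * V w).
  rewrite -[RHS]mulN1r -RintegralZl//; last exact: integrable_sin_rv.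
  by apply: eq_Rintegral => w _; rewrite mulNr sinN mulN1r.
by rewrite sqrrN.
Qed.

(** Decomposition of the mean squared error into variance and squared
    bias, for an estimator with real part A and imaginary part B. *)
Lemma mse_le (fhat : T -> R[i]) (A B : T -> R) (v mr mi S Vn b : R) :
  measurable_fun setT A -> measurable_fun setT B ->
  (forall w, `|A w| <= S) -> (forall w, `|B w| <= S) ->
  (forall w, Rc (fhat w) = A w) -> (forall w, Ic (fhat w) = B w) ->
  \int[P]_w ((A w - mr) ^+ 2) <= Vn -> \int[P]_w ((B w - mi) ^+ 2) <= Vn ->
  `|mr - v| <= b -> `|mi| <= b ->
  (MSE P fhat v <= (4 * Vn + 4 * b ^+ 2)%:E)%E.
Proof.
move=> mA mB AS BS EA EB VA VB br bi.
have bnd (D : T -> R) (m : R) : measurable_fun setT D -> (forall w, `|D w| <= S) ->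
    P.-integrable setT (EFin \o (fun w => (D w - m) ^+ 2)).
  move=> mD DS; apply: (@bounded_integrable_prob _ _ _ P _ ((S + `|m|) ^+ 2)).
    by apply: measurable_funX; apply: measurable_funB.
  move=> w; rewrite normrX lerXn2r ?nnegrE ?addr_ge0//.
    exact: (le_trans (normr_ge0 _) (DS w)).
  by apply: (le_trans (ler_normB _ _)); rewrite lerD2r.
have iA := bnd A mr mA AS; have iB := bnd B mi mB BS.
have iA2 : P.-integrable setT (EFin \o (fun w => 2 * (A w - mr) ^+ 2)).
  by have := integrableZl measurableT 2 iA; apply: eq_integrable.
have iB2 : P.-integrable setT (EFin \o (fun w => 2 * (B w - mi) ^+ 2)).
  by have := integrableZl measurableT 2 iB; apply: eq_integrable.
have iAB : P.-integrable setT (EFin \o (fun w => 2 * (A w - mr) ^+ 2 + 2 * (B w - mi) ^+ 2)).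
  by have := integrableD measurableT iA2 iB2; apply: eq_integrable.
have ic : P.-integrable setT (EFin \o (fun=> 4 * b ^+ 2 : R)).
  exact: finite_measure_integrable_cst.
have iF : P.-integrable setT (EFin \o (fun w => 2 * (A w - mr) ^+ 2 + 2 * (B w - mi) ^+ 2 + 4 * b ^+ 2)).
  by have := integrableD measurableT iAB ic; apply: eq_integrable.
have EN w : Normc.normc (fhat w - v%:C%C) ^+ 2 = (A w - v) ^+ 2 + B w ^+ 2.
  rewrite -(EA w) -(EB w); case: (fhat w) => x y /=.
  by rewrite sqr_sqrtr ?addr_ge0 ?sqr_ge0// oppr0 addr0.
rewrite /MSE unlock.
apply: (@le_trans _ _ (\int[P]_w (2 * (A w - mr) ^+ 2 + 2 * (B w - mi) ^+ 2 + 4 * b ^+ 2)%:E)%E).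
  apply: ge0_le_integral => //.
  - by move=> w _; rewrite lee_fin sqr_ge0.
  - apply/measurable_EFinP; rewrite (_ : (fun w => _) = (fun w => (A w - v) ^+ 2 + B w ^+ 2)); last first.
      by apply/funext => w; exact: EN.
    by apply: measurable_funD; apply: measurable_funX => //; exact: measurable_funB.
  - exact: measurable_int iF.
  - move=> w _; rewrite lee_fin EN.
    have b0 : 0 <= b by exact: (le_trans (normr_ge0 _) bi).
    have h1 : (mr - v) ^+ 2 <= b ^+ 2.
      by rewrite -(real_normK (num_real (mr - v))) lerXn2r ?nnegrE.
    have h2 : mi ^+ 2 <= b ^+ 2.
      by rewrite -(real_normK (num_real mi)) lerXn2r ?nnegrE.
    have e1 : (A w - v) ^+ 2 <= 2 * (A w - mr) ^+ 2 + 2 * (mr - v) ^+ 2.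
      rewrite -subr_ge0 (_ : _ - _ = ((A w - mr) - (mr - v)) ^+ 2) ?sqr_ge0//; ring.
    have e2 : B w ^+ 2 <= 2 * (B w - mi) ^+ 2 + 2 * mi ^+ 2.
      rewrite -subr_ge0 (_ : _ - _ = ((B w - mi) - mi) ^+ 2) ?sqr_ge0//; ring.
    lra.
have -> : (\int[P]_w (2 * (A w - mr) ^+ 2 + 2 * (B w - mi) ^+ 2 + 4 * b ^+ 2)%:E)%E =
    (\int[P]_w (2 * (A w - mr) ^+ 2 + 2 * (B w - mi) ^+ 2 + 4 * b ^+ 2))%:E.
  by rewrite /Rintegral fineK// integrable_fin_num.
rewrite lee_fin RintegralD// RintegralD// (RintegralZl _ measurableT iA) (RintegralZl _ measurableT iB).
rewrite Rintegral_prob_cst; lra.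
Qed.

End Risk.

Section Rates.
Context {R : realType}.

(** The slack theta - (2 - 2 gamma) is shared between the losses in the
    exponents: half of it is kept as the final rate omega. *)
Lemma exponent_choice (gamma theta : R) :
  1 / 2 < gamma -> gamma < 1 -> 2 - 2 * gamma < theta -> theta < 1 ->
  let omega := (theta - (2 - 2 * gamma)) / 2 in
  let eta := omega / 4 in
  let g := gamma - eta in
  let p := 2 * g - 1 - eta in
  [/\ 0 < omega, 0 < eta < gamma, 1 - g + eta <= g, g < 1 &
   [/\ 0 <= p, 0 <= 1 - p + eta & (1 - theta) + (eta - p) = - omega]].
Proof.
move=> g1 g2 t1 t2 omega eta g p.
have eta4 : 8 * eta = theta - (2 - 2 * gamma) by rewrite /eta /omega; field.
have om : omega = 4 * eta by rewrite /eta; field.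
split; [lra|apply/andP; split; lra|rewrite /g; lra|rewrite /g; lra|].
by split; rewrite /p /g; lra.
Qed.

Lemma bandwidth_rates (d0 a beta theta l : R) :
  0 < d0 -> 0 < a -> 0 < beta -> theta < 1 ->
  let L := (1 - theta) / (2 * a) * l in
  let h := d0 * (2 * a / ((1 - theta) * l)) `^ (beta^-1) in
  1 <= L -> d0 `^ beta <= L ->
  [/\ 0 < h <= 1, d0 / h = L `^ (beta^-1), 1 <= d0 / h, (d0 / h) `^ beta = L &
      h ^+ 2 = d0 ^+ 2 * L `^ (- 2 / beta)].
Proof.
move=> d00 a0 b0 t1 L h L1 dL.
have L0 : 0 < L by lra.
have b' : beta != 0 by rewrite gt_eqF.
have bi0 : 0 < beta^-1 by rewrite invr_gt0.
have k0 : 0 < (1 - theta) / (2 * a) by rewrite divr_gt0 ?mulr_gt0// subr_gt0.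
have l0 : 0 < l by rewrite -(pmulr_rgt0 l k0).
have Ln : 0 < L `^ (beta^-1) by exact: powR_gt0.
have hE : h = d0 * (L `^ (beta^-1))^-1.
  rewrite /h; congr (_ * _).
  have -> : 2 * a / ((1 - theta) * l) = L^-1.
    have t0 : 1 - theta != 0 by rewrite subr_eq0 gt_eqF.
    have a' : a != 0 by rewrite gt_eqF.
    have l' : l != 0 by rewrite gt_eqF.
    by rewrite /L; field; rewrite ?t0 ?a' ?l'.
  by rewrite -powR_inv1 ?(ltW L0)// -powRrM mulN1r powRN.
have h0 : 0 < h by rewrite hE divr_gt0.
have AE : d0 / h = L `^ (beta^-1).
  by rewrite hE; field; rewrite !gt_eqF.
have Ab : (L `^ beta^-1) `^ beta = L.
  by rewrite -powRrM mulVf// powRr1// ltW.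
have A1 : 1 <= L `^ (beta^-1).
  have : 1 `^ (beta^-1) <= L `^ (beta^-1).
    by apply: ge0_ler_powR => //; rewrite ?nnegrE ?(ltW bi0) ?(ltW L0).
  by rewrite powR1.
split => //.
- rewrite h0 /= hE ler_pdivrMr// mul1r.
  have -> : d0 = (d0 `^ beta) `^ (beta^-1) by rewrite -powRrM mulfV// powRr1// ltW.
  by apply: ge0_ler_powR => //; rewrite ?nnegrE ?powR_ge0 ?(ltW bi0) ?(ltW L0).
- by rewrite AE.
- by rewrite AE.
- rewrite hE exprMn; congr (_ * _).
  rewrite exprVn -powR_mulrn ?powR_ge0// -powRrM mulNr powRN.
  by congr (_^-1); congr (_ `^ _); rewrite mulrC.
Qed.

(** The squared supremum of the deconvolution kernel: a power of l = ln n
    times n^(1 - theta). *)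
Lemma kernel_sup_rate (d0 a beta theta q l h c0 : R) :
  0 < d0 -> 0 < a -> 0 < beta -> theta < 1 -> 0 <= q ->
  let kap := (1 - theta) / (2 * a) in
  0 < l -> 0 < h -> d0 / h = (kap * l) `^ (beta^-1) -> (d0 / h) `^ beta = kap * l ->
  (h^-1 * (c0 * ((d0 / h) `^ q * expR (a * (d0 / h) `^ beta) * (2 * d0)))) ^+ 2 =
  (2 * c0) ^+ 2 * kap `^ (2 * (1 + q) / beta) * l `^ (2 * (1 + q) / beta) *
    expR ((1 - theta) * l).
Proof.
move=> d00 a0 b0 t1 q0 kap l0 h0 AE Ab.
have k0 : 0 < kap by rewrite divr_gt0 ?mulr_gt0// subr_gt0.
have L0 : 0 < kap * l by rewrite mulr_gt0.
have A0 : 0 < d0 / h by rewrite divr_gt0.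
have h' : h != 0 by rewrite gt_eqF.
have -> : h^-1 * (c0 * ((d0 / h) `^ q * expR (a * (d0 / h) `^ beta) * (2 * d0))) =
   2 * c0 * ((d0 / h) * (d0 / h) `^ q) * expR (a * (d0 / h) `^ beta) by ring.
have -> : (d0 / h) * (d0 / h) `^ q = (d0 / h) `^ (1 + q).
  rewrite powRD ?(gt_eqF A0) ?implybT//; by rewrite powRr1// ltW.
rewrite Ab !exprMn -(powR_mulrn 2 (powR_ge0 (d0 / h) (1 + q))) -powRrM AE -powRrM.
have -> : beta^-1 * ((1 + q) * 2) = 2 * (1 + q) / beta by ring.
rewrite powRM ?(ltW k0) ?(ltW l0)//.
have -> : expR (a * (kap * l)) ^+ 2 = expR ((1 - theta) * l).
  rewrite -expRM_natl; congr expR; rewrite /kap; field; rewrite gt_eqF//.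
by ring.
Qed.

(** A power of the logarithm is absorbed by a negative power of n. *)
Lemma log_power_absorb (V D Q1 l omega CL n b : R) :
  0 <= V -> 0 <= D -> 0 < l -> 0 < n ->
  l `^ (Q1 + b) <= CL * n `^ omega ->
  V * (D * l `^ Q1) * n `^ (- omega) <= V * D * CL * l `^ (- b).
Proof.
move=> V0 D0 l0 n0 H.
rewrite !powRN.
have lb : 0 < l `^ b by exact: powR_gt0.
have no : 0 < n `^ omega by exact: powR_gt0.
rewrite ler_pdivlMr// mulrAC ler_pdivrMr//.
rewrite -!mulrA ler_wpM2l// ler_wpM2l//.
by rewrite -powRD// (gt_eqF l0) implybT.
Qed.

End Rates.

(* MathComp-Analysis, over an arbitrary [R : realType] *)
Theorem proposition2p15
  (d : measure_display) (T : measurableType d) (R : realType)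
  (P : probability T R)
  (* the processes *)
  (Z X : int -> {RV P >-> measurableTypeR R})
  (eps : nat -> {RV P >-> measurableTypeR R})
  (c : nat -> R) (gamma : R) (L0 : R -> R)
  (f feps fY : R -> R)
  (x0 : R)
  (HZiid : iid P (fun i w => Z i w : R))
  (HZ2 : forall i, (Z i : T -> R) \in Lfun P 2%:E)
  (HZ0 : forall i, 'E_P[(Z i : T -> R)]%E = 0%E)
  (Hc0 : c 0%N = 1)
  (HX : linear_process P c (fun i w => Z i w) (fun i w => X i w))
  (HXstat : strictly_stationary P (fun i w => X i w))
  (HXdens : forall j : int,
    has_density P lebesgue_measure (fun w => X j w : measurableTypeR R) f)
  (Hepsiid : iid P (fun j w => eps j w : R))
  (Hepsdens : forall j : nat,
    has_density P lebesgue_measure (fun w => eps j w : measurableTypeR R) feps)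
  (HXeps : independent_processes P (fun i w => X i w : R) (fun j w => eps j w : R))
  (Y := fun (j : nat) (w : T) => X j%:Z w + eps j w : R)
  (phie := characteristic_fun P (fun w => eps 0%N w : R))
  (HYdens : forall j : nat,
    has_density P lebesgue_measure (fun w => Y j w : measurableTypeR R) fY)
  (* standing assumptions *)
  (K : R -> R)
  (Hf : twice_differentiable f)
  (Hf2 : continuous (derive1n 2 f) /\ bounded_fct (derive1n 2 f))
  (HKint : (@lebesgue_measure R).-integrable setT (fun u => (K u)%:E))
  (HK1 : \int[@lebesgue_measure R]_u K u = 1)
  (HKm1 : \int[@lebesgue_measure R]_u (u * K u) = 0)
  (HKm2int : (@lebesgue_measure R).-integrable setT (fun u => (u ^+ 2 * K u)%:E))
  (HKm2 : \int[@lebesgue_measure R]_u (u ^+ 2 * K u) <> 0)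
  (phiK := fourier K)
  (Hphie0 : forall t, 0 < Normc.normc (phie t))
  (HphieRe : twice_differentiable_bounded (fun t => complex.Re (phie t)))
  (HphieIm : twice_differentiable_bounded (fun t => complex.Im (phie t)))
  (HphiKRe : twice_differentiable_bounded (fun t => complex.Re (phiK t)))
  (HphiKIm : twice_differentiable_bounded (fun t => complex.Im (phiK t)))
  (* LRD *)
  (HLRD : lrd_coefficients c gamma L0)
  (* (i) *)
  (a beta beta0 B1 B2 : R)
  (Ha : 0 < a) (Hbeta : 0 < beta) (HB1 : 0 < B1) (HB2 : 0 < B2)
  (Hi : \forall t \near pinfty_nbhs R,
    B1 * `|t| `^ beta0 * expR (- a * `|t| `^ beta) <= Normc.normc (phie t)
      <= B2 * `|t| `^ beta0 * expR (- a * `|t| `^ beta))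
  (* (ii) *)
  (d0 : R) (Hd0 : 0 < d0)
  (Hii : forall t, d0 <= `|t| -> phiK t = 0)
  (* (iii) *)
  (delta1 m B3 B4 : R)
  (Hdelta1 : 0 < delta1) (Hm : 0 < m) (HB3 : 0 < B3) (HB4 : 0 < B4)
  (Hiii : forall t : R, d0 - delta1 < t < d0 ->
    Normc.normc (phiK t) <= B3 * (d0 - t) `^ m /\
    (B4 * (d0 - t) `^ m)%:C%C <= phiK t)
  (* (iv) *)
  (Hiv : (fun t => complex.Re (phie t)) =o_+oo (fun t => complex.Im (phie t)) \/
         (fun t => complex.Im (phie t)) =o_+oo (fun t => complex.Re (phie t)))
  (* joint densities of the observations *)
  (HfY : forall x, derivable fY x 1)
  (HfYc : continuous (derive1 fY))
  (HfYi : (@lebesgue_measure R).-integrable setT (fun x => (derive1 fY x)%:E))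
  (fk hk : nat -> R -> R -> R) (h : R -> R) (delta : R)
  (Hdelta : 0 < delta)
  (Hhc : continuous h)
  (Hhi : (@lebesgue_measure R).-integrable setT (fun x => (h x)%:E))
  (rho := autocovariance P (fun i w => X i w : R))
  (Hfk : forall k : nat, (0 < k)%N ->
    has_density P (@lebesgue_measure R \x @lebesgue_measure R)%E
      (fun w => (Y 0%N w : measurableTypeR R, Y k w : measurableTypeR R))
      (fun z => fk k z.1 z.2))
  (Hfkhk : forall (k : nat) (x y : R), (0 < k)%N ->
    fk k x y = fY x * fY y + rho k * derive1 fY x * derive1 fY y + hk k x y)
  (Hhk : forall (k : nat) (x y : R), (0 < k)%N ->
    `|hk k x y| <= `|rho k| `^ (1 + delta) * h x * h y)
  (theta : R) (Htheta : 2 - 2 * gamma < theta < 1)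
  (hn := fun n : nat => d0 * (2 * a / ((1 - theta) * ln n%:R)) `^ (beta^-1)) :
  exists C : R, \forall n \near \oo,
    (MSE P (deconv_estimator phiK phie Y x0 (hn n) n) (f x0)
       <= (C * (ln n%:R) `^ (- 2 / beta))%:E)%E.

Proof.
have /andP[Ht1 Ht2] := Htheta.
have [/andP[Hg1 Hg2] _ _] := HLRD.
have [om0 eta_g geta g1 [p0 pe ep]] := exponent_choice Hg1 Hg2 Ht1 Ht2.
move: om0 eta_g geta g1 p0 pe ep.
set omega := (theta - (2 - 2 * gamma)) / 2; set eta := omega / 4.
set g := gamma - eta; set p := 2 * g - 1 - eta => om0 eta_g geta g1 p0 pe ep.
have /andP[eta0 _] := eta_g.
have [Cc Cc0 Hcc] := lrd_coefficients_le HLRD eta_g.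
have Hcg k : `|c k| <= Cc * k.+1%:R `^ (- g) by rewrite /g opprB.
have [D D0 Hrho] := linear_process_autocovariance_le HZiid HZ2 HZ0 HX Cc0 Hcg eta0 geta g1.
have [V V0 HV] := empirical_mean_variance_le HXstat Hepsiid HXeps HYdens HfYi Hdelta Hhi
  Hfk Hfkhk Hhk D0 Hrho p0 eta0 pe.
have cer := twice_differentiable_bounded_continuous HphieRe.
have cei := twice_differentiable_bounded_continuous HphieIm.
have cKr := twice_differentiable_bounded_continuous HphiKRe.
have cKi := twice_differentiable_bounded_continuous HphiKIm.
have phieN t : Normc.normc (phie (- t)) = Normc.normc (phie t).
  exact: normc_charfunN.
have Hi1 : \forall t \near pinfty_nbhs R,
    B1 * `|t| `^ beta0 * expR (- a * `|t| `^ beta) <= Normc.normc (phie t).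
  by move: Hi; apply: filterS => t /andP[].
have [Bq Bq0 HBq] := inverse_charfun_bound cer cei Hphie0 phieN Ha Hbeta HB1 Hi1.
have indep (A B : set (measurableTypeR R)) : measurable A -> measurable B ->
     P ((X 0 : T -> R) @^-1` A `&` (eps 0%N : T -> R) @^-1` B) =
     (P ((X 0%R : T -> R) @^-1` A) * P ((eps 0%N : T -> R) @^-1` B))%E.
  move=> mA mB; apply: HXeps; apply: sub_sigma_algebra.
    by exists 0%:Z => //; exists A => //; rewrite setTI.
  by exists 0%N => //; exists B => //; rewrite setTI.
have [Cb Cb0 Hbias] := bias_le x0 indep (HXdens 0) Hf (proj2 Hf2) HKint HK1 HKm2int
  Hd0 Hii (continuous_measurable_fun cKr) (continuous_measurable_fun cKi) Hphie0.
pose kap := (1 - theta) / (2 * a).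
have kap0 : 0 < kap by rewrite divr_gt0 ?mulr_gt0// subr_gt0.
pose q := `|beta0|.
have q0 : 0 <= q by exact: normr_ge0.
pose Q1 := 2 * (1 + q) / beta.
have Q10 : 0 < Q1 by rewrite divr_gt0// mulr_gt0// ltr_wpDr.
have [CL CL0 HCL] := @ln_powR_le R (Q1 + 2 / beta) omega
  (addr_gt0 Q10 (divr_gt0 (ltr0Sn R 1) Hbeta)) om0.
pose Kn : R := 2 * \int[@lebesgue_measure R]_u `|K u|.
have Kn0 : 0 <= Kn by rewrite mulr_ge0//; exact: Rintegral_ge0.
pose c1 : R := (2 * pi)^-1 * (Kn * Bq).
pose D2 : R := (2 * c1) ^+ 2 * kap `^ Q1.
have D20 : 0 <= D2 by apply: mulr_ge0; [exact: sqr_ge0|exact: powR_ge0].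
exists (4 * (V * D2 * CL) + 4 * (Cb ^+ 2 * d0 ^+ 2 * kap `^ (- 2 / beta))).
(* Beyond this threshold for kap * ln n, both h <= 1 and d0 / h >= 1 hold. *)
pose Lmin := Num.max 1 (d0 `^ beta).
exists (Num.truncn (expR (Lmin / kap))).+1 => // n /= Nn.
have n0 : (0 < n)%N by apply: leq_trans Nn.
have nR0 : 0 < n%:R :> R by rewrite ltr0n.
pose l : R := ln n%:R.
have lL0 : Lmin / kap <= l.
  rewrite -[leLHS]expRK /l ler_ln ?posrE ?expR_gt0//.
  apply/ltW/(lt_le_trans (truncnS_gt _)); by rewrite ler_nat.
have Lminl : Lmin <= kap * l by rewrite mulrC -ler_pdivrMr.
have L1 : 1 <= kap * l by apply: le_trans Lminl; rewrite le_max lexx.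
have L2 : d0 `^ beta <= kap * l by apply: le_trans Lminl; rewrite le_max lexx orbT.
have l0 : 0 < l by rewrite -(pmulr_rgt0 l kap0); apply: lt_le_trans L1.
have [hn01 AE A1 Ab h2] := bandwidth_rates Hd0 Ha Hbeta Ht2 L1 L2.
change (d0 * (2 * a / ((1 - theta) * l)) `^ beta^-1) with (hn n) in hn01, AE, A1, Ab, h2.
have /andP[h0 h1] := hn01.
pose E0 : R := (d0 / hn n) `^ q * expR (a * (d0 / hn n) `^ beta).
have E00 : 0 <= E0 by apply: mulr_ge0; [exact: powR_ge0|exact: expR_ge0].
pose Q := Kn * Bq * E0.
have psi_le t : Normc.normc (phiK t / phie (t / hn n)) <=
    Q * \1_(`[- d0, d0]%classic : set (measurableTypeR R)) t.
  rewrite Normc.normcM Normc.normcV.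
  have HK := phiK_le_indic HKint Hii t.
  move: HK; rewrite indicE; have [td|td] := boolP (t \in (`[- d0, d0]%classic : set (measurableTypeR R))).
    rewrite !mulr1 => HK; rewrite /Q -mulrA; apply: ler_pM => //.
    - exact: normc_ge0.
    - by rewrite invr_ge0 normc_ge0.
    rewrite /E0 mulrA; apply: HBq => //.
    rewrite normrM [X in _ * X]gtr0_norm ?invr_gt0// ler_pM2r ?invr_gt0//.
    by move: td; rewrite inE /= in_itv /= -ler_norml.
  rewrite !mulr0 => HK.
  have -> : Normc.normc (phiK t) = 0 by apply/eqP; rewrite eq_le HK normc_ge0.
  by rewrite mul0r.
have ipsi := Cintegrable_psi cKr cKi cer cei Hphie0 psi_le.
have [bR bI] := Hbias _ hn01 ipsi.
have [mR mI] := measurable_deconv_kernel Hd0 cKr cKi cer cei Hphie0 psi_le x0.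
(* The estimator is an empirical mean, with components gR and gI bounded by S. *)
pose kern (y : R) := deconv_kernel phiK phie (hn n) ((x0 - y) / hn n).
pose gR (y : R) := (hn n)^-1 * complex.Re (kern y).
pose gI (y : R) := (hn n)^-1 * complex.Im (kern y).
pose S := (hn n)^-1 * ((2 * pi)^-1 * (Q * (2 * d0))).
have mgR : measurable_fun setT (gR : measurableTypeR R -> measurableTypeR R).
  by apply: measurable_funM.
have mgI : measurable_fun setT (gI : measurableTypeR R -> measurableTypeR R).
  by apply: measurable_funM.
have gRS y : `|gR y| <= S.
  rewrite normrM gtr0_norm ?invr_gt0// ler_pM2l ?invr_gt0//.
  by have [] := deconv_kernel_Re_Im Hd0 cKr cKi cer cei Hphie0 psi_le ((x0 - y) / hn n).
have gIS y : `|gI y| <= S.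
  rewrite normrM gtr0_norm ?invr_gt0// ler_pM2l ?invr_gt0//.
  by have [] := deconv_kernel_Re_Im Hd0 cKr cKi cer cei Hphie0 psi_le ((x0 - y) / hn n).
have VR := HV gR S n n0 mgR gRS.
have VI := HV gI S n n0 mgI gIS.
have mY j : measurable_fun setT (Y j : T -> measurableTypeR R).
  by apply: measurable_funD; [exact: (measurable_funPT (X j%:Z))|exact: (measurable_funPT (eps j))].
have mean (gg : R -> R) (k : R -> R) : (forall y, gg y = (hn n)^-1 * k y) ->
    measurable_fun setT (gg : measurableTypeR R -> measurableTypeR R) ->
    (forall y, `|gg y| <= S) ->
    \int[P]_w gg (Y 0%N w) = (hn n)^-1 * \int[P]_w k (Y 0%N w).
  move=> ggE mgg ggS.
  have kE y : k y = hn n * gg y by rewrite ggE mulrA divff ?gt_eqF// mul1r.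
  under [in RHS]eq_Rintegral do rewrite kE.
  rewrite RintegralZl//; first by rewrite mulrA mulVf ?gt_eqF// mul1r.
  apply: (@bounded_integrable_prob _ _ _ P _ S); last by move=> w; exact: ggS.
  by apply: (measurableT_comp mgg); exact: mY.
have sumRe (w : T) : complex.Re (deconv_estimator phiK phie Y x0 (hn n) n w) =
    n%:R^-1 * \sum_(1 <= j < n.+1) gR (Y j w).
  rewrite /deconv_estimator ReM /= mul0r subr0 invfM -mulrA; congr (_ * _).
  rewrite (big_morph (fun z : R[i] => complex.Re z) (id1 := 0) (op1 := +%R))//.
    by rewrite mulr_sumr.
  by case=> x1 y1; case=> x2 y2.
have sumIm (w : T) : complex.Im (deconv_estimator phiK phie Y x0 (hn n) n w) =
    n%:R^-1 * \sum_(1 <= j < n.+1) gI (Y j w).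
  rewrite /deconv_estimator ImM /= mul0r addr0 invfM -mulrA; congr (_ * _).
  rewrite (big_morph (fun z : R[i] => complex.Im z) (id1 := 0) (op1 := +%R))//.
    by rewrite mulr_sumr.
  by case=> x1 y1; case=> x2 y2.
have avg_meas (gg : R -> R) : measurable_fun setT (gg : measurableTypeR R -> measurableTypeR R) ->
    measurable_fun setT (fun w => n%:R^-1 * \sum_(1 <= j < n.+1) gg (Y j w)).
  move=> mgg; apply: measurable_funM => //; apply: measurable_sum => j.
  by apply: (measurableT_comp mgg); exact: mY.
have avg_le (gg : R -> R) : (forall y, `|gg y| <= S) ->
    forall w, `|n%:R^-1 * \sum_(1 <= j < n.+1) gg (Y j w)| <= S.
  move=> ggS w; rewrite normrM gtr0_norm ?invr_gt0// mulrC ler_pdivrMr//.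
  apply: (le_trans (ler_norm_sum _ _ _)).
  apply: (@le_trans _ _ (\sum_(1 <= j < n.+1) S)); first by apply: ler_sum => j _; exact: ggS.
  by rewrite sumr_const_nat subn1 /= mulr_natr.
have biasR : `|\int[P]_w gR (Y 0%N w) - f x0| <= Cb * hn n.
  by rewrite (mean gR (fun y => complex.Re (kern y))).
have biasI : `|\int[P]_w gI (Y 0%N w)| <= Cb * hn n.
  by rewrite (mean gI (fun y => complex.Im (kern y))).
apply: (le_trans (mse_le (avg_meas _ mgR) (avg_meas _ mgI) (avg_le _ gRS) (avg_le _ gIS)
  sumRe sumIm VR VI biasR biasI)).
rewrite lee_fin [leRHS]mulrDl; apply: lerD.
  rewrite -[leRHS]mulrA ler_pM2l//.
  have SE : S ^+ 2 = D2 * l `^ Q1 * n%:R `^ (1 - theta).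
    have := @kernel_sup_rate R d0 a beta theta q l (hn n) c1 Hd0 Ha Hbeta Ht2 q0 l0 h0 AE Ab.
    rewrite -/E0 -/kap -/Q1 -/D2.
    have -> : (hn n)^-1 * (c1 * (E0 * (2 * d0))) = S by rewrite /S /Q /c1; ring.
    by move=> ->; rewrite /powR (gt_eqF nR0).
  rewrite SE.
  have -> : V * (D2 * l `^ Q1 * n%:R `^ (1 - theta)) * n%:R `^ (eta - p) =
      V * (D2 * l `^ Q1) * n%:R `^ (- omega).
    have <- : n%:R `^ (1 - theta) * n%:R `^ (eta - p) = n%:R `^ (- omega) :> R.
      by rewrite -ep [RHS]powRD ?(gt_eqF nR0) ?implybT.
    by ring.
  have := log_power_absorb V0 D20 l0 nR0 (HCL n n0).
  by rewrite mulNr.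
rewrite exprMn h2 powRM ?(ltW kap0) ?(ltW l0)//.
by rewrite le_eqVlt; apply/orP; left; apply/eqP; ring.
Qed.
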